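(* Let $n\ge2$, $d\ge2$, $\mathfrak m=(x_1,\dots,x_n)\subset\mathbf k[\mathbf x]$, $A_d=\mathbf k[\mathbf x]/\mathfrak m^d$ and $G=\operatorname{Aut}_{\mathbf k}(A_d)$. Let $H\subseteq G$ be the subgroup generated by the maximal torus $T$ and the root subgroups $U_\alpha$ with $\alpha\in\mathcal R(\mathfrak m^d)$ outer. Then $H=G^{\mathrm{Jac}}$. Moreover, $$\operatorname{Lie}(H)=\mathfrak g_0\oplus\bigoplus_{\alpha\text{ outer}}\mathfrak g_\alpha\oplus\bigoplus_{\alpha\text{ inner}}\{\overline\partial\in\mathfrak g_\alpha : \operatorname{div}(\overline\partial)=0\},$$ where $\alpha$ runs over the outer, respectively inner, roots of $\mathfrak m^d$; so $H$ has codimension $\binom{n+d-2}{n}-1$ in $G$, which is the number of inner roots.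
   Context: $\mathbf k$ is an algebraically closed field of characteristic zero, $\mathbf k[\mathbf x]=\mathbf k[x_1,\dots,x_n]$, $\mathbf x^m=x_1^{m_1}\cdots x_n^{m_n}$, $e_1,\dots,e_n$ is the canonical basis of $\mathbb Z^n$ and $e_i^*$ the dual basis of $N_{\mathbf k}=\operatorname{Hom}(\mathbb Z^n,\mathbf k)$. For $\alpha\in\mathbb Z^n$, $p\in N_{\mathbf k}$, $\partial_{\alpha,p}$ is the derivation $\mathbf x^m\mapsto p(m)\mathbf x^{m+\alpha}$ of $\mathbf k[\mathbf x]$ (when it maps $\mathbf k[\mathbf x]$ to itself), and $\overline\partial_{\alpha,p}$ the induced derivation of $A_d$ when $\mathfrak m^d$ is preserved. A root is an $\alpha\neq0$ such that $A_d$ has a nonzero homogeneous derivation of degree $\alpha$; $\mathcal R(\mathfrak m^d)$ is the set of roots; a root is inner if it lies in $\mathbb Z^n_{\ge0}$, outer otherwise. An outer root $\alpha$ has exactly one negative coordinate, $\alpha_j=-1$, and the derivations of degree $\alpha$ are the multiples of $\overline\partial_{\alpha,e_j^*}$. $\operatorname{Lie}(G)=\operatorname{Der}_{\mathbf k}(A_d)=\mathfrak g_0\oplus\bigoplus_{\alpha\in\mathcal R(\mathfrak m^d)}\mathfrak g_\alpha$, where $\mathfrak g_\alpha$ is the space of homogeneous derivations of degree $\alpha$ and $\mathfrak g_0=\operatorname{Lie}(T)$, $T$ being the torus acting by $\overline x_i\mapsto t_i\overline x_i$. For an outer root, $U_\alpha=\{\exp(t\overline\partial_{\alpha,e_j^*}):t\in\mathbf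 k\}$. Jacobian: every class in $A_d$ has a unique representative of degree $<d$. For $\varphi\in G$ let $F_i$ be the representative of degree $<d$ of $\varphi(\overline x_i)$ and put $\mathrm{Jac}(\varphi)=\det(\partial F_i/\partial x_j)_{i,j}\in\mathbf k[\mathbf x]/\mathfrak m^{d-1}$. $G^{\mathrm{Jac}}=\{\varphi\in G:\mathrm{Jac}(\varphi)\in\mathbf k^\times\}$ (a subgroup of $G$). Divergence: $\operatorname{div}\colon\operatorname{Der}(A_d)\to\mathbf k[\mathbf x]/\mathfrak m^{d-1}$ is $\operatorname{div}(\sum_i f_i\,\partial/\partial x_i)=\sum_i\partial f_i/\partial x_i$, computed on any lift to $\operatorname{Der}(\mathbf k[\mathbf x])$. *)

(* Defs.v *)
From HB Require Import structures.
From mathcomp Require Import all_boot all_order all_algebra.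
From mathcomp Require Import mpoly.

Set Implicit Arguments.
Unset Strict Implicit.
Unset Printing Implicit Defensive.

Import Order.TTheory GRing.Theory Num.Theory.
Local Open Scope ring_scope.
Local Open Scope quotient_scope.

(** * The ideal m^d and the algebra A_d = k[x]/m^d *)

Section PowerOfMaximalIdeal.
Variables (k : fieldType) (n d : nat).
Implicit Types (p q : {mpoly k[n]}) (m : 'X_{1..n}).

(* Decidable form of m^d: every monomial has total degree at least d.  That
   this is the d-th power of the ideal (x_1, ..., x_n) is mpowP below. *)
Definition mpow : {pred {mpoly k[n]}} :=
  [pred p | all (fun m => d <= mdeg m)%N (msupp p)].

Lemma mpow_coeffP p :
  reflect (forall m, (mdeg m < d)%N -> p@_m = 0) (p \in mpow).
Proof.
apply: (iffP allP) => [h m lt_md|h m].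
  by apply/eqP; apply: contraLR lt_md; rewrite -mcoeff_msupp -leqNgt; apply: h.
by rewrite mcoeff_msupp => nz; rewrite leqNgt; apply: contra nz => /h ->.
Qed.

Lemma mpowMl q p : p \in mpow -> q * p \in mpow.
Proof.
move/mpow_coeffP=> h; apply/mpow_coeffP => m lt_md.
rewrite mcoeffM big1 // => -[m1 m2] /= /eqP eqm.
have := congr1 mdeg eqm; rewrite mdegD => deg_m.
by rewrite (h m2) ?mulr0 //; apply: leq_ltn_trans lt_md;
  apply: leq_trans (leq_addl _ _) (eq_leq (esym deg_m)).
Qed.

Lemma mpow_zmod_closed : zmod_closed mpow.
Proof.
split=> [|p q /mpow_coeffP hp /mpow_coeffP hq]; apply/mpow_coeffP => m lt_md.
  by rewrite mcoeff0.
by rewrite mcoeffB hp // hq // subrr.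
Qed.

HB.instance Definition _ :=
  GRing.isZmodClosed.Build {mpoly k[n]} mpow mpow_zmod_closed.

Lemma mpowP p :
  p \in mpow <->
  exists s : seq ({mpoly k[n]} * d.-tuple 'I_n),
    p = \sum_(u <- s) u.1 * \prod_(i <- u.2) 'X_i.
Proof.
split=> [hp|[s ->]].
  have mon m : (d <= mdeg m)%N ->
      exists u : {mpoly k[n]} * d.-tuple 'I_n,
        'X_[m] = u.1 * \prod_(i <- u.2) 'X_i.
    elim: d m => [|e IHe] m le_em.
      by exists ('X_[m], [tuple]); rewrite big_nil mulr1.
    have [i mi_gt0] : exists i, (0 < m i)%N.
      apply/existsP; apply: contraLR le_em => /existsPn m0.
      suff -> : mdeg m = 0%N by [].
      by rewrite mdegE big1 // => i _; apply/eqP; rewrite -leqn0 leqNgt m0.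
    have defm : m = (m - U_(i) + U_(i))%MM.
      by rewrite submK //; apply/mnm_lepP => j; rewrite mnm1E; case: eqP => // <-.
    have /IHe [[q t] /= eq_q] : (e <= mdeg (m - U_(i))%MM)%N.
      by move: le_em; rewrite {1}defm mdegD mdeg1 addn1 ltnS.
    exists (q, [tuple of i :: t]).
    by rewrite big_cons /= defm mpolyXD eq_q [_ * 'X_i]mulrC mulrCA.
  rewrite (mpolyE p); move/allP: hp.
  elim: (msupp p) => [|m s IHs] hs; first by exists [::]; rewrite !big_nil.
  have [|t eq_t] := IHs; first by move=> m' m's; apply: hs; rewrite inE m's orbT.
  have [|u eq_u] := mon m; first by apply: hs; rewrite mem_head.
  by exists ((p@_m *: u.1, u.2) :: t); rewrite !big_cons eq_t /= eq_u scalerAl.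
apply: rpred_sum => u _; apply: mpowMl.
have -> : \prod_(i <- u.2) 'X_i =
    'X_[(\sum_(i <- u.2) U_(i))%MM] :> {mpoly k[n]}.
  by elim/big_rec2: _ => [|i m q _ ->]; rewrite ?mpolyX0 // mpolyXD.
apply/mpow_coeffP => m; rewrite mcoeffX; case: eqP => // <-.
rewrite mdeg_sum; under eq_bigr do rewrite mdeg1.
by rewrite big_const_seq count_predT size_tuple iter_addn_0 mul1n ltnn.
Qed.

End PowerOfMaximalIdeal.
Arguments mpow : clear implicits.

Definition jet (k : fieldType) (n d : nat) := Quotient.quot (mpow k n d).

HB.instance Definition _ k n d := GRing.Zmodule.on (jet k n d).
HB.instance Definition _ k n d := EqQuotient.on (jet k n d).

Section JetAlgebra.
Variables (k : fieldType) (n d : nat).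
Local Notation A := (jet k n d).
Local Notation P := {mpoly k[n]}.

(* The class of p modulo m^d. *)
Definition jpi (p : P) : A := \pi_A p.

Lemma jpi_eq p q : (jpi p == jpi q) = (p - q \in mpow k n d).
Proof. by rewrite Quotient.idealrBE. Qed.

Lemma jpi_repr (a : A) : jpi (repr a) = a.
Proof. exact: reprK. Qed.

Lemma jpi_is_zmod_morphism : zmod_morphism jpi.
Proof. exact: pi_is_zmod_morphism. Qed.
HB.instance Definition _ :=
  GRing.isZmodMorphism.Build P A jpi jpi_is_zmod_morphism.

Definition jone : A := jpi 1.
Definition jmul (a b : A) : A := jpi (repr a * repr b).
Definition jscale (c : k) (a : A) : A := jpi (c *: repr a).

Lemma jpiM p q : jpi (p * q) = jmul (jpi p) (jpi q).
Proof.
apply/eqP; rewrite jpi_eq.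
have hr r : r - repr (jpi r) \in mpow k n d by rewrite -jpi_eq jpi_repr.
have -> : p * q - repr (jpi p) * repr (jpi q) =
    p * (q - repr (jpi q)) + repr (jpi q) * (p - repr (jpi p)).
  by rewrite !mulrBr [repr (jpi q) * p]mulrC addrA subrK [_ * repr (jpi p)]mulrC.
by apply: rpredD; apply: mpowMl.
Qed.

Lemma jpiZ c p : jpi (c *: p) = jscale c (jpi p).
Proof.
by apply/eqP; rewrite jpi_eq -scalerBr -mul_mpolyC mpowMl // -jpi_eq jpi_repr.
Qed.

Fact jmulA : associative jmul.
Proof.
move=> a b c; rewrite -[a]jpi_repr -[b]jpi_repr -[c]jpi_repr.
by rewrite -!jpiM mulrA.
Qed.
Fact jmulC : commutative jmul.
Proof. by move=> a b; rewrite /jmul mulrC. Qed.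
Fact jmul1 : left_id jone jmul.
Proof. by move=> a; rewrite -[a]jpi_repr -jpiM mul1r. Qed.
Fact jmulDl : left_distributive jmul +%R.
Proof.
move=> a b c; rewrite -[a]jpi_repr -[b]jpi_repr -[c]jpi_repr.
by rewrite -raddfD -!jpiM -raddfD mulrDl.
Qed.
HB.instance Definition _ :=
  GRing.Zmodule_isComPzRing.Build A jmulA jmulC jmul1 jmulDl.

Fact jscaleA a b v : jscale a (jscale b v) = jscale (a * b) v.
Proof. by rewrite -[v]jpi_repr -!jpiZ scalerA. Qed.
Fact jscale1 : left_id 1 jscale.
Proof. by move=> v; rewrite -[v]jpi_repr -jpiZ scale1r. Qed.
Fact jscaleDr : right_distributive jscale +%R.
Proof.
move=> c u v; rewrite -[u]jpi_repr -[v]jpi_repr.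
by rewrite -raddfD -!jpiZ -raddfD scalerDr.
Qed.
Fact jscaleDl v : {morph jscale^~ v : a b / a + b}.
Proof. by move=> a b; rewrite -[v]jpi_repr -!jpiZ -raddfD scalerDl. Qed.
HB.instance Definition _ :=
  GRing.Zmodule_isLmodule.Build k A jscaleA jscale1 jscaleDr jscaleDl.

Fact jscaleAl (c : k) (u v : A) : c *: (u * v) = (c *: u) * v.
Proof.
have eM p q : jpi p * jpi q = jpi (p * q) by rewrite jpiM.
have eZ p : c *: jpi p = jpi (c *: p) by rewrite jpiZ.
by rewrite -[u]jpi_repr -[v]jpi_repr !(eM, eZ) scalerAl.
Qed.

Lemma jpi_is_monoid_morphism : monoid_morphism jpi.
Proof. by split=> // p q; rewrite jpiM. Qed.
HB.instance Definition _ :=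
  GRing.isMonoidMorphism.Build P A jpi jpi_is_monoid_morphism.
Lemma jpi_is_scalable : scalable jpi.
Proof. by move=> c p; rewrite jpiZ. Qed.
HB.instance Definition _ :=
  GRing.isScalable.Build k P A *:%R jpi jpi_is_scalable.

Lemma jpi_surj (a : A) : exists p, jpi p = a.
Proof. by exists (repr a); rewrite jpi_repr. Qed.

(* The representative of degree < d. *)
Definition jrep (a : A) : P :=
  \sum_(m : 'X_{1..n < d}) (repr a)@_m *: 'X_[m].

Lemma mcoeff_jrep a (m : 'X_{1..n}) :
  (jrep a)@_m = if (mdeg m < d)%N then (repr a)@_m else 0.
Proof.
rewrite /jrep raddf_sum /=; case: ifP => [lt_md|ge_md].
  rewrite (bigD1 (BMultinom lt_md)) //= mcoeffZ mcoeffX eqxx mulr1 big1 ?addr0 //.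
  by move=> m' neq; rewrite mcoeffZ mcoeffX -val_eqE /= in neq *; rewrite (negPf neq) mulr0.
rewrite big1 // => m' _; rewrite mcoeffZ mcoeffX.
case: eqP => [eqm|_]; last by rewrite mulr0.
by rewrite -eqm bmdeg in ge_md.
Qed.

Lemma jrepK a : jpi (jrep a) = a.
Proof.
rewrite -[RHS]jpi_repr; apply/eqP; rewrite jpi_eq; apply/mpow_coeffP => m lt_md.
by rewrite mcoeffB mcoeff_jrep lt_md subrr.
Qed.

Lemma msize_jrep a : (msize (jrep a) <= d)%N.
Proof.
rewrite mmeasureE; apply/bigmax_leqP_seq => m; rewrite mcoeff_msupp mcoeff_jrep.
by case: ifP; rewrite ?eqxx.
Qed.

Lemma jrep_uniq a p : (msize p <= d)%N -> jpi p = a -> p = jrep a.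
Proof.
move=> szp eqa; apply/mpolyP => m.
case: (ltnP (mdeg m) d) => [lt_md|le_dm]; last first.
  rewrite mcoeff_jrep ltnNge le_dm /= memN_msupp_eq0 //.
  by apply/negP => /msize_mdeg_lt; rewrite ltnNge (leq_trans szp).
have /eqP : jpi p = jpi (jrep a) by rewrite jrepK.
rewrite jpi_eq => /mpow_coeffP /(_ m lt_md).
by rewrite mcoeffB => /eqP; rewrite subr_eq0 => /eqP.
Qed.

Let N := #|{: 'X_{1..n < d}}|.
Let jcoord (a : A) : 'rV[k]_N := \row_i (jrep a)@_(enum_val i : 'X_{1..n < d}).

Lemma jet_vect_axiom : Vector.axiom N A.
Proof.
have eq_rep p (m : 'X_{1..n < d}) : (repr (jpi p))@_m = p@_m.
  have /mpow_coeffP/(_ m (bmdeg m)) : repr (jpi p) - p \in mpow k n d.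
    by rewrite -jpi_eq jpi_repr.
  by rewrite mcoeffB => /eqP; rewrite subr_eq0 => /eqP.
exists jcoord.
  move=> c u v; apply/rowP => i; rewrite !mxE !mcoeff_jrep !bmdeg.
  by rewrite -{1}[u]jpi_repr -{1}[v]jpi_repr -linearP eq_rep mcoeffD mcoeffZ.
pose inv (r : 'rV[k]_N) :=
  jpi (\sum_(m : 'X_{1..n < d}) r 0 (enum_rank m) *: 'X_[m]).
exists inv => [a|r].
  rewrite -[RHS]jrepK /inv /jrep; congr jpi; apply: eq_bigr => m _.
  by rewrite mxE enum_rankK mcoeff_jrep bmdeg.
apply/rowP => i; rewrite mxE mcoeff_jrep bmdeg eq_rep raddf_sum /=.
rewrite (bigD1 (enum_val i)) //= mcoeffZ mcoeffX eqxx mulr1 enum_valK.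
rewrite big1 ?addr0 // => m' neq; rewrite mcoeffZ mcoeffX -val_eqE /= in neq *.
by rewrite (negPf neq) mulr0.
Qed.
HB.instance Definition _ := Lmodule_hasFinDim.Build k A jet_vect_axiom.

End JetAlgebra.

(** * Zariski geometry in a finite-dimensional vector space *)

Section Zariski.
Variables (k : fieldType) (V : vectType k).
Local Notation N := (\dim {:V}).
Implicit Types (X Y : V -> Prop) (v : V).

Definition coords v : 'I_N -> k := fun i => coord (vbasis {:V}) i v.

Definition vanishes_on (P : {mpoly k[N]}) X : Prop :=
  forall v, X v -> P.@[coords v] = 0.

(* Zariski tangent space at x of the closure of X. *)
Definition tangent_at X (x v : V) : Prop :=
  forall P : {mpoly k[N]}, vanishes_on P X ->
    \sum_i (P^`M(i)).@[coords x] * coords v i = 0.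

Definition alg_independent_on X r (f : r.-tuple {mpoly k[N]}) : Prop :=
  forall Q : {mpoly k[r]}, vanishes_on (Q \mPo f) X -> Q = 0.

(* The dimension is the transcendence degree of the coordinate ring of the
   closure of X, i.e. the largest number of algebraically independent
   regular functions; it applies to locally closed X. *)
Definition has_dimension X (r : nat) : Prop :=
  (exists f : r.-tuple {mpoly k[N]}, alg_independent_on X f) /\
  (forall s (f : s.-tuple {mpoly k[N]}), alg_independent_on X f -> (s <= r)%N).

Definition has_codimension_in X Y (c : nat) : Prop :=
  exists r, has_dimension X r /\ has_dimension Y (r + c).

(* W is the internal direct sum of the subspaces L i, for i satisfying J. *)
Definition internal_direct_sum (I : eqType) (J : I -> Prop)
    (L : I -> V -> Prop) (W : V -> Prop) : Prop :=
  (forall v, W v <-> exists (s : seq I) (f : I -> V),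
     [/\ uniq s, forall i, i \in s -> J i /\ L i (f i)
       & v = \sum_(i <- s) f i]) /\
  (forall (s : seq I) (f : I -> V), uniq s ->
     (forall i, i \in s -> J i /\ L i (f i)) ->
     \sum_(i <- s) f i = 0 -> forall i, i \in s -> f i = 0).

End Zariski.

Section LinearGroups.
Variables (k : fieldType) (V : vectType k).

(* Lie algebra of a closed subgroup X of GL(V): since GL(V) is open in
   End(V), this is the tangent space at the identity computed in End(V). *)
Definition Lie (X : 'End(V) -> Prop) : 'End(V) -> Prop := tangent_at X \1%VF.

Inductive gen_subgroup (S : 'End(V) -> Prop) : 'End(V) -> Prop :=
| gen_subgroup_one : gen_subgroup S \1%VF
| gen_subgroup_mem f : S f -> gen_subgroup S f
| gen_subgroup_mul f g :
    gen_subgroup S f -> gen_subgroup S g -> gen_subgroup S (f \o g)%VF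
| gen_subgroup_inv f : gen_subgroup S f -> gen_subgroup S (f^-1)%VF.

(* phi = exp D, for a nilpotent endomorphism D. *)
Definition is_exp (D phi : 'End(V)) : Prop :=
  exists2 r : nat, forall v, iter r D v = 0
    & forall v, phi v = \sum_(i < r) (i`!%:R)^-1 *: iter i D v.

End LinearGroups.

(** * Automorphisms and derivations of A_d *)

Section AutDer.
Variables (k : fieldType) (n d : nat).
Local Notation A := (jet k n d).
Local Notation Zn := {ffun 'I_n -> int}.
Implicit Types (phi D : 'End(A)) (alpha beta : Zn).

Definition is_aut phi : Prop :=
  [/\ bijective phi, phi 1 = 1 & forall a b, phi (a * b) = phi a * phi b].

Definition is_der D : Prop := forall a b, D (a * b) = a * D b + D a * b.

Definition torus phi : Prop :=
  is_aut phi /\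
  exists2 t : 'I_n -> k, forall i, t i != 0
    & forall i, phi (jpi d 'X_i) = t i *: jpi d 'X_i.

(* The Laurent monomial x^beta, replaced by 0 when it is not a monomial. *)
Definition xmon beta : {mpoly k[n]} :=
  if [forall i, 0 <= beta i] then 'X_[[multinom `|beta i|%N | i < n]] else 0.

Definition expZ (m : 'X_{1..n}) : Zn := [ffun i => (m i)%:Z].

Definition homogeneous alpha D : Prop :=
  forall beta a, (exists c, a = c *: jpi d (xmon beta)) ->
    exists c, D a = c *: jpi d (xmon (beta + alpha)).

(* The space g_alpha of homogeneous derivations of degree alpha. *)
Definition der_piece alpha D : Prop := is_der D /\ homogeneous alpha D.

Definition jet_root alpha : Prop :=
  alpha != 0 /\ exists2 D, D != 0 & der_piece alpha D.

Definition inner_root alpha : Prop := jet_root alpha /\ forall i, 0 <= alpha i.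
Definition outer_root alpha : Prop := jet_root alpha /\ ~ forall i, 0 <= alpha i.

Definition dualb (j : 'I_n) (beta : Zn) : k := (beta j)%:~R.

(* The derivation x^m |-> p(m) x^(m + alpha).  It is meaningful when p(m) = 0
   whenever m + alpha has a negative coordinate, as for p = e_j^* and alpha
   with alpha_j = -1 and all other coordinates nonnegative. *)
Definition pder alpha (p : Zn -> k) (f : {mpoly k[n]}) : {mpoly k[n]} :=
  \sum_(m <- msupp f) (f@_m * p (expZ m)) *: xmon (expZ m + alpha).

Definition induces (delta : {mpoly k[n]} -> {mpoly k[n]}) D : Prop :=
  forall f, D (jpi d f) = jpi d (delta f).

Definition root_subgroup alpha phi : Prop :=
  exists j, alpha j = -1 /\
  exists D, induces (pder alpha (dualb j)) D /\
  exists t : k, is_exp (t *: D) phi.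

Definition subgroupH : 'End(A) -> Prop :=
  gen_subgroup (fun phi => torus phi \/
    exists alpha, outer_root alpha /\ root_subgroup alpha phi).

(* The classes modulo m^(d-1) of the Jacobian determinant of phi and of the
   divergence of D are computed on the representatives of degree < d; the
   latter does not depend on the lift, see divergenceE. *)
Definition Jac phi : jet k n d.-1 :=
  jpi d.-1 (\det (\matrix_(i, j) (jrep (phi (jpi d 'X_i)))^`M(j))).

Definition GJac phi : Prop :=
  is_aut phi /\ exists2 c : k, c != 0 & Jac phi = jpi d.-1 c%:MP.

Definition divergence D : jet k n d.-1 :=
  jpi d.-1 (\sum_i (jrep (D (jpi d 'X_i)))^`M(i)).

Lemma divergenceE D (f : 'I_n -> {mpoly k[n]}) :
  (forall i, jpi d (f i) = D (jpi d 'X_i)) ->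
  divergence D = jpi d.-1 (\sum_i (f i)^`M(i)).
Proof.
move=> hf; rewrite /divergence !raddf_sum /=; apply: eq_bigr => i _; apply/eqP.
rewrite jpi_eq -mderivB; apply/mpow_coeffP => m lt_m.
have /mpow_coeffP h : jrep (D (jpi d 'X_i)) - f i \in mpow k n d.
  by rewrite -jpi_eq jrepK hf.
by rewrite mcoeff_deriv h ?mul0rn // mdegD mdeg1 addn1 -ltn_predRL.
Qed.

(* The summand of Lie(H) of degree alpha. *)
Definition LieH_piece alpha D : Prop :=
  [\/ alpha = 0 /\ Lie torus D,
      outer_root alpha /\ der_piece alpha D
    | inner_root alpha /\ der_piece alpha D /\ divergence D = 0].

End AutDer.

(* Main.v *)
Require Import Defs.
From HB Require Import structures.
From mathcomp Require Import all_boot all_order all_fingroup all_algebra.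
From mathcomp Require Import mpoly.
From mathcomp Require Import ring.

Set Implicit Arguments.
Unset Strict Implicit.
Unset Printing Implicit Defensive.

Import Order.TTheory GRing.Theory Num.Theory.
Local Open Scope ring_scope.

(** An automorphism of A_d is given by the tuple F of the images of the
    variables, taken modulo m^d and without constant term; [amap] and [dmap]
    turn tuples into endomorphisms and derivations of A_d.

    The group. By the chain rule [jac_comp], the automorphisms with constant
    Jacobian determinant form a group. It contains the torus and, since a
    polynomial automorphism of k[x] has constant Jacobian determinant, the root
    subgroups: for an outer root these consist of the maps
    x_j |-> x_j + c x^m, where x^m does not involve x_j ([exp_elem]). Conversely,
    factor an automorphism with constant Jacobian determinant as a linear one,
    generated by the diagonal and elementary matrices ([GL_generated]), and one
    tangent to the identity. If the latter is x + F + (higher terms), with F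
    homogeneous of degree e, then the Jacobian determinant is
    1 + div F + (higher terms) by [jac_perturb], so div F = 0. Every homogeneous
    field of divergence zero is a linear combination of shears, which are
    conjugates of outer root fields by transvections ([divfree_span]): a shear
    depends polynomially on the parameter t of the transvection, and its
    coefficients in t are recovered by inverting a Vandermonde matrix. Hence some
    element of H has the leading term - F; composing with it raises the order of
    contact with the identity, and after d steps the automorphism is trivial
    ([near_id_H]).

    The Lie algebra. The velocities of polynomial curves in H are tangent to H
    ([tangent_curve]); conjugates of root subgroups yield the shears, hence all
    homogeneous fields of divergence zero, and the torus yields degree zero. In
    the other direction, multiplicativity and the higher coefficients of the
    Jacobian determinant are polynomial equations of H, and their differentials
    at the identity say that a tangent vector is a derivation whose divergence
    is constant ([tangent_line], [Lie_der], [Lie_H_div]). Splitting such a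
    derivation into homogeneous components gives the direct sum.

    The dimensions. Both groups consist of products of an arbitrary linear
    automorphism and of one tangent to the identity with arbitrarily prescribed
    coefficients at certain monomials: at all those of degree at least 2 for the
    full group, and for H at all of them but the x^(a + e_i0) in the component
    i0, where a is the degree of an inner root. Indeed the part of degree a of
    the Jacobian condition determines that coefficient as a polynomial in the
    others ([ustep_jac], [jac_unique]). Such a parametrization computes the
    dimension ([dimension_param], [dimension_LU]), so the codimension is the
    number of the exponents a, which is the number of inner roots. *)

(** * Polynomials, substitution and the filtration by powers of m *)

Section MonomialInduction.
Variable n : nat.

Lemma mnm_neq0P (m : 'X_{1..n}) : m != 0%MM -> exists i, m i != 0%N.
Proof.
move=> m_neq0; apply/existsP; apply: contraNT m_neq0.
rewrite negb_exists => /forallP m0; apply/eqP/mnmP => i; rewrite mnm0E.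
by apply/eqP; have := m0 i; rewrite negbK.
Qed.

Lemma mnm_ind (Q : 'X_{1..n} -> Prop) :
  Q 0%MM -> (forall m i, Q m -> Q (m + U_(i))%MM) -> forall m, Q m.
Proof.
move=> Q0 QS m; have [e] := ubnP (mdeg m); elim: e m => // e IHe m.
rewrite ltnS => le_m; have [->//|m_neq0] := eqVneq m 0%MM.
have [i mi] := mnm_neq0P m_neq0.
have defm : (m - U_(i) + U_(i))%MM = m by rewrite submK // lep1mP.
rewrite -defm; apply: QS; apply: IHe.
by move: le_m; rewrite -{1}defm mdegD mdeg1 addn1.
Qed.

End MonomialInduction.

Section PolyInduction.
Variables (k : comNzRingType) (n : nat).
Local Notation P := {mpoly k[n]}.

Lemma mpoly_gen_ind (Q : P -> Prop) :
    (forall c, Q c%:MP) -> (forall i, Q 'X_i) ->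
    (forall p q, Q p -> Q q -> Q (p + q)) ->
    (forall p q, Q p -> Q q -> Q (p * q)) ->
  forall p, Q p.
Proof.
move=> QC QX QD QM; elim/mpolyind => [|c m p _ _ Qp]; first exact: (QC 0).
apply: (QD) => //; rewrite -mul_mpolyC; apply: (QM) => //.
elim/mnm_ind: m => [|m i Qm]; first by rewrite mpolyX0; apply: (QC 1).
by rewrite mpolyXD; apply: (QM).
Qed.

Lemma mderivXU i j : ('X_i : P)^`M(j) = (i == j)%:R.
Proof.
rewrite mderivX mnm1E; case: eqVneq => [->|_]; last by rewrite scale0r.
rewrite scale1r (_ : (U_(j) - U_(j))%MM = 0%MM) ?mpolyX0 //.
by apply/mnmP => l; rewrite mnmBE subnn mnm0E.
Qed.

(** Both sides are derivations along g, and they agree on the generators.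
    The chain rule, the derivative along a curve and the shape of a derivation
    of a quotient algebra are all instances. *)
Lemma der_along_gens (B : comPzRingType) (g : {rmorphism P -> B}) (delta : P -> B) :
    (forall c, delta c%:MP = 0) ->
    (forall p q, delta (p + q) = delta p + delta q) ->
    (forall p q, delta (p * q) = g p * delta q + g q * delta p) ->
  forall p, delta p = \sum_i g p^`M(i) * delta 'X_i.
Proof.
move=> dC dD dM; apply: mpoly_gen_ind => [c|i|p q dp dq|p q dp dq].
- by rewrite dC big1 // => i _; rewrite mderivC rmorph0 mul0r.
- rewrite (bigD1 i) //= mderivXU eqxx rmorph1 mul1r big1 ?addr0 // => j ne_ji.
  by rewrite mderivXU eq_sym (negPf ne_ji) rmorph0 mul0r.
- rewrite dD dp dq -big_split; apply: eq_bigr => i _ /=.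
  by rewrite mderivD rmorphD mulrDl.
- rewrite dM dp dq !mulr_sumr -big_split; apply: eq_bigr => i _ /=.
  by rewrite mderivM rmorphD !rmorphM mulrDl addrC -!mulrA [g q * (_ * _)]mulrCA.
Qed.

End PolyInduction.

Section MaximalIdealPowers.
Variables (k : fieldType) (n : nat).
Local Notation P := {mpoly k[n]}.
Implicit Types (p q : P) (m : 'X_{1..n}) (e f : nat).

Lemma mpow_coeff0 e p m : p \in mpow k n e -> (mdeg m < e)%N -> p@_m = 0.
Proof. by move/mpow_coeffP; apply. Qed.

Lemma mpow_leq e f p : (e <= f)%N -> p \in mpow k n f -> p \in mpow k n e.
Proof.
move=> le_ef hp; apply/mpow_coeffP => m lt_m.
by apply: mpow_coeff0 hp _; apply: leq_trans le_ef.
Qed.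

Lemma mpow0 p : p \in mpow k n 0.
Proof. by apply/mpow_coeffP. Qed.

Lemma mpowZ e c p : p \in mpow k n e -> c *: p \in mpow k n e.
Proof. by move=> hp; rewrite -mul_mpolyC; apply: mpowMl. Qed.

Lemma mpowX m : 'X_[m] \in mpow k n (mdeg m).
Proof.
by apply/mpow_coeffP => m'; rewrite mcoeffX; case: eqP => // ->; rewrite ltnn.
Qed.

Lemma mpow_ind e (Q : P -> Prop) : Q 0 ->
    (forall p q, Q p -> Q q -> Q (p + q)) ->
    (forall c m, (e <= mdeg m)%N -> Q (c *: 'X_[m])) ->
  forall p, p \in mpow k n e -> Q p.
Proof.
move=> Q0 QD QX p /allP hp; rewrite (mpolyE p) big_seq.
by apply: big_ind => // m /hp; apply: QX.
Qed.

Lemma mpowM e f p q :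
  p \in mpow k n e -> q \in mpow k n f -> p * q \in mpow k n (e + f).
Proof.
move=> hp hq; apply/mpow_coeffP => m lt_m; rewrite mcoeffM big1 //.
move=> -[m1 m2] /= /eqP eqm; have deg_m := congr1 mdeg eqm.
rewrite mdegD in deg_m; have [lt1|ge1] := ltnP (mdeg m1) e.
  by rewrite (mpow_coeff0 hp) ?mul0r.
rewrite (mpow_coeff0 hq) ?mulr0 // -(ltn_add2l e).
by apply: leq_ltn_trans lt_m; apply: leq_trans (eq_leq (esym deg_m)); rewrite leq_add2r.
Qed.

Lemma mpowMr e p q : p \in mpow k n e -> p * q \in mpow k n e.
Proof. by rewrite mulrC; apply: mpowMl. Qed.

Lemma mpow_deriv e p i : p \in mpow k n e -> p^`M(i) \in mpow k n e.-1.
Proof.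
move=> hp; apply/mpow_coeffP => m lt_m; rewrite mcoeff_deriv.
by rewrite (mpow_coeff0 hp) ?mul0rn // mdegD mdeg1 addn1 -ltn_predRL.
Qed.

Lemma mpow1E p : (p \in mpow k n 1) = (p@_0%MM == 0).
Proof.
apply/mpow_coeffP/eqP => [-> //|p0 m]; first by rewrite mdeg0.
by rewrite ltnS leqn0 mdeg_eq0 => /eqP ->.
Qed.

End MaximalIdealPowers.

Section Substitution.
Variables (k : fieldType) (n : nat).
Local Notation P := {mpoly k[n]}.
Local Notation vf := {ffun 'I_n -> P}.
Implicit Types (p q : P) (m : 'X_{1..n}) (e f : nat) (F G : vf).

(** Locked, as unification would otherwise unfold it down to finite sums. *)
Fact msub_key : unit. Proof. exact: tt. Qed.
Definition msub F : P -> P :=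
  locked_with msub_key (comp_mpoly [tuple F i | i < n]).

Lemma msubE F p : msub F p = p \mPo [tuple F i | i < n].
Proof. by rewrite /msub locked_withE. Qed.

Fact msub_is_zmod_morphism F : zmod_morphism (msub F).
Proof. by move=> p q; rewrite !msubE raddfB. Qed.
Fact msub_is_monoid_morphism F : monoid_morphism (msub F).
Proof. by split=> [|p q]; rewrite !msubE (rmorph1, rmorphM). Qed.
Fact msub_is_scalable F : scalable (msub F).
Proof. by move=> c p; rewrite !msubE linearZ. Qed.
HB.instance Definition _ F :=
  GRing.isZmodMorphism.Build P P (msub F) (msub_is_zmod_morphism F).
HB.instance Definition _ F :=
  GRing.isMonoidMorphism.Build P P (msub F) (msub_is_monoid_morphism F).
HB.instance Definition _ F :=
  GRing.isScalable.Build k P P *:%R (msub F) (msub_is_scalable F).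

Lemma msubX F i : msub F 'X_i = F i.
Proof. by rewrite msubE comp_mpolyXU -tnth_nth tnth_mktuple. Qed.

Lemma msubC F c : msub F c%:MP = c%:MP.
Proof. by rewrite msubE comp_mpolyC. Qed.

Definition idvf : vf := [ffun i => 'X_i].

Lemma msub_idvf p : msub idvf p = p.
Proof.
elim/mpoly_gen_ind: p => [c|i|p q|p q]; rewrite ?msubC ?msubX ?ffunE //.
  by rewrite rmorphD /= => -> ->.
by rewrite rmorphM /= => -> ->.
Qed.

(** Composition of the associated endomorphisms of k[x]; the substitution of
    F comes last, so that for maps of affine space the order is reversed. *)
Definition vcomp F G : vf := [ffun i => msub F (G i)].

Lemma msub_comp F G p : msub F (msub G p) = msub (vcomp F G) p.
Proof.
elim/mpoly_gen_ind: p => [c|i|p q|p q]; rewrite ?msubC ?msubX ?ffunE //.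
  by rewrite !rmorphD /= => -> ->.
by rewrite !rmorphM /= => -> ->.
Qed.

Lemma msub_chain F p j :
  (msub F p)^`M(j) = \sum_i msub F p^`M(i) * (F i)^`M(j).
Proof.
rewrite (der_along_gens (g := msub F) (delta := fun p => (msub F p)^`M(j))).
- by apply: eq_bigr => i _; rewrite msubX.
- by move=> c; rewrite msubC mderivC.
- by move=> q r; rewrite rmorphD mderivD.
- by move=> q r; rewrite rmorphM mderivM addrC [_ * msub F r]mulrC.
Qed.

Lemma msub_mpow F p e : (forall i, F i \in mpow k n 1) ->
  p \in mpow k n e -> msub F p \in mpow k n e.
Proof.
move=> hF; move: p; apply: mpow_ind => [|q r hq hr|c m le_em]; rewrite ?raddf0 ?rpred0 //.
  by rewrite raddfD rpredD.
rewrite linearZ mpowZ //; apply: mpow_leq le_em _.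
elim/mnm_ind: m => [|m i IHm]; first by rewrite mpolyX0 mdeg0 mpow0.
by rewrite mpolyXD rmorphM mdegD mdeg1 /=; apply: mpowM; rewrite ?msubX.
Qed.

Lemma msub_congr F G p e : (forall i, F i - G i \in mpow k n e) ->
  msub F p - msub G p \in mpow k n e.
Proof.
move=> hFG; elim/mpoly_gen_ind: p => [c|i|p q hp hq|p q hp hq].
- by rewrite !msubC subrr rpred0.
- by rewrite !msubX.
- by rewrite !rmorphD opprD addrACA rpredD.
rewrite !rmorphM /=.
have -> : msub F p * msub F q - msub G p * msub G q =
   msub F p * (msub F q - msub G q) + msub G q * (msub F p - msub G p).
  by rewrite !mulrBr [msub G q * msub F p]mulrC addrA subrK [msub G q * _]mulrC.
by rewrite rpredD // mpowMl.
Qed.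

(** An endomorphism tangent to the identity acts trivially on the graded
    ring of the filtration by powers of m. *)
Lemma msub_unip F p e : (forall i, F i - 'X_i \in mpow k n 2) ->
  p \in mpow k n e -> msub F p - p \in mpow k n e.+1.
Proof.
move=> hF; move: p; apply: mpow_ind => [|q r hq hr|c m le_em].
- by rewrite raddf0 subr0 rpred0.
- by rewrite raddfD opprD addrACA rpredD.
rewrite linearZ -scalerBr mpowZ //; apply: (mpow_leq (f := (mdeg m).+1)) => //.
elim/mnm_ind: m {le_em} => [|m i IHm].
  by rewrite mpolyX0 rmorph1 subrr rpred0.
have F1 : forall j, F j \in mpow k n 1.
  move=> j; rewrite -(subrK 'X_j (F j)) rpredD //; last by rewrite -(mdeg1 j) mpowX.
  exact: mpow_leq (hF j).
rewrite mpolyXD rmorphM mdegD mdeg1 /= msubX.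
have -> : msub F 'X_[m] * F i - 'X_[m] * 'X_i =
   (msub F 'X_[m] - 'X_[m]) * F i + 'X_[m] * (F i - 'X_i).
  by rewrite mulrBl mulrBr addrA subrK.
rewrite addn1 rpredD //; first by rewrite -addn1; apply: mpowM.
by rewrite -addn2; apply: mpowM; rewrite ?mpowX.
Qed.

End Substitution.

(** * The Jacobian determinant of a tuple of polynomials *)

Section DetNearIdentity.
Variables (B : comNzRingType) (n : nat) (Q : B -> Prop) (E : 'M[B]_n).
Hypotheses (Q0 : Q 0) (QD : forall a b, Q a -> Q b -> Q (a + b))
  (QM : forall a b, Q b -> Q (a * b)) (QE : forall i j l h, Q (E i j * E l h)).

(** A permutation other than 1 moves at least two points, so its term in the
    Leibniz formula contains two entries of E. *)
Lemma det_near1 : Q (\det (1%:M + E) - 1 - \tr E).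
Proof.
have QMr a b : Q a -> Q (a * b) by rewrite mulrC; apply: QM.
rewrite /determinant (bigD1 (1%g : 'S_n)) //= odd_perm1 expr0 mul1r.
rewrite -!addrA [X in _ + X]addrC !addrA; apply: QD; last first.
  apply: big_ind => // s s_neq1; apply: (QM).
  have [i si] : exists i, s i != i.
    apply/existsP; apply: contraNT s_neq1; rewrite negb_exists => /forallP s1.
    by apply/eqP/permP => i; rewrite perm1; have := s1 i; rewrite negbK => /eqP.
  have ssi : s (s i) != s i by rewrite (inj_eq perm_inj).
  rewrite (bigD1 i) //= (bigD1 (s i)) //= mulrA; apply: QMr.
  by rewrite !mxE eq_sym (negPf si) eq_sym (negPf ssi) !add0r.
rewrite (eq_bigr (fun i => 1 + E i i)) => [|i _]; last by rewrite !mxE perm1 eqxx.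
rewrite /mxtrace; elim: (index_enum _) => [|i s IHs].
  by rewrite !big_nil subrr subr0.
rewrite !big_cons; set p := \prod_(_ <- _) _ in IHs *.
set t := \sum_(_ <- _) _ in IHs *.
have -> : (1 + E i i) * p - 1 - (E i i + t) =
          (p - 1 - t) + (E i i * (p - 1 - t) + E i i * t).
  by ring.
apply: (QD) => //; apply: QD; first exact: QM.
by rewrite /t mulr_sumr; apply: big_ind.
Qed.

End DetNearIdentity.

Section Jacobian.
Variables (k : fieldType) (n : nat).
Local Notation P := {mpoly k[n]}.
Local Notation vf := {ffun 'I_n -> P}.
Implicit Types (p q : P) (e : nat) (F G : vf) (L : 'M[k]_n).

Definition jacmx F : 'M[P]_n := \matrix_(i, j) (F i)^`M(j).
Definition jac F : P := \det (jacmx F).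

Lemma jac_comp F G : jac (vcomp F G) = msub F (jac G) * jac F.
Proof.
rewrite /jac -det_map_mx -det_mulmx; congr (\det _); apply/matrixP => i j.
by rewrite !mxE ffunE msub_chain; apply: eq_bigr => l _; rewrite !mxE.
Qed.

Lemma det_congr (A B : 'M[P]_n) e :
  (forall i j, A i j - B i j \in mpow k n e) -> \det A - \det B \in mpow k n e.
Proof.
move=> hAB; rewrite /determinant -sumrB; apply: rpred_sum => s _.
rewrite -mulrBr; apply: mpowMl.
elim: (index_enum _) => [|i r IHr]; first by rewrite !big_nil subrr rpred0.
rewrite !big_cons; set a := A i _; set b := B i _.
set p := \prod_(_ <- _) _ in IHr *; set q := \prod_(_ <- _) _ in IHr *.
have -> : a * p - b * q = a * (p - q) + (a - b) * q.
  by rewrite mulrBr mulrBl addrA subrK.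
by rewrite rpredD //; [apply: mpowMl | apply: mpowMr; apply: hAB].
Qed.

Lemma jac_congr F G e :
  (forall i, F i - G i \in mpow k n e) -> jac F - jac G \in mpow k n e.-1.
Proof.
by move=> hFG; apply: det_congr => i j; rewrite !mxE -mderivB mpow_deriv.
Qed.

Lemma jacmx_idvf : jacmx (idvf k n) = 1%:M.
Proof. by apply/matrixP => i j; rewrite !mxE ffunE mderivXU. Qed.

Lemma jac_idvf : jac (idvf k n) = 1.
Proof. by rewrite /jac jacmx_idvf det1. Qed.

(** The differential of the Jacobian determinant is the divergence. Here
    J G = J F + E with E in m^e, and J F = 1 modulo m gives
    J G = (J F) (1 + E) modulo m^(e+1); only the trace of E survives in
    det (1 + E). *)
Lemma jac_perturb F G e : (0 < e)%N ->
    (forall i, F i - 'X_i \in mpow k n 2) ->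
    (forall i, G i - F i \in mpow k n e.+1) ->
  jac G - jac F - \sum_i (G i - F i)^`M(i) \in mpow k n e.+1.
Proof.
move=> e_gt0 hF hG; set A := jacmx F; set E := jacmx G - A.
have hE i j : E i j \in mpow k n e.
  by rewrite !mxE -mderivB; apply: mpow_deriv (hG i).
have hA i j : A i j - 1%:M i j \in mpow k n 1.
  rewrite -jacmx_idvf.
  by rewrite !mxE ffunE -mderivB; apply: mpow_deriv (hF i).
have trE : \tr E = \sum_i (G i - F i)^`M(i).
  by apply: eq_bigr => i _; rewrite !mxE mderivB.
have detA : jac F - 1 \in mpow k n 1 by rewrite -(det1 P n); apply: det_congr.
have tr_e : \tr E \in mpow k n e by apply: rpred_sum => i _; apply: hE.
have h1 : \det (1%:M + E) - 1 - \tr E \in mpow k n e.+1.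
  apply: (det_near1 (Q := fun p => p \in mpow k n e.+1)).
  - exact: rpred0.
  - by move=> a b; apply: rpredD.
  - by move=> a b; apply: mpowMl.
  move=> i j l h; apply: (mpow_leq (f := (e + e)%N)); last exact: mpowM.
  by rewrite -addn1 leq_add2l.
have h2 : jac G - jac F * \det (1%:M + E) \in mpow k n e.+1.
  rewrite -det_mulmx; apply: det_congr => i j.
  have -> : jacmx G i j = A i j + E i j.
    have -> : E i j = jacmx G i j - A i j by rewrite /E !mxE.
    by rewrite addrC subrK.
  rewrite mulmxDr mulmx1 [(_ + _ *m _) i j]mxE opprD addrACA subrr add0r.
  have -> : E i j - (A *m E) i j = - \sum_l (A i l - 1%:M i l) * E l j.
    under eq_bigr do rewrite mulrBl.
    rewrite sumrB opprB -{1}[E]mul1mx.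
    by rewrite [(1%:M *m E) i j]mxE [(A *m E) i j]mxE.
  rewrite rpredN; apply: rpred_sum => l _; rewrite -add1n.
  exact: mpowM (hA i l) (hE l j).
have -> : jac G - jac F - \sum_i (G i - F i)^`M(i) =
    (jac G - jac F * \det (1%:M + E)) +
    (jac F * (\det (1%:M + E) - 1 - \tr E) + (jac F - 1) * \tr E).
  by rewrite trE; ring.
rewrite rpredD // rpredD //; first exact: mpowMl.
by rewrite -add1n; apply: mpowM.
Qed.

Definition linmx F : 'M[k]_n := \matrix_(i, j) (F i)@_U_(j).
Definition vlin L F : vf := [ffun i => \sum_j L i j *: F j].

Lemma jac_const F : (jac F)@_0%MM = \det (linmx F).
Proof.
rewrite /jac -(det_map_mx (mcoeff (0%MM : 'X_{1..n}))); congr (\det _).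
by apply/matrixP => i j; rewrite !mxE /= mcoeff_deriv add0m mnm0E mulr1n.
Qed.

Lemma jac_vlin L F : jac (vlin L F) = (\det L)%:MP * jac F.
Proof.
rewrite /jac -(det_map_mx (mpolyC n (R := k))) -det_mulmx; congr (\det _).
apply/matrixP => i j; rewrite !mxE ffunE raddf_sum; apply: eq_bigr => l _.
by rewrite !mxE mul_mpolyC /= mderivZ.
Qed.

Lemma vlin_comp L M F : vlin L (vlin M F) = vlin (L *m M) F.
Proof.
apply/ffunP => i; rewrite !ffunE.
under eq_bigr do rewrite ffunE scaler_sumr.
rewrite exchange_big; apply: eq_bigr => j _ /=.
by rewrite mxE scaler_suml; apply: eq_bigr => l _; rewrite scalerA.
Qed.

Lemma vlin1 F : vlin 1%:M F = F.
Proof.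
apply/ffunP => i; rewrite ffunE (bigD1 i) //= mxE eqxx scale1r big1 ?addr0 //.
by move=> j ne_ji; rewrite mxE eq_sym (negPf ne_ji) scale0r.
Qed.

Lemma linmx_vlin L F : linmx (vlin L F) = L *m linmx F.
Proof.
apply/matrixP => i j; rewrite !mxE ffunE raddf_sum; apply: eq_bigr => l _.
by rewrite mxE /= mcoeffZ.
Qed.

Lemma vcomp_vlin F L : vcomp F (vlin L (idvf k n)) = vlin L F.
Proof.
apply/ffunP => i; rewrite !ffunE raddf_sum; apply: eq_bigr => j _ /=.
by rewrite linearZ ffunE /= msubX.
Qed.

End Jacobian.

(** * Polynomial functions, tangent vectors and dimension *)

Section PolynomialFunctions.
Variables (k : fieldType) (T : Type) (N : nat) (c : T -> 'I_N -> k).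

Definition polyfun (g : T -> k) : Prop :=
  exists P : {mpoly k[N]}, forall t, g t = P.@[c t].

Lemma polyfun_ext g h : g =1 h -> polyfun g -> polyfun h.
Proof. by move=> eq_gh [P hP]; exists P => t; rewrite -eq_gh. Qed.

Lemma polyfun_const a : polyfun (fun=> a).
Proof. by exists a%:MP => t; rewrite mevalC. Qed.

Lemma polyfun_coord i : polyfun (fun t => c t i).
Proof. by exists 'X_i => t; rewrite mevalXU. Qed.

Lemma polyfunD g h : polyfun g -> polyfun h -> polyfun (fun t => g t + h t).
Proof. by move=> [P hP] [Q hQ]; exists (P + Q) => t; rewrite mevalD hP hQ. Qed.

Lemma polyfunM g h : polyfun g -> polyfun h -> polyfun (fun t => g t * h t).
Proof. by move=> [P hP] [Q hQ]; exists (P * Q) => t; rewrite mevalM hP hQ. Qed.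

Lemma polyfunB g h : polyfun g -> polyfun h -> polyfun (fun t => g t - h t).
Proof. by move=> [P hP] [Q hQ]; exists (P - Q) => t; rewrite mevalB hP hQ. Qed.

Lemma polyfun_sum (I : Type) (r : seq I) (A : pred I) (g : I -> T -> k) :
  (forall i, A i -> polyfun (g i)) -> polyfun (fun t => \sum_(i <- r | A i) g i t).
Proof.
move=> hg; elim: r => [|i r IHr].
  by apply: (polyfun_ext _ (polyfun_const 0)) => t; rewrite big_nil.
case: (boolP (A i)) => [Ai|nAi].
  by apply: (polyfun_ext _ (polyfunD (hg i Ai) IHr)) => t; rewrite big_cons Ai.
by apply: (polyfun_ext _ IHr) => t; rewrite big_cons (negPf nAi).
Qed.

Lemma polyfun_prod (I : Type) (r : seq I) (A : pred I) (g : I -> T -> k) :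
  (forall i, A i -> polyfun (g i)) -> polyfun (fun t => \prod_(i <- r | A i) g i t).
Proof.
move=> hg; elim: r => [|i r IHr].
  by apply: (polyfun_ext _ (polyfun_const 1)) => t; rewrite big_nil.
case: (boolP (A i)) => [Ai|nAi].
  by apply: (polyfun_ext _ (polyfunM (hg i Ai) IHr)) => t; rewrite big_cons Ai.
by apply: (polyfun_ext _ IHr) => t; rewrite big_cons (negPf nAi).
Qed.

Lemma polyfun_det n (A : T -> 'M[k]_n) :
  (forall i j, polyfun (fun t => A t i j)) -> polyfun (fun t => \det (A t)).
Proof.
move=> hA; apply: polyfun_sum => s _; apply: polyfunM; first exact: polyfun_const.
by apply: polyfun_prod.
Qed.

Variable n : nat.
Local Notation P := {mpoly k[n]}.

(** The coefficients vary polynomially with the parameter; no bound on the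
    degree in x is imposed. *)
Definition polyfam (p : T -> P) : Prop := forall m, polyfun (fun t => (p t)@_m).

Lemma polyfam_ext p q : p =1 q -> polyfam p -> polyfam q.
Proof. by move=> eq_pq hp m; apply: (polyfun_ext _ (hp m)) => t; rewrite eq_pq. Qed.

Lemma polyfam_const p : polyfam (fun=> p).
Proof. by move=> m; apply: polyfun_const. Qed.

Lemma polyfamD p q : polyfam p -> polyfam q -> polyfam (fun t => p t + q t).
Proof.
move=> hp hq m; apply: (polyfun_ext _ (polyfunD (hp m) (hq m))) => t.
by rewrite mcoeffD.
Qed.

Lemma polyfamZ g p : polyfun g -> polyfam p -> polyfam (fun t => g t *: p t).
Proof.
move=> hg hp m; apply: (polyfun_ext _ (polyfunM hg (hp m))) => t.
by rewrite mcoeffZ.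
Qed.

Lemma polyfamM p q : polyfam p -> polyfam q -> polyfam (fun t => p t * q t).
Proof.
move=> hp hq m; apply: (@polyfun_ext (fun t => \sum_(u : 'X_{1..n < (mdeg m).+1} *
    'X_{1..n < (mdeg m).+1} | m == (u.1 + u.2)%MM) (p t)@_u.1 * (q t)@_u.2)).
  by move=> t; rewrite mcoeffM.
by apply: polyfun_sum => u _; apply: polyfunM.
Qed.

Lemma polyfam_sum (I : Type) (r : seq I) (A : pred I) (p : I -> T -> P) :
  (forall i, A i -> polyfam (p i)) -> polyfam (fun t => \sum_(i <- r | A i) p i t).
Proof.
move=> hp m; apply: (polyfun_ext _ (polyfun_sum r (fun i Ai => hp i Ai m))) => t.
by rewrite raddf_sum.
Qed.

Lemma polyfam_prod (I : Type) (r : seq I) (A : pred I) (p : I -> T -> P) :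
  (forall i, A i -> polyfam (p i)) -> polyfam (fun t => \prod_(i <- r | A i) p i t).
Proof.
move=> hp; elim: r => [|i r IHr].
  by apply: (polyfam_ext _ (polyfam_const 1)) => t; rewrite big_nil.
case: (boolP (A i)) => [Ai|nAi].
  by apply: (polyfam_ext _ (polyfamM (hp i Ai) IHr)) => t; rewrite big_cons Ai.
by apply: (polyfam_ext _ IHr) => t; rewrite big_cons (negPf nAi).
Qed.

Lemma polyfam_deriv p i : polyfam p -> polyfam (fun t => (p t)^`M(i)).
Proof.
move=> hp m; have h := polyfunM (polyfun_const (m i).+1%:R) (hp (m + U_(i))%MM).
by apply: (polyfun_ext _ h) => t; rewrite mcoeff_deriv mulr_natl.
Qed.

Lemma polyfam_exp p e : polyfam p -> polyfam (fun t => p t ^+ e).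
Proof.
move=> hp; have h := polyfam_prod (index_enum 'I_e) (fun i (_ : true) => hp).
by apply: (polyfam_ext _ h) => t; rewrite prodr_const card_ord.
Qed.

Lemma polyfam_jac (F : T -> {ffun 'I_n -> P}) :
  (forall i, polyfam (fun t => F t i)) -> polyfam (fun t => jac (F t)).
Proof.
move=> hF; apply: polyfam_sum => s _.
apply: polyfamM; first exact: polyfam_const.
apply: polyfam_prod => i _; apply: (polyfam_ext _ (polyfam_deriv (s i) (hF i))) => t.
by rewrite mxE.
Qed.

Lemma polyfam_msubX (F : T -> {ffun 'I_n -> P}) m :
  (forall i, polyfam (fun t => F t i)) -> polyfam (fun t => msub (F t) 'X_[m]).
Proof.
move=> hF; have h := polyfam_prod (index_enum 'I_n)
  (fun i (_ : true) => polyfam_exp (m i) (hF i)).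
apply: (polyfam_ext _ h) => t; rewrite mpolyXE_id rmorph_prod; apply: eq_bigr.
by move=> i _; rewrite rmorphXn /= msubX.
Qed.

End PolynomialFunctions.

Lemma polyfun_comp (k : fieldType) (S T : Type) (M N : nat) (c : T -> 'I_N -> k)
    (b : S -> 'I_M -> k) (Phi : S -> T) (g : T -> k) :
  (forall i, polyfun b (fun s => c (Phi s) i)) -> polyfun c g ->
  polyfun b (fun s => g (Phi s)).
Proof.
move=> hPhi [P hP]; have [Q hQ] := fin_all_exists hPhi.
exists (P \mPo [tuple Q i | i < N]) => s; rewrite hP comp_mpoly_meval.
by apply: meval_eq => i; rewrite hQ tnth_mktuple.
Qed.

Section CharacteristicZero.
Variable k : fieldType.
Hypothesis char_k : [pchar k] =i pred0.

Lemma natr_neq0 e : (e.+1%:R : k) != 0.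
Proof. by rewrite ((pcharf0P k).1 char_k). Qed.

Lemma natr_inj : injective (fun e => e%:R : k).
Proof.
move=> a b; wlog le_ab : a b / (a <= b)%N => [h|].
  by case/orP: (leq_total a b) => /h // hab /esym/hab.
move=> eq_ab; have /eqP : (b - a)%:R = 0 :> k by rewrite natrB // eq_ab subrr.
rewrite ((pcharf0P k).1 char_k) subn_eq0 => le_ba.
by apply/eqP; rewrite eqn_leq le_ab.
Qed.

Lemma poly_vanish (q : {poly k}) : (forall c, q.[c] = 0) -> q = 0.
Proof.
move=> q0; apply/eqP; apply: contraT => q_neq0.
have := @max_poly_roots _ q [seq i%:R | i <- iota 0 (size q)] q_neq0.
rewrite size_map size_iota ltnn; apply; last by rewrite (map_inj_uniq natr_inj) iota_uniq.
by apply/allP => x _; apply/rootP.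
Qed.

Section Line.
Variables (N : nat) (P : {mpoly k[N]}) (a : 'I_N -> {poly k}).

Definition along : {poly k} := mmap (@polyC k) a P.

End Line.

Lemma alongE N (P : {mpoly k[N]}) a c : (along P a).[c] = P.@[fun i => (a i).[c]].
Proof.
rewrite /along; elim/mpoly_gen_ind: P => [b|i|p q|p q].
- by rewrite mmapC hornerC mevalC.
- by rewrite mmapX mmap1U mevalXU.
- by rewrite raddfD hornerD mevalD /= => -> ->.
- by rewrite rmorphM hornerM mevalM /= => -> ->.
Qed.

Lemma along_deriv N (P : {mpoly k[N]}) a :
  (along P a)^`() = \sum_i along P^`M(i) a * (a i)^`().
Proof.
rewrite /along (der_along_gens (g := mmap (@polyC k) a)
   (delta := fun p => (mmap (@polyC k) a p)^`())).
- by apply: eq_bigr => i _; rewrite [mmap _ _ 'X_i]mmapX mmap1U.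
- by move=> b; rewrite mmapC derivC.
- by move=> p q; rewrite raddfD derivD.
- by move=> p q; rewrite rmorphM derivM addrC [_^`() * _]mulrC.
Qed.

(** In characteristic zero, a polynomial function that vanishes everywhere has
    vanishing derivatives, so it is constant by induction on the degree. *)
Lemma mpoly_vanish N (P : {mpoly k[N]}) : (forall v, P.@[v] = 0) -> P = 0.
Proof.
have [e] := ubnP (msize P) => /ltnW le_e.
have : forall m, (e <= mdeg m)%N -> P@_m = 0.
  by move=> m le_m; apply/memN_msupp_eq0/msize_mdeg_ge/(leq_trans le_e).
elim: e P {le_e} => [|e IHe] P Pe P0; first by apply/mpolyP => m; rewrite Pe ?mcoeff0.
have dP i : P^`M(i) = 0.
  apply: IHe => [m le_m|v].
    by rewrite mcoeff_deriv Pe ?mul0rn // mdegD mdeg1 addn1 ltnS.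
  pose a j := (v j)%:P + (i == j)%:R *: 'X.
  have aP : along P a = 0 by apply: poly_vanish => c; rewrite alongE P0.
  have := congr1 (fun q => q.[0]) (along_deriv P a).
  rewrite aP deriv0 horner0 horner_sum (bigD1 i) //= big1 => [|j ne_ji].
    rewrite addr0 hornerM alongE /a derivD derivC add0r derivZ derivX eqxx.
    rewrite scale1r hornerC mulr1 => /esym; congr (_ = _); apply: meval_eq => j.
    by rewrite hornerD hornerC hornerZ hornerX mulr0 addr0.
  by rewrite /a derivD derivC add0r derivZ eq_sym (negPf ne_ji) scale0r mulr0 horner0.
have PC : P = (P@_0%MM)%:MP.
  apply/mpolyP => m; rewrite mcoeffC; have [->|m_neq0] := eqVneq m 0%MM.
    by rewrite mulr1.
  have [i mi] := mnm_neq0P m_neq0.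
  have := congr1 (mcoeff (m - U_(i))%MM) (dP i).
  rewrite mcoeff_deriv submK ?lep1mP // mcoeff0 mulr0 -mulr_natr => /eqP.
  by rewrite mulf_eq0 (negPf (natr_neq0 _)) orbF => /eqP.
by rewrite PC; have := P0 (fun=> 0); rewrite {1}PC mevalC => ->.
Qed.

Section Tangent.
Variable V : vectType k.
Local Notation N := (\dim {:V}).
Implicit Types (X Y : V -> Prop) (u v x D : V).

Lemma coordsE v : v = \sum_i coords v i *: (vbasis {:V})`_i.
Proof. exact: coord_vbasis (memvf v). Qed.

Lemma coordsP a u v i : coords (a *: u + v) i = a * coords u i + coords v i.
Proof. by rewrite /coords linearP. Qed.

Lemma coordsD u v i : coords (u + v) i = coords u i + coords v i.
Proof. by rewrite /coords linearD. Qed.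

Lemma coordsZ a v i : coords (a *: v) i = a * coords v i.
Proof. by rewrite /coords linearZ. Qed.

Lemma tangent_sub X Y x v : (forall u, X u -> Y u) ->
  tangent_at X x v -> tangent_at Y x v.
Proof. by move=> XY hv P hP; apply: hv => u /XY; apply: hP. Qed.

Lemma tangent0 X x : tangent_at X x 0.
Proof.
by move=> P _; rewrite big1 // => i _; rewrite /coords linear0 mulr0.
Qed.

Lemma tangentP X x a u v :
  tangent_at X x u -> tangent_at X x v -> tangent_at X x (a *: u + v).
Proof.
move=> hu hv P hP; under eq_bigr do rewrite coordsP mulrDr mulrCA.
by rewrite big_split -mulr_sumr /= hu // hv // mulr0 addr0.
Qed.

Lemma tangentD X x u v :
  tangent_at X x u -> tangent_at X x v -> tangent_at X x (u + v).
Proof. by move=> hu hv; rewrite -[u]scale1r; apply: tangentP. Qed.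

Lemma tangentZ X x a u : tangent_at X x u -> tangent_at X x (a *: u).
Proof. by move=> hu; rewrite -[_ *: _]addr0; apply/tangentP/tangent0. Qed.

Lemma tangent_sum X x (I : Type) (r : seq I) (A : pred I) (w : I -> V) :
  (forall i, A i -> tangent_at X x (w i)) ->
  tangent_at X x (\sum_(i <- r | A i) w i).
Proof. by move=> hw; apply: big_ind => //; [apply: tangent0|apply: tangentD]. Qed.

(** The velocity of a polynomial curve lying in X, up to finitely many
    parameters, is tangent to X: an equation of X becomes a polynomial in
    the parameter with infinitely many zeros. *)
Lemma tangent_curve X r (w : nat -> V) (q : {poly k}) : q != 0 -> (1 < r)%N ->
    (forall c, q.[c] != 0 -> X (\sum_(l < r) c ^+ l *: w l)) ->
  tangent_at X (w 0%N) (w 1%N).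
Proof.
move=> q_neq0 r_gt1 hX P hP.
pose a i : {poly k} := \poly_(l < r) coords (w l) i.
have aE c i : (a i).[c] = coords (\sum_(l < r) c ^+ l *: w l) i.
  rewrite horner_poly /coords linear_sum; apply: eq_bigr => l _ /=.
  by rewrite linearZ mulrC.
have P0 : along P a = 0.
  suff /eqP : along P a * q = 0 by rewrite mulf_eq0 (negPf q_neq0) orbF => /eqP.
  apply: poly_vanish => c; rewrite hornerM alongE.
  have [->|qc] := eqVneq q.[c] 0; first by rewrite mulr0.
  rewrite (@meval_eq _ _ _ (coords (\sum_(l < r) c ^+ l *: w l))).
    by rewrite hP ?mul0r //; apply: hX.
  by move=> i; rewrite aE.
have := congr1 (fun p => p.[0]) (along_deriv P a).
rewrite P0 deriv0 horner0 horner_sum => h; rewrite [RHS]h.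
apply: eq_bigr => i _; rewrite hornerM alongE; congr (_ * _).
  by apply: meval_eq => j; rewrite horner_coef0 coef_poly (ltnW r_gt1).
by rewrite horner_coef0 coef_deriv coef_poly r_gt1.
Qed.

(** A tangent vector kills the linear part at x of every equation of X. *)
Lemma tangent_line X x D g (q : {poly k}) :
    polyfun (@coords k V) g -> (forall v, X v -> g v = 0) -> tangent_at X x D ->
    (forall c, g (x + c *: D) = q.[c]) ->
  q`_1 = 0.
Proof.
move=> [P hP] gX0 hD gq.
have PX : vanishes_on P X by move=> v Xv; rewrite -hP gX0.
pose a i : {poly k} := (coords x i)%:P + coords D i *: 'X.
have aE c i : (a i).[c] = coords (x + c *: D) i.
  by rewrite /a hornerD hornerC hornerZ hornerX coordsD coordsZ mulrC.
have -> : q = along P a.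
  apply/eqP; rewrite -subr_eq0; apply/eqP/poly_vanish => c.
  rewrite hornerD hornerN -gq hP alongE; apply/eqP; rewrite subr_eq0; apply/eqP.
  by apply: meval_eq => i; rewrite aE.
rewrite -[LHS]mulr1n -[_ *+ 1]coef_deriv -horner_coef0 along_deriv horner_sum.
rewrite -[RHS](hD P PX); apply: eq_bigr => i _; rewrite hornerM alongE.
congr (_ * _).
  by apply: meval_eq => j; rewrite aE scale0r addr0.
by rewrite /a derivD derivC add0r derivZ derivX hornerZ hornerC mulr1.
Qed.

Lemma polyfun_linear (g : V -> k) :
  (forall a u v, g (a *: u + v) = a * g u + g v) -> polyfun (@coords k V) g.
Proof.
move=> gP; have g0 : g 0 = 0.
  by have := gP (-1) 0 0; rewrite scaler0 addr0 mulN1r addNr.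
apply: (@polyfun_ext _ _ _ _ (fun v => \sum_i coords v i * g (vbasis {:V})`_i)).
  move=> v; rewrite [in RHS](coordsE v); apply/esym.
  elim: (index_enum _) => [|i r IHr]; first by rewrite !big_nil.
  by rewrite !big_cons gP IHr.
apply: polyfun_sum => i _; apply: polyfunM; last exact: polyfun_const.
exact: polyfun_coord.
Qed.

End Tangent.

End CharacteristicZero.

Section AlgebraicDependence.
Variable k : fieldType.

(** Counting dimensions: the monomials of degree less than e in each of the
    s polynomials outnumber, for large e, the monomials in r < s variables
    that occur in them. *)
Lemma alg_dependent r s (f : s.-tuple {mpoly k[r]}) : (r < s)%N ->
  exists2 Q : {mpoly k[s]}, Q != 0 & Q \mPo f = 0.
Proof.
(* The f_i have degree at most D; with exponents below e in each of the s
   variables, the images have degree below B = e C. As e > C^r, there are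
   e^s >= e^(r+1) > B^r monomials upstairs. *)
move=> lt_rs; pose D := (\max_(i < s) msize (tnth f i))%N.
pose C := (s * D).+1; pose e := (C ^ r).+1; pose B := (e * C)%N.
pose mm N b (u : {ffun 'I_N -> 'I_b}) : 'X_{1..N} := [multinom val (u i) | i < N].
have card_lt : (#|{ffun 'I_r -> 'I_B}| < #|{ffun 'I_s -> 'I_e}|)%N.
  rewrite !card_ffun !card_ord; apply: (@leq_trans (e ^ r.+1)); last first.
    by rewrite leq_pexp2l.
  by rewrite /B expnMn expnS mulnC ltn_pmul2r // expn_gt0.
pose deg_le E (p : {mpoly k[r]}) := forall m, (E < mdeg m)%N -> p@_m = 0.
have degM a b p q : deg_le a p -> deg_le b q -> deg_le (a + b)%N (p * q).
  move=> hp hq m lt_m; rewrite mcoeffM big1 // => -[m1 m2] /= /eqP eqm.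
  have deg_m := congr1 mdeg eqm; rewrite mdegD in deg_m.
  have [lt1|ge1] := ltnP a (mdeg m1); first by rewrite hp ?mul0r.
  rewrite (hq m2) ?mulr0 // -(ltn_add2l a).
  by apply: (leq_trans lt_m); apply: (leq_trans (eq_leq deg_m)); rewrite leq_add2r.
have deg1 : deg_le 0%N 1.
  by move=> m; rewrite mcoeff1; case: eqP => // ->; rewrite mdeg0.
have degX N p E : deg_le E p -> deg_le (N * E)%N (p ^+ N).
  by move=> hp; elim: N => [|N IHN]; rewrite ?expr0 // exprS mulSn; apply: degM.
have deg_f i : deg_le D (tnth f i).
  move=> m lt_m; apply/memN_msupp_eq0/msize_mdeg_ge/(leq_trans _ (ltnW lt_m)).
  exact: (leq_bigmax (F := fun i => msize (tnth f i))).
have deg_X u m : (B <= mdeg m)%N -> ('X_[mm s e u] \mPo f)@_m = 0.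
  move=> le_m; rewrite comp_mpolyX.
  suff h : deg_le (\sum_(i < s) e * D)%N (\prod_i tnth f i ^+ mm s e u i).
    apply: h; apply: leq_trans le_m; rewrite sum_nat_const card_ord mulnCA.
    by rewrite /B /C ltn_pmul2l.
  have : (forall i, (mm s e u i <= e)%N) by move=> i; rewrite mnmE; apply/ltnW/ltn_ord.
  move: (mm s e u) => w w_le.
  apply: (big_ind2 (fun E p => deg_le E p)) => [|N p N' q|i _]; [exact: deg1|exact: degM|].
  move=> m' lt_m'; apply: (degX (w i) _ D (deg_f i)); apply: leq_ltn_trans lt_m'.
  by rewrite leq_mul2r w_le orbT.
pose M : 'M[k]_(#|{ffun 'I_s -> 'I_e}|, #|{ffun 'I_r -> 'I_B}|) :=
  \matrix_(i, j) ('X_[mm s e (enum_val i)] \mPo f)@_(mm r B (enum_val j)).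
have : kermx M != 0.
  rewrite -mxrank_eq0 mxrank_ker -lt0n subn_gt0.
  by apply: leq_ltn_trans card_lt; apply: rank_leq_col.
case/rowV0Pn => v /sub_kermxP vM0 v_neq0.
exists (\sum_u v 0 (enum_rank u) *: 'X_[mm s e u]).
  apply: contra v_neq0 => /eqP Q0; apply/eqP/rowP => i.
  have := congr1 (mcoeff (mm s e (enum_val i))) Q0.
  rewrite mcoeff0 raddf_sum (bigD1 (enum_val i)) //= big1 => [|u ne_u].
    by rewrite mcoeffZ mcoeffX eqxx mulr1 addr0 enum_valK mxE.
  rewrite mcoeffZ mcoeffX; case: eqP => [eq_u|]; last by rewrite mulr0.
  case/eqP: ne_u; apply/ffunP => j; apply: val_inj.
  by have := congr1 (fun m : 'X_{1..s} => m j) eq_u; rewrite !mnmE.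
apply/mpolyP => m; rewrite mcoeff0 (raddf_sum (comp_mpoly f)) raddf_sum /=. 
have [lt_m|ge_m] := ltnP (mdeg m) B; last first.
  by apply: big1 => u _; rewrite comp_mpolyZ mcoeffZ deg_X ?mulr0.
have lt_mi i : (m i < B)%N.
  by apply: leq_ltn_trans lt_m; rewrite mdegE (bigD1 i) //= leq_addr.
pose w : {ffun 'I_r -> 'I_B} := [ffun i => Ordinal (lt_mi i)].
have mw : m = mm r B w by apply/mnmP => i; rewrite mnmE ffunE.
have := congr1 (fun x : 'rV_ _ => x 0 (enum_rank w)) vM0; rewrite !mxE => h; rewrite -[RHS]h.
rewrite [RHS](reindex_onto enum_rank enum_val) => [|i _]; last exact: enum_valK.
apply: eq_big => [u|u _]; first by rewrite enum_rankK eqxx.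
by rewrite mxE comp_mpolyZ mcoeffZ !enum_rankK mw.
Qed.

End AlgebraicDependence.

Section Dimension.
Variables (k : fieldType) (V : vectType k).
Hypothesis char_k : [pchar k] =i pred0.

(** Coordinates on an affine space whose parameters are indexed by any finite
    type, so that each parameter keeps its meaning. *)
Definition fcoords (J : finType) (y : J -> k) (i : 'I_#|J|) : k := y (enum_val i).

(** A parametrization bounds the dimension from above, since polynomials in
    the parameters are algebraically dependent once they outnumber them; and
    functions recovering generic parameters are independent. *)
Lemma dimension_param (X : V -> Prop) (J : finType) (Phi : (J -> k) -> V)
    (g : J -> V -> k) (q : (J -> k) -> k) :
    (forall i, polyfun (@fcoords J) (fun y => coords (Phi y) i)) ->
    (forall v, X v -> exists y, v = Phi y) ->
    (forall j, polyfun (@coords k V) (g j)) ->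
    polyfun (@fcoords J) q -> (exists y, q y != 0) ->
    (forall y, q y != 0 -> exists2 v, X v & forall j, g j v = y j) ->
  has_dimension X #|J|.
Proof.
move=> hPhi XPhi hg [q' hq] [y0 qy0] Xg; split.
  have [G hG] : exists G : 'I_#|J| -> {mpoly k[\dim {:V}]},
      forall i v, g (enum_val i) v = (G i).@[coords v].
    apply: (@fin_all_exists _ _ (fun i G =>
      forall v, g (enum_val i) v = G.@[coords v])) => i; exact: hg.
  exists [tuple G i | i < #|J|] => Q hQ.
  suff /eqP : Q * q' = 0.
    rewrite mulf_eq0 => /orP[/eqP //|/eqP q'0].
    by rewrite hq q'0 meval0 eqxx in qy0.
  apply: mpoly_vanish => // v; rewrite mevalM.
  pose y j := v (enum_rank j).
  have yv : fcoords y =1 v by move=> i; rewrite /fcoords /y enum_valK.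
  rewrite -!(meval_eq _ yv) -hq; have [->|qy] := eqVneq (q y) 0.
    by rewrite mulr0.
  have [u Xu gu] := Xg y qy; have := hQ u Xu; rewrite comp_mpoly_meval.
  rewrite (@meval_eq _ _ _ (fcoords y)) => [->|i]; first by rewrite mul0r.
  by rewrite tnth_mktuple -hG gu.
move=> s f indep; rewrite leqNgt; apply/negP => lt_s.
have h i : polyfun (@fcoords J) (fun y => (tnth f i).@[coords (Phi y)]).
  apply: (@polyfun_comp _ _ _ _ _ (@coords k V) _ Phi (fun v => (tnth f i).@[coords v]) hPhi).
  by exists (tnth f i).
have [F hF] : exists F : 'I_s -> {mpoly k[#|J|]},
    forall i y, (tnth f i).@[coords (Phi y)] = (F i).@[fcoords y].
  exact: (@fin_all_exists _ _ (fun i F =>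
    forall y, (tnth f i).@[coords (Phi y)] = F.@[fcoords y])).
have [Q Q_neq0 QF] := alg_dependent [tuple F i | i < s] lt_s.
case/eqP: Q_neq0; apply: (indep Q) => v Xv; have [y ->] := XPhi v Xv.
rewrite comp_mpoly_meval.
have := congr1 (fun p => p.@[fcoords y]) QF; rewrite meval0 comp_mpoly_meval => <-.
by apply: meval_eq => i; rewrite tnth_mktuple hF.
Qed.

End Dimension.

(** * Endomorphisms of the jet algebra *)

Section JetRepresentative.
Variables (k : fieldType) (n d : nat).
Local Notation A := (jet k n d).
Local Notation P := {mpoly k[n]}.

Lemma jpi_eqP (p q : P) : jpi d p = jpi d q <-> p - q \in mpow k n d.
Proof. by rewrite -jpi_eq; split=> /eqP. Qed.

Lemma jpi_eq0 (p : P) : jpi d p = 0 <-> p \in mpow k n d.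
Proof. by rewrite -{2}[p]subr0 -jpi_eqP raddf0. Qed.

Lemma jrep_jpi (p : P) : jrep (jpi d p) - p \in mpow k n d.
Proof. by rewrite -jpi_eq jrepK. Qed.

Lemma jrep_coeff (p : P) m : (mdeg m < d)%N -> (jrep (jpi d p))@_m = p@_m.
Proof.
by move=> lt_m; apply/eqP; rewrite -subr_eq0 -mcoeffB (mpow_coeff0 (jrep_jpi p)).
Qed.

Lemma jet_eqP (a b : A) :
  (forall m, (mdeg m < d)%N -> (jrep a)@_m = (jrep b)@_m) -> a = b.
Proof.
move=> eq_ab; rewrite -[a]jrepK -[b]jrepK; apply/jpi_eqP/mpow_coeffP => m lt_m.
by rewrite mcoeffB eq_ab // subrr.
Qed.

Fact jrep_is_linear : linear (@jrep k n d).
Proof.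
move=> c a b; apply/esym/jrep_uniq; last by rewrite linearP /= !jrepK.
apply: leq_trans (msizeD_le _ _) _; rewrite geq_max msize_jrep andbT.
exact: leq_trans (msizeZ_le _ _) (msize_jrep a).
Qed.
HB.instance Definition _ :=
  GRing.isLinear.Build k A P *:%R (@jrep k n d) jrep_is_linear.

End JetRepresentative.

Section JetEndomorphisms.
Variables (k : fieldType) (n d : nat).
Hypothesis d_gt1 : (1 < d)%N.
Local Notation A := (jet k n d).
Local Notation P := {mpoly k[n]}.
Local Notation vf := {ffun 'I_n -> P}.
Local Notation x i := (@jpi k n d 'X_i).
Implicit Types (p q : P) (F G : vf) (phi psi : 'End(A)).

(** The tuples whose substitution preserves every power of m, and therefore
    acts on A. *)
Definition centered F := forall i, F i \in mpow k n 1.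

Definition amap_fun F (a : A) : A := jpi d (msub F (jrep a)).
Fact amap_fun_is_linear F : linear (amap_fun F).
Proof. by move=> c a b; rewrite /amap_fun !linearP. Qed.
HB.instance Definition _ F :=
  GRing.isLinear.Build k A A *:%R (amap_fun F) (amap_fun_is_linear F).
Definition amap F : 'End(A) := linfun (amap_fun F).

Lemma amapE F (hF : centered F) p : amap F (jpi d p) = jpi d (msub F p).
Proof.
rewrite lfunE /= /amap_fun; apply/jpi_eqP; rewrite -raddfB /=.
by apply: msub_mpow => //; apply: jrep_jpi.
Qed.

Lemma lfun_jetP (phi psi : 'End(A)) :
  (forall p, phi (jpi d p) = psi (jpi d p)) -> phi = psi.
Proof. by move=> h; apply/lfunP => a; rewrite -[a]jrepK. Qed.

Definition is_endo phi :=
  phi 1 = 1 /\ forall a b, phi (a * b) = phi a * phi b.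

Lemma endo_ext phi psi : is_endo phi -> is_endo psi ->
  (forall i, phi (x i) = psi (x i)) -> phi = psi.
Proof.
move=> [phi1 phiM] [psi1 psiM] eqX; apply: lfun_jetP.
apply: mpoly_gen_ind => [c|i|p q hp hq|p q hp hq] //.
- by rewrite -alg_mpolyC !linearZ /= rmorph1 phi1 psi1.
- by rewrite !raddfD /= hp hq.
- by rewrite rmorphM phiM psiM hp hq.
Qed.

Lemma amap_endo F : centered F -> is_endo (amap F).
Proof.
move=> hF; split; first by rewrite -(rmorph1 (jpi d)) (amapE hF) (rmorph1 (msub F)).
move=> a b; rewrite -[a]jrepK -[b]jrepK -rmorphM !(amapE hF).
by rewrite (rmorphM (msub F)) rmorphM.
Qed.

Definition vf_of phi : vf := [ffun i => jrep (phi (x i))].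

Lemma vf_of_amap F i : centered F -> vf_of (amap F) i - F i \in mpow k n d.
Proof. by move=> hF; rewrite ffunE (amapE hF) msubX jrep_jpi. Qed.

(** The class of x_i is nilpotent, hence so is its image. *)
Lemma endo_centered phi : is_endo phi -> centered (vf_of phi).
Proof.
move=> [phi1 phiM] i; rewrite mpow1E ffunE.
have phiX e : phi (x i ^+ e) = phi (x i) ^+ e.
  by elim: e => [|e IHe]; rewrite ?phi1 // !exprS phiM IHe.
have xd0 : x i ^+ d = 0.
  rewrite -(rmorphXn (jpi d)); apply/jpi_eq0; rewrite mpolyXn.
  have := mpowX k (U_(i) *+ d)%MM; by rewrite mdegMn mdeg1 mul1n.
have := phiX d; rewrite xd0 linear0 -[phi (x i)]jrepK -(rmorphXn (jpi d)) => /esym/jpi_eq0.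
move/mpow_coeff0 => /(_ 0%MM); rewrite mdeg0 rmorphXn (ltnW d_gt1) => /(_ isT) /eqP.
by rewrite jrepK expf_eq0 => /andP[].
Qed.

Lemma endo_amap phi : is_endo phi -> phi = amap (vf_of phi).
Proof.
move=> hphi; have c := endo_centered hphi; apply: endo_ext => //.
  exact: amap_endo.
by move=> i; rewrite (amapE c) msubX ffunE jrepK.
Qed.

Lemma centered_vcomp F G : centered F -> centered G -> centered (vcomp F G).
Proof. by move=> hF hG i; rewrite ffunE; apply: msub_mpow. Qed.

Lemma centered_id : centered (idvf k n).
Proof. by move=> i; rewrite ffunE -(mdeg1 i) mpowX. Qed.

Lemma centered_vlin L F : centered F -> centered (vlin L F).
Proof. by move=> hF i; rewrite ffunE; apply: rpred_sum => j _; apply: mpowZ. Qed.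

Lemma amap_comp F G : centered F -> centered G ->
  (amap F \o amap G)%VF = amap (vcomp F G).
Proof.
move=> hF hG; apply: lfun_jetP => p; rewrite comp_lfunE (amapE hG) (amapE hF) msub_comp.
by rewrite (amapE (centered_vcomp hF hG)).
Qed.

Lemma amap_id : amap (idvf k n) = \1%VF.
Proof.
by apply: lfun_jetP => p; rewrite (amapE centered_id) msub_idvf id_lfunE.
Qed.

Lemma amap_congr F G : centered F -> centered G ->
  (forall i, F i - G i \in mpow k n d) -> amap F = amap G.
Proof.
move=> hF hG hFG; apply: lfun_jetP => p; rewrite (amapE hF) (amapE hG).
exact/jpi_eqP/msub_congr.
Qed.

Lemma amap_inj F G : centered F -> centered G -> amap F = amap G ->
  forall i, F i - G i \in mpow k n d.
Proof.
move=> hF hG eqFG i; rewrite -jpi_eqP -(msubX F) -(msubX G) -(amapE hF) eqFG.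
by rewrite (amapE hG).
Qed.

Lemma aut_endo phi : is_aut phi -> is_endo phi.
Proof. by case. Qed.

Lemma aut_amap phi : is_aut phi -> phi = amap (vf_of phi).
Proof. by move/aut_endo/endo_amap. Qed.

Lemma aut_centered phi : is_aut phi -> centered (vf_of phi).
Proof. by move/aut_endo/endo_centered. Qed.

Lemma inverse_aut phi psi : is_endo phi ->
  (phi \o psi)%VF = \1%VF -> (psi \o phi)%VF = \1%VF -> is_aut phi.
Proof.
move=> [phi1 phiM] /lfunP h1 /lfunP h2; split=> //.
exists psi => a; first by have := h2 a; rewrite comp_lfunE id_lfunE.
by have := h1 a; rewrite comp_lfunE id_lfunE.
Qed.

Lemma aut_lker phi : is_aut phi -> lker phi == 0%VS.
Proof. by case=> /bij_inj/lker0P. Qed.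

Lemma aut_inv phi : is_aut phi -> is_aut (phi^-1)%VF.
Proof.
move=> hphi; have ker0 := aut_lker hphi; have [_ phi1 phiM] := hphi.
have invK : cancel phi (phi^-1)%VF.
  by move=> a; have /lfunP/(_ a) := lker0_compVf ker0; rewrite comp_lfunE id_lfunE.
have Kinv : cancel (phi^-1)%VF phi.
  by move=> a; have /lfunP/(_ a) := lker0_compfV ker0; rewrite comp_lfunE id_lfunE.
split; first by exists phi.
  by apply: (can_inj invK); rewrite Kinv phi1.
by move=> a b; apply: (can_inj invK); rewrite phiM !Kinv.
Qed.

Lemma aut_comp phi psi : is_aut phi -> is_aut psi -> is_aut (phi \o psi)%VF.
Proof.
move=> [phib phi1 phiM] [psib psi1 psiM]; split; rewrite ?comp_lfunE ?psi1 //.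
  by apply: (eq_bij (bij_comp phib psib)) => a; rewrite comp_lfunE.
by move=> a b; rewrite !comp_lfunE psiM phiM.
Qed.

Definition const_jac F :=
  exists2 c, c != 0 & jac F - c%:MP \in mpow k n d.-1.

Lemma Jac_amap F : centered F -> Jac (amap F) = jpi d.-1 (jac F).
Proof.
move=> hF; rewrite /Jac; set M := \matrix_(i, j) _.
have -> : M = jacmx (vf_of (amap F)) by apply/matrixP => i j; rewrite !mxE ffunE.
by apply/jpi_eqP/jac_congr => i; apply: vf_of_amap.
Qed.

Lemma GJac_amap F : centered F ->
  GJac (amap F) <-> is_aut (amap F) /\ const_jac F.
Proof.
move=> hF; rewrite /GJac Jac_amap //; split=> -[h [c c_neq0 hc]]; split=> //.
  by exists c => //; rewrite -jpi_eqP.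
by exists c => //; apply/jpi_eqP.
Qed.

Lemma GJac_const phi : GJac phi -> const_jac (vf_of phi).
Proof.
move=> h; have haut := h.1; move: h; rewrite {1}(aut_amap haut) GJac_amap.
  by case.
exact: aut_centered.
Qed.

Lemma jac_mod_congr F c (q : P) e : centered F -> q - c%:MP \in mpow k n e ->
  msub F q - c%:MP \in mpow k n e.
Proof. by move=> hF hq; rewrite -(msubC F) -raddfB msub_mpow. Qed.

Lemma GJac_comp phi psi : GJac phi -> GJac psi -> GJac (phi \o psi)%VF.
Proof.
move=> hphi hpsi; have hc := aut_comp hphi.1 hpsi.1; split=> //.
have [c c_neq0 hc1] := GJac_const hphi; have [b b_neq0 hb] := GJac_const hpsi.
rewrite (aut_amap hphi.1) (aut_amap hpsi.1).
move: (aut_centered hphi.1) (aut_centered hpsi.1) hc1 hb.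
move: (vf_of phi) (vf_of psi) => F G hF hG hc1 hb.
rewrite amap_comp // Jac_amap; last exact: centered_vcomp.
exists (b * c); first by rewrite mulf_neq0.
apply/jpi_eqP; rewrite jac_comp mpolyCM.
have -> : msub F (jac G) * jac F - b%:MP * c%:MP =
  (msub F (jac G) - b%:MP) * jac F + b%:MP * (jac F - c%:MP) by ring.
by rewrite rpredD //; [apply/mpowMr/jac_mod_congr|apply: mpowMl].
Qed.

(** The chain rule for phi and its inverse makes the constant term of the
    Jacobian determinant a unit. *)
Lemma aut_jac_const phi : is_aut phi -> (jac (vf_of phi))@_0%MM != 0.
Proof.
move=> haut; have haut' := aut_inv haut.
have : (phi \o phi^-1)%VF = \1%VF by apply: lker0_compfV; apply: aut_lker.
rewrite {1}(aut_amap haut) (aut_amap haut').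
rewrite -amap_id amap_comp; try exact: aut_centered.
move/amap_inj => h.
have /jac_congr : forall i, vcomp (vf_of phi) (vf_of phi^-1) i - idvf k n i \in mpow k n d.
  by apply: h; [apply: centered_vcomp; exact: aut_centered|exact: centered_id].
rewrite jac_comp jac_idvf => /mpow_coeff0 h0.
have := h0 0%MM; rewrite mdeg0 -subn1 subn_gt0 => /(_ d_gt1) /eqP.
rewrite mcoeffB mcoeff1 eqxx subr_eq0 rmorphM /= => /eqP e1.
by apply: contra_eq_neq e1 => ->; rewrite mulr0 eq_sym oner_eq0.
Qed.

Lemma GJac_inv phi : GJac phi -> GJac (phi^-1)%VF.
Proof.
move=> hphi; have haut := hphi.1; have haut' := aut_inv haut; split=> //.
have [c c_neq0 hc] := GJac_const hphi.
have e1 : (amap (vf_of phi) \o amap (vf_of phi^-1))%VF = \1%VF.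
  by rewrite -(aut_amap haut) -(aut_amap haut'); apply/lker0_compfV/aut_lker.
have e2 : (amap (vf_of phi^-1) \o amap (vf_of phi))%VF = \1%VF.
  by rewrite -(aut_amap haut) -(aut_amap haut'); apply/lker0_compVf/aut_lker.
rewrite (aut_amap haut').
move: e1 e2 (aut_centered haut) (aut_centered haut') hc.
move: (vf_of phi) (vf_of phi^-1) => F G e1 e2 hF hG hc.
rewrite Jac_amap //; exists c^-1; first by rewrite invr_eq0.
apply/jpi_eqP; move: e1 e2; rewrite -amap_id !amap_comp //.
move=> /amap_inj e1 /amap_inj e2.
have {e1} hFG : msub F (jac G) - c^-1%:MP \in mpow k n d.-1.
  have /jac_congr : forall i, vcomp F G i - idvf k n i \in mpow k n d.
    by apply: e1; [apply: centered_vcomp|apply: centered_id].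
  rewrite jac_comp jac_idvf => h.
  have cV : c^-1%:MP * c%:MP = 1 :> P by rewrite -mpolyCM mulVf.
  have -> : msub F (jac G) - c^-1%:MP = c^-1%:MP * ((msub F (jac G) * jac F - 1)
     - msub F (jac G) * (jac F - c%:MP)) + msub F (jac G) * (1 - c^-1%:MP * c%:MP).
    by ring.
  rewrite cV subrr mulr0 addr0.
  by apply: mpowMl; rewrite rpredB //; apply: mpowMl.
have := jac_mod_congr hG hFG; rewrite msub_comp => h.
have -> : jac G - c^-1%:MP = (msub (vcomp G F) (jac G) - c^-1%:MP) -
   (msub (vcomp G F) (jac G) - msub (idvf k n) (jac G)).
  by rewrite msub_idvf; ring.
rewrite rpredB //; apply: (mpow_leq (leq_pred d)); apply: msub_congr.
by apply: e2; [apply: centered_vcomp|apply: centered_id].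
Qed.

End JetEndomorphisms.

(** * Derivations of the jet algebra and their exponentials *)

Section JetDerivations.
Variables (k : fieldType) (n d : nat).
Hypothesis char_k : [pchar k] =i pred0.
Hypothesis d_gt1 : (1 < d)%N.
Local Notation A := (jet k n d).
Local Notation P := {mpoly k[n]}.
Local Notation vf := {ffun 'I_n -> P}.
Local Notation x i := (@jpi k n d 'X_i).
Implicit Types (p : P) (F G : vf) (phi psi D E : 'End(A)) (m q : 'X_{1..n}).

Definition dmap_fun F (a : A) : A := jpi d (\sum_i F i * (jrep a)^`M(i)).
Fact dmap_fun_is_linear F : linear (dmap_fun F).
Proof.
move=> c a b; rewrite /dmap_fun -linearP /=; congr (jpi d _).
rewrite scaler_sumr -big_split; apply: eq_bigr => i _ /=.
by rewrite linearP linearP /= mulrDr scalerAr.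
Qed.
HB.instance Definition _ F :=
  GRing.isLinear.Build k A A *:%R (dmap_fun F) (dmap_fun_is_linear F).
Definition dmap F : 'End(A) := linfun (dmap_fun F).

Lemma dmapE F (hF : centered F) p :
  dmap F (jpi d p) = jpi d (\sum_i F i * p^`M(i)).
Proof.
rewrite lfunE /= /dmap_fun; apply/jpi_eqP; rewrite -sumrB; apply: rpred_sum => i _.
rewrite -mulrBr -mderivB -[d](subnKC (ltnW d_gt1)).
apply: mpowM; first exact: hF.
by rewrite subn1; apply: mpow_deriv; rewrite addnC addn1 prednK ?jrep_jpi // ltnW.
Qed.

Lemma dmap_der F : centered F -> is_der (dmap F).
Proof.
move=> hF a b; rewrite -[a]jrepK -[b]jrepK -rmorphM !(dmapE hF) -!rmorphM -rmorphD.
congr (jpi d _); move: (jrep a) (jrep b) => p q.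
rewrite mulr_sumr mulr_suml -big_split; apply: eq_bigr => i _ /=.
by rewrite mderivM; ring.
Qed.

Lemma dmapX F i (hF : centered F) : dmap F (x i) = jpi d (F i).
Proof.
rewrite (dmapE hF); congr (jpi d _); rewrite (bigD1 i) //= mderivXU eqxx.
rewrite mulr1 big1 ?addr0 // => j ne_ji.
by rewrite mderivXU eq_sym (negPf ne_ji) mulr0.
Qed.

Lemma der1 D : is_der D -> D 1 = 0.
Proof.
move=> hD; have := hD 1 1; rewrite !mul1r mulr1 => /eqP.
by rewrite -subr_eq0 opprD addrA subrr add0r oppr_eq0 => /eqP.
Qed.

Lemma der_ext D E : is_der D -> is_der E ->
  (forall i, D (x i) = E (x i)) -> D = E.
Proof.
move=> hD hE eqX; apply: lfun_jetP.
apply: mpoly_gen_ind => [c|i|p q hp hq|p q hp hq] //.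
- by rewrite -alg_mpolyC !linearZ /= rmorph1 !der1.
- by rewrite !raddfD /= hp hq.
- by rewrite rmorphM hD hE hp hq.
Qed.

(** In characteristic zero a derivation preserves the maximal ideal, since
    0 = D (x_i^d) = d x_i^(d-1) D x_i. *)
Lemma der_centered D : is_der D -> centered (vf_of D).
Proof.
move=> hD i; rewrite mpow1E ffunE.
have DX e : D (x i ^+ e) = (x i ^+ e.-1 * D (x i)) *+ e.
  elim: e => [|e IHe]; first by rewrite mulr0n der1.
  rewrite exprS hD IHe /= [D _ * _]mulrC; case: e {IHe} => [|e] /=.
    by rewrite mulr0n mulr0 add0r mulr1n.
  by rewrite mulrnAr mulrA -exprS -mulrSr.
have xd0 : x i ^+ d = 0.
  rewrite -(rmorphXn (jpi d)); apply/jpi_eq0; rewrite mpolyXn.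
  by have := mpowX k (U_(i) *+ d)%MM; rewrite mdegMn mdeg1 mul1n.
have := DX d; rewrite xd0 linear0 -{1}[D (x i)]jrepK -(rmorphXn (jpi d)) -rmorphM.
rewrite -rmorphMn => /esym/jpi_eq0/mpow_coeffP/(_ (U_(i) *+ d.-1)%MM).
rewrite mdegMn mdeg1 mul1n prednK ?leqnn; last exact: ltnW.
rewrite mcoeffMn mpolyXn mulrC; have := mcoeffMX (jrep (D (x i))) (U_(i) *+ d.-1)%MM 0%MM.
rewrite addm0 => ->; rewrite -mulr_natr => /(_ isT).
move/eqP; rewrite mulf_eq0 => /orP[//|].
by rewrite ((pcharf0P k).1 char_k) -leqn0 leqNgt (ltnW d_gt1).
Qed.

Lemma der_dmap D : is_der D -> D = dmap (vf_of D).
Proof.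
move=> hD; have c := der_centered hD; apply: der_ext => //; first exact: dmap_der.
by move=> i; rewrite (dmapX i c) ffunE jrepK.
Qed.

Lemma dmapP c F G : dmap (c *: F + G) = c *: dmap F + dmap G.
Proof.
apply/lfunP => a; rewrite add_lfunE scale_lfunE !lfunE /= /dmap_fun -linearP /=.
congr (jpi d _); rewrite scaler_sumr -big_split; apply: eq_bigr => i _ /=.
by rewrite !ffunE mulrDl scalerAl.
Qed.

Lemma dmapD F G : dmap (F + G) = dmap F + dmap G.
Proof. by have := dmapP 1 F G; rewrite !scale1r. Qed.

Lemma dmap0 : dmap 0 = 0.
Proof.
by have := dmapP (-1) 0 0; rewrite scaler0 addr0 scaleN1r addNr.
Qed.

Lemma dmapZ c F : dmap (c *: F) = c *: dmap F.
Proof. by have := dmapP c F 0; rewrite !addr0 dmap0 addr0. Qed.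

(** The vector field p d/dx_j, and the automorphism x_j |-> x_j + c x^m. *)
Definition mvf j p : vf := [ffun i => if i == j then p else 0].
Definition elem j m (c : k) : vf := idvf k n + c *: mvf j 'X_[m].

Lemma mvf_centered j p : p \in mpow k n 1 -> centered (mvf j p).
Proof. by move=> hp i; rewrite ffunE; case: eqP => // _; apply: rpred0. Qed.

Lemma mpowX1 m : m != 0%MM -> 'X_[m] \in mpow k n 1.
Proof. by move=> m_neq0; rewrite mpow1E mcoeffX (negPf m_neq0). Qed.

Lemma elem_centered j m c : m != 0%MM -> centered (elem j m c).
Proof.
move=> m_neq0 i; rewrite !ffunE rpredD //; first by rewrite -(mdeg1 i) mpowX.
by apply: mpowZ; case: eqP => _; [apply: mpowX1|apply: rpred0].
Qed.

Lemma msub_elem_fix j m c q : q j = 0%N -> msub (elem j m c) 'X_[q] = 'X_[q].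
Proof.
move=> qj; rewrite (mpolyXE_id _ q) rmorph_prod; apply: eq_bigr => i _.
rewrite rmorphXn /= msubX !ffunE; case: eqP => [->|_]; first by rewrite qj !expr0.
by rewrite scaler0 addr0.
Qed.

Lemma vcomp_elem j m c b : m j = 0%N ->
  vcomp (elem j m c) (elem j m b) = elem j m (c + b).
Proof.
move=> mj; apply/ffunP => i; rewrite !ffunE raddfD /= linearZ /= msubX !ffunE.
rewrite scalerDl addrA; case: eqP => _; last by rewrite (raddf0 (msub (elem j m c))) !scaler0.
by rewrite msub_elem_fix.
Qed.

Lemma elem0 j m : elem j m 0 = idvf k n.
Proof. by rewrite /elem scale0r addr0. Qed.

(** The exponent of x^q after l of its factors x_j are replaced by x^m. *)
Definition shift j m l q : 'X_{1..n} := (q - U_(j) *+ l + m *+ l)%MM.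

Lemma dmap_mvfX j m q : m != 0%MM ->
  dmap (mvf j 'X_[m]) (jpi d 'X_[q]) = (q j)%:R *: jpi d 'X_[q - U_(j) + m].
Proof.
move=> m_neq0; rewrite (dmapE (mvf_centered j (mpowX1 m_neq0))) -linearZ /=.
congr (jpi d _); rewrite (bigD1 j) //= big1 => [|i ne_ij]; last first.
  by rewrite ffunE (negPf ne_ij) mul0r.
by rewrite ffunE eqxx addr0 mderivX -scalerAr mpolyXD mulrC.
Qed.

Lemma iter_dmap j m c l q : m j = 0%N -> m != 0%MM ->
  iter l (c *: dmap (mvf j 'X_[m])) (jpi d 'X_[q]) =
  (c ^+ l * (q j ^_ l)%:R) *: jpi d 'X_[shift j m l q].
Proof.
move=> mj m_neq0; elim: l => [|l IHl].
  rewrite /= expr0 mul1r ffactn0 scale1r /shift !mulm0n addm0.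
  by congr (jpi d 'X_[_]); apply/mnmP => i; rewrite mnmBE mnm0E subn0.
rewrite iterS IHl linearZ /= scale_lfunE dmap_mvfX //= !scalerA.
have -> : (shift j m l q j) = (q j - l)%N.
  by rewrite mnmDE mnmBE !mulmnE mnm1E eqxx mul1n mj mul0n addn0.
have -> : (shift j m l q - U_(j) + m)%MM = shift j m l.+1 q.
  apply/mnmP => i; rewrite !(mnmDE, mnmBE, mulmnE) mnm1E.
  case: eqP => [<-|_]; first by rewrite mj !mul1n !mul0n !addn0 subnS subn1.
  by rewrite !mul0n !subn0 -addnA mulnS [(_ * l + _)%N]addnC.
by rewrite ffactnSr natrM exprSr; congr (_ *: _); ring.
Qed.

Lemma iter_lfun0 D r l v : (forall v, iter r D v = 0) -> (r <= l)%N -> iter l D v = 0.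
Proof. by move=> Dr0 le_rl; rewrite -(subnKC le_rl) iterD Dr0. Qed.

Lemma iter_lfunP D l c u v : iter l D (c *: u + v) = c *: iter l D u + iter l D v.
Proof. by elim: l => //= l ->; rewrite linearP. Qed.

(** The binomial formula for (x_j + c x^m)^(q_j) is the exponential series,
    because x^m does not involve x_j. *)
Lemma exp_elem j m c r : m j = 0%N -> m != 0%MM ->
    (forall v, iter r (c *: dmap (mvf j 'X_[m])) v = 0) ->
  forall v, amap d (elem j m c) v =
    \sum_(i < r) (i`!%:R)^-1 *: iter i (c *: dmap (mvf j 'X_[m])) v.
Proof.
move=> mj m_neq0 Dr0 v; rewrite -[v]jrepK.
elim/mpolyind: (jrep v) => [|b q p _ _ IHp].
  rewrite !linear0 big1 // => i _; elim: (i : nat) => [|l IHl] //=; rewrite ?scaler0 //.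
  by have := iter_lfunP (c *: dmap (mvf j 'X_[m])) l.+1 (-1) 0 0;
    rewrite /= scaler0 addr0 scaleN1r addNr => ->; rewrite scaler0.
rewrite !linearP /= IHp; under [RHS]eq_bigr do rewrite iter_lfunP scalerDr scalerA mulrC -scalerA.
rewrite big_split /= -scaler_sumr; congr (b *: _ + _).
under eq_bigr do rewrite iter_dmap // scalerA.
(* The terms T l vanish both for l >= r and for l > q_j. *)
pose T l : A := ('C(q j, l)%:R * c ^+ l) *: jpi d 'X_[shift j m l q].
have TE l : T l = (l`!%:R)^-1 *: iter l (c *: dmap (mvf j 'X_[m])) (jpi d 'X_[q]).
  rewrite iter_dmap // scalerA /T -bin_ffact natrM; congr (_ *: _).
  have : l`!%:R != 0 :> k by rewrite -(prednK (fact_gt0 l)) natr_neq0.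
  by move=> h; field.
rewrite (eq_bigr (fun i : 'I_r => T i)) => [|i _]; last first.
  by rewrite TE iter_dmap // scalerA.
have -> : \sum_(i < r) T i = \sum_(i < (q j).+1) T i.
  rewrite -!(big_mkord xpredT T).
  have tail a e : (forall l, (a <= l)%N -> T l = 0) -> (a <= e)%N ->
     \sum_(0 <= l < e) T l = \sum_(0 <= l < a) T l.
    move=> T0 le_ab; rewrite (big_cat_nat (n := a)) //= [X in _ + X = _]big_nat.
    rewrite [X in _ + X]big1 ?addr0 //.
    by move=> l /andP[/T0].
  have Tr l : (r <= l)%N -> T l = 0 by move=> h; rewrite TE (iter_lfun0 _ Dr0) // scaler0.
  have Tq l : (q j < l)%N -> T l = 0 by move=> h; rewrite /T bin_small // mul0r scale0r.
  by rewrite -(tail _ _ Tr (leq_maxl r (q j).+1)) (tail _ _ Tq (leq_maxr _ _)).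
rewrite (amapE d (elem_centered _ _ m_neq0)).
have -> : msub (elem j m c) 'X_[q] =
   ('X_j + c *: 'X_[m]) ^+ q j * 'X_[q - U_(j) *+ q j].
  have {1}-> : q = (U_(j) *+ q j + (q - U_(j) *+ q j))%MM.
    apply/mnmP => i; rewrite mnmDE mnmBE mulmnE mnm1E; case: eqP => [<-|_].
      by rewrite mul1n subnn addn0.
    by rewrite mul0n subn0.
  rewrite mpolyXD rmorphM -mpolyXn rmorphXn /= msubX !ffunE eqxx msub_elem_fix //.
  by rewrite mnmBE mulmnE mnm1E eqxx mul1n subnn.
rewrite exprDn mulr_suml raddf_sum; apply: eq_bigr => l _ /=.
have le_l : (l <= q j)%N by rewrite -ltnS.
rewrite /T -linearZ /=; congr (jpi d _).
rewrite exprZn -scalerAr -scaler_nat scalerA -scalerAl; congr (_ *: _).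
rewrite !mpolyXn -!mpolyXD; congr 'X_[_]; apply/mnmP => i.
rewrite !(mnmDE, mnmBE, mulmnE) mnm1E; case: eqP => [<-|_].
  by rewrite mj !mul1n !mul0n subnn !addn0.
by rewrite !mul0n !subn0 add0n addnC.
Qed.

Lemma dmap_nilpotent j m c v : m j = 0%N -> m != 0%MM ->
  iter d (c *: dmap (mvf j 'X_[m])) v = 0.
Proof.
move=> mj m_neq0; rewrite -[v]jrepK; set D := c *: _.
have D0 : iter d D 0 = 0.
  by have := iter_lfunP D d (-1) 0 0; rewrite scaler0 addr0 scaleN1r addNr.
elim/mpolyind: (jrep v) => [|b q p _ _ IHp]; first by rewrite raddf0.
rewrite linearP /= iter_lfunP IHp addr0.
have [lt_q|ge_q] := ltnP (mdeg q) d.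
  rewrite iter_dmap // ffact_small ?mulr0 ?scale0r ?scaler0 //.
  by apply: leq_ltn_trans lt_q; rewrite mdegE (bigD1 j) //= leq_addr.
rewrite (_ : jpi d 'X_[q] = 0) ?D0 ?scaler0 //.
by apply/jpi_eq0; apply: mpow_leq ge_q (mpowX _ _).
Qed.

Lemma is_exp_elem j m c phi : m j = 0%N -> m != 0%MM ->
  is_exp (c *: dmap (mvf j 'X_[m])) phi <-> phi = amap d (elem j m c).
Proof.
move=> mj m_neq0; split=> [[r Dr0 hphi]|->].
  by apply/lfunP => v; rewrite hphi (exp_elem mj m_neq0 Dr0).
by exists d => v; [apply: dmap_nilpotent|apply: exp_elem => // u; apply: dmap_nilpotent].
Qed.

End JetDerivations.

(** * Generation of the general linear group *)

Section GeneralLinearGenerators.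
Variables (k : fieldType) (n : nat) (S : 'M[k]_n -> Prop).
Hypothesis S_diag : forall t : 'rV[k]_n, (forall i, t 0 i != 0) -> S (diag_mx t).
Hypothesis S_elem : forall i j c, i != j -> S (1%:M + c *: delta_mx i j).
Hypothesis S_mul : forall A B, S A -> S B -> S (A *m B).

Lemma S_row_elem i (w : 'I_n -> k) (s : seq 'I_n) : i \notin s ->
  S (1%:M + \sum_(l <- s) w l *: delta_mx i l).
Proof.
elim: s => [|l s IHs]; first by rewrite big_nil addr0 -diag_const_mx => _;
  apply: S_diag => j; rewrite mxE oner_eq0.
rewrite inE negb_or => /andP[ne_il i_s]; rewrite big_cons.
have -> : 1%:M + (w l *: delta_mx i l + \sum_(j <- s) w j *: delta_mx i j) =
    (1%:M + \sum_(j <- s) w j *: delta_mx i j) *m (1%:M + w l *: delta_mx i l).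
  rewrite mulmxDr mulmx1 mulmxDl mul1mx mulmx_suml big_seq [X in _ + (_ + X)]big_seq.
  rewrite [X in _ + (_ + X)]big1 => [|j js].
    by rewrite addr0 -addrA; congr (_ + _); rewrite addrC.
  rewrite -scalemxAl -scalemxAr mul_delta_mx_0 ?scaler0 //.
  by apply: contraNneq i_s => <-.
by apply: S_mul; [apply: IHs|apply: S_elem].
Qed.

(** Gaussian elimination by column operations, one row at a time. *)
Lemma GL_generated A : A \in unitmx -> S A.
Proof.
pose good r (B : 'M[k]_n) := B \in unitmx /\
  forall i : 'I_n, (i < r)%N -> forall j, B i j = (i == j)%:R.
suff H r B : (r <= n)%N -> good (n - r)%N B -> S B.
  by move=> uA; apply: (H n) => //; split=> // i; rewrite subnn.
elim: r B => [|r IHr] B le_r [uB hB].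
  have -> : B = 1%:M by apply/matrixP => i j; rewrite hB ?subn0 // mxE.
  by rewrite -diag_const_mx; apply: S_diag => j; rewrite mxE oner_eq0.
have lt_i : (n - r.+1 < n)%N by rewrite ltn_subrL; case: (n) le_r.
pose i0 := Ordinal lt_i; have e0 : (n - r)%N = i0.+1 by rewrite /= subnSK.
have ne0 (i : 'I_n) : (i < n - r.+1)%N -> i != i0.
  by move=> lt; apply: contraTneq lt => ->; rewrite ltnn.
have delta_col (C : 'M[k]_n) a b i j : (C *m delta_mx a b) i j = C i a * (j == b)%:R.
  rewrite mxE (bigD1 a) //= mxE eqxx /= big1 ?addr0 // => l ne_la.
  by rewrite mxE (negPf ne_la) mulr0.
(* With a pivot 1 at (i0, i0), column operations clear the rest of row i0. *)
have stepC (C : 'M[k]_n) : good (n - r.+1)%N C -> C i0 i0 = 1 -> S C.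
  move=> [uC hC] C1; pose s := rem i0 (enum 'I_n).
  have i0_s : i0 \notin s by rewrite mem_rem_uniq ?enum_uniq // inE eqxx.
  pose R c : 'M[k]_n := 1%:M + \sum_(l <- s) (c * C i0 l) *: delta_mx i0 l.
  have RE c (D : 'M[k]_n) i j :
      (D *m R c) i j = D i j + D i i0 * ((j != i0)%:R * (c * C i0 j)).
    rewrite mulmxDr mulmx1 mxE; congr (_ + _); rewrite mulmx_sumr summxE.
    under eq_bigr do rewrite -scalemxAr mxE delta_col mulrCA.
    rewrite -mulr_sumr; congr (_ * _).
    have [->|ne_j] := eqVneq j i0.
      rewrite mul0r big_seq big1 // => l; rewrite mem_rem_uniq ?enum_uniq //.
      by rewrite inE eq_sym => /andP[/negPf -> _]; rewrite mulr0.
    rewrite mul1r (bigD1_seq j) ?rem_uniq ?enum_uniq //=; last first.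
      by rewrite mem_rem_uniq ?enum_uniq // inE ne_j mem_enum.
    rewrite eqxx mulr1 big1 ?addr0 // => l /negPf ne_l.
    by rewrite eq_sym ne_l mulr0.
  have -> : C = (C *m R (-1)) *m R 1.
    apply/matrixP => i j; rewrite !RE eqxx mul0r mulr0 addr0.
    by case: (j != i0); ring.
  have SR c : S (R c) by apply: S_row_elem.
  have uR : R (-1) \in unitmx.
    have /mulmx1_unit[] // : R (-1) *m R 1 = 1%:M.
    apply/matrixP => i j; rewrite RE -[R (-1)]mul1mx !RE !eqxx mul0r mulr0 addr0.
    by case: (j != i0); ring.
  apply: S_mul => //; apply: IHr; first exact: ltnW.
  split=> [|i]; first by rewrite unitmx_mul uC.
  rewrite e0 ltnS leq_eqVlt => /orP[/eqP/val_inj ->|lt_i'] j.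
    rewrite RE C1; have [->|ne_j] := eqVneq j i0; last by rewrite /=; ring.
    by rewrite C1 mul0r mulr0 addr0.
  by rewrite RE [C i i0]hC // (negPf (ne0 _ lt_i')) mul0r addr0 hC.
(* A nonzero pivot is normalized by a diagonal matrix. *)
have stepB (C : 'M[k]_n) : good (n - r.+1)%N C -> C i0 i0 != 0 -> S C.
  move=> [uC hC] C_neq0.
  pose t c : 'rV[k]_n := \row_l (if l == i0 then c else 1).
  have tE c (D : 'M[k]_n) i j : (D *m diag_mx (t c)) i j = D i j * t c 0 j.
    by rewrite mul_mx_diag mxE.
  have -> : C = (C *m diag_mx (t (C i0 i0)^-1)) *m diag_mx (t (C i0 i0)).
    apply/matrixP => i j; rewrite !tE !mxE; case: eqP => [->|_]; last by rewrite !mulr1.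
    by rewrite mulfVK.
  have tn c i : c != 0 -> t c 0 i != 0.
    by move=> c_neq0; rewrite mxE; case: (i == i0); rewrite ?oner_eq0.
  apply: S_mul; last by apply: S_diag => i; apply: tn.
  apply: stepC; last by rewrite tE mxE eqxx mulfV.
  split=> [|i lt_i' j].
    rewrite unitmx_mul uC unitmxE det_diag unitfE.
    by apply/prodf_neq0 => i _; apply: tn; rewrite invr_eq0.
  rewrite tE hC // mxE; case: (eqVneq j i0) => [->|_]; last by rewrite mulr1.
  by rewrite (negPf (ne0 _ lt_i')) mul0r.
(* A zero pivot is replaced by adding a later column; there is one that works,
   as otherwise row i0 would be a combination of the preceding rows. *)
have [B0|] := eqVneq (B i0 i0) 0; last exact: stepB.
have [j le_j Bj] : exists2 j : 'I_n, (n - r.+1 <= j)%N & B i0 j != 0.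
  apply/exists_inP; apply: contraT; rewrite negb_exists_in => /forall_inP Bz.
  pose v : 'rV[k]_n := delta_mx 0 i0 - row i0 B.
  have vB : v *m B = 0.
    apply/rowP => l; rewrite mulmxBl -rowE !mxE.
    rewrite (eq_bigr (fun j => B i0 j * (j == l)%:R)) => [|j _]; last first.
      rewrite mxE; have [lt_j|le_j] := ltnP j (n - r.+1); first by rewrite (hB j lt_j).
      by have := Bz j le_j; rewrite negbK => /eqP ->; rewrite !mul0r.
    rewrite (bigD1 l) //= eqxx mulr1 big1 ?addr0 ?subrr // => j ne_jl.
    by rewrite (negPf ne_jl) mulr0.
  have v0 : v = 0 by rewrite -[v](mulmxK uB) vB mul0mx.
  have := congr1 (fun u : 'rV_n => u 0 i0) v0; rewrite !mxE !eqxx B0 subr0 => /eqP.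
  by rewrite oner_eq0.
have ne_j : j != i0 by apply: contraNneq Bj => ->; rewrite B0.
have EE c (D : 'M[k]_n) i l :
    (D *m (1%:M + c *: delta_mx j i0)) i l = D i l + c * (D i j * (l == i0)%:R).
  by rewrite mulmxDr mulmx1 mxE -scalemxAr [X in _ + X]mxE delta_col.
have -> : B = (B *m (1%:M + 1 *: delta_mx j i0)) *m (1%:M + (-1) *: delta_mx j i0).
  apply/matrixP => i l; rewrite !EE (negPf ne_j) /=; ring.
apply: S_mul; last exact: S_elem.
apply: stepB; last by rewrite EE B0 eqxx mulr1 mul1r add0r.
split=> [|i lt_i' l].
  rewrite unitmx_mul uB; have /mulmx1_unit[] // :
    (1%:M + 1 *: delta_mx j i0) *m (1%:M + (-1) *: delta_mx j i0) = 1%:M :> 'M[k]_n.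
  apply/matrixP => a b; rewrite EE -[1%:M + 1 *: _]mul1mx !EE (negPf ne_j) /=; ring.
rewrite EE !hB // (_ : i == j = false) ?mul0r ?mulr0 ?addr0 //.
by apply: contraTF lt_i' => /eqP ->; rewrite -leqNgt.
Qed.

End GeneralLinearGenerators.

(** * Root subgroups, the torus and the group H *)

Section Roots.
Variables (k : fieldType) (n d : nat).
Hypothesis char_k : [pchar k] =i pred0.
Hypothesis d_gt1 : (1 < d)%N.
Local Notation A := (jet k n d).
Local Notation P := {mpoly k[n]}.
Local Notation vf := {ffun 'I_n -> P}.
Local Notation Zn := {ffun 'I_n -> int}.
Local Notation x i := (@jpi k n d 'X_i).
Local Notation dmon j m := (@dmap k n d (mvf j 'X_[m])).
Implicit Types (F G : vf) (phi D : 'End(A)) (m q : 'X_{1..n}) (alpha beta : Zn).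

(** The degree of the field x^m d/dx_j. *)
Definition eroot j m : Zn := expZ m - expZ U_(j)%MM.

Lemma erootE j m i : eroot j m i = (m i)%:Z - (j == i)%:Z.
Proof. by rewrite !ffunE mnm1E. Qed.

Lemma expZ_inj : injective (@expZ n).
Proof.
move=> m q eq_mq; apply/mnmP => i.
by have := congr1 (fun f : Zn => f i) eq_mq; rewrite !ffunE => -[].
Qed.

Lemma expZD m q : expZ (m + q)%MM = expZ m + expZ q.
Proof. by apply/ffunP => i; rewrite !ffunE mnmDE PoszD. Qed.

Lemma xmon_exp m : xmon k (expZ m) = 'X_[m].
Proof.
rewrite /xmon; case: ifP => [_|/forallP[]]; last by move=> i; rewrite ffunE.
by congr 'X_[_]; apply/mnmP => i; rewrite mnmE ffunE.
Qed.

Lemma xmon_neg beta i : beta i < 0 -> xmon k beta = 0.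
Proof.
by rewrite /xmon; case: ifP => // /forallP/(_ i); rewrite leNgt => /negPf ->.
Qed.

Lemma expZ_nonneg beta : (forall i, 0 <= beta i) -> exists m, beta = expZ m.
Proof.
move=> b0; exists [multinom `|beta i|%N | i < n]; apply/ffunP => i.
by rewrite ffunE mnmE gez0_abs.
Qed.

Lemma monomial_or_neg beta :
  (exists m, beta = expZ m) \/ (exists i, beta i < 0).
Proof.
have [/forallP/expZ_nonneg|] := boolP [forall i, 0 <= beta i]; first by left.
by rewrite negb_forall => /existsP[i]; rewrite -ltNge; right; exists i.
Qed.

Lemma expZ_eroot q j m : (0 < q j)%N -> expZ q + eroot j m = expZ (q - U_(j) + m)%MM.
Proof.
move=> qj; have {1}-> : q = (q - U_(j) + U_(j))%MM by rewrite submK // lep1mP -lt0n.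
by rewrite !expZD /eroot addrACA subrr addr0.
Qed.

Lemma xmon_shift j m q :
  (q j)%:R *: xmon k (expZ q + eroot j m) = (q j)%:R *: 'X_[q - U_(j) + m].
Proof.
case: (posnP (q j)) => [->|qj]; first by rewrite !scale0r.
by rewrite expZ_eroot // xmon_exp.
Qed.

Lemma mvf_homogeneous j m : m != 0%MM ->
  homogeneous (eroot j m) (dmon j m).
Proof.
move=> m_neq0 beta a [c ->]; have [[q ->]|[i bi]] := monomial_or_neg beta; last first.
  by exists 0; rewrite (xmon_neg bi) linear0 scaler0 linear0 scale0r.
exists (c * (q j)%:R).
rewrite xmon_exp linearZ /= dmap_mvfX // -scalerA; congr (c *: _).
by rewrite -!jpi_is_scalable xmon_shift.
Qed.

Lemma piece_scale alpha c D : der_piece alpha D -> der_piece alpha (c *: D).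
Proof.
move=> [hD hom]; split=> [a b|beta a /hom[e De]].
  by rewrite !scale_lfunE hD scalerDr (jscaleAl c (D a)) [in LHS]mulrC (jscaleAl c (D b)) mulrC.
by exists (c * e); rewrite scale_lfunE De scalerA.
Qed.

Lemma piece_add alpha D E : der_piece alpha D -> der_piece alpha E ->
  der_piece alpha (D + E).
Proof.
move=> [hD homD] [hE homE]; split=> [a b|beta a h].
  by rewrite !add_lfunE hD hE; ring.
have [c Dc] := homD _ _ h; have [e Ee] := homE _ _ h.
by exists (c + e); rewrite add_lfunE Dc Ee scalerDl.
Qed.

Lemma piece0 alpha : der_piece alpha (0 : 'End(A)).
Proof.
split=> [a b|beta a _]; first by rewrite !zero_lfunE mulr0 mul0r addr0.
by exists 0; rewrite zero_lfunE scale0r.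
Qed.

Lemma piece_sum alpha (I : Type) (r : seq I) (B : pred I) (D : I -> 'End(A)) :
  (forall i, B i -> der_piece alpha (D i)) ->
  der_piece alpha (\sum_(i <- r | B i) D i).
Proof. by move=> h; apply: big_ind => //; [apply: piece0|apply: piece_add]. Qed.

Lemma piece_gen alpha D i : der_piece alpha D ->
  exists c, D (x i) = c *: jpi d (xmon k (expZ U_(i)%MM + alpha)).
Proof. by case=> _; apply; exists 1; rewrite scale1r xmon_exp. Qed.

Lemma mvf_piece j m : m != 0%MM -> der_piece (eroot j m) (dmon j m).
Proof.
by move=> m_neq0; split; [apply/dmap_der/mvf_centered/mpowX1|apply: mvf_homogeneous].
Qed.

Lemma mvf_neq0 j m : m != 0%MM -> (mdeg m < d)%N -> dmon j m != 0 :> 'End(A).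
Proof.
move=> m_neq0 lt_m; apply: contraTneq lt_m => /lfunP/(_ (x j)).
rewrite (dmapX d_gt1 j (mvf_centered j (mpowX1 k m_neq0))) zero_lfunE ffunE eqxx.
move/jpi_eq0/mpow_coeffP/(_ m); rewrite mcoeffX eqxx ltnNge => h.
by apply/negP => lt; have /eqP := h lt; rewrite oner_eq0.
Qed.

(** A homogeneous derivation whose degree has a negative coordinate kills all
    the variables but one. *)
Lemma piece_negative alpha D j : der_piece alpha D -> alpha j < 0 ->
  D = 0 \/ exists c m, [/\ D = c *: dmon j m, alpha = eroot j m,
                           m j = 0%N & m != 0%MM].
Proof.
move=> hD aj.
have D_other i : i != j -> D (x i) = 0.
  move=> ne_ij; have [c ->] := piece_gen i hD.
  rewrite (xmon_neg (i := j)) ?linear0 ?scaler0 //.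
  by rewrite !ffunE mnm1E (negPf ne_ij) add0r.
have [c Dj] := piece_gen j hD.
have Dext (E : 'End(A)) : is_der E -> (forall i, i != j -> E (x i) = 0) ->
    D (x j) = E (x j) -> D = E.
  move=> hE Ei Ej; apply: der_ext; rewrite ?hD.1 //; first by case: hD.
  by move=> i; have [->//|ne_ij] := eqVneq i j; rewrite D_other // Ei.
have der0 : is_der (0 : 'End(A)) by case: (piece0 0).
have [[m eq_m]|[i bi]] := monomial_or_neg (expZ U_(j)%MM + alpha); last first.
  left; apply: Dext => // [i' _|]; first by rewrite zero_lfunE.
  by rewrite Dj (xmon_neg bi) linear0 scaler0 zero_lfunE.
have alphaE : alpha = eroot j m by rewrite /eroot -eq_m addrAC subrr add0r.
have mj : m j = 0%N.
  by move: aj; rewrite alphaE erootE eqxx; case: (m j) => // e; rewrite subr_lt0.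
have [m0|m_neq0] := eqVneq m 0%MM.
  left; apply: Dext => // [i' _|]; first by rewrite zero_lfunE.
  have := der_centered char_k d_gt1 hD.1 j; rewrite ffunE mpow1E Dj eq_m xmon_exp m0.
  rewrite mpolyX0 -linearZ /= jrep_coeff ?mdeg0 ?(ltnW d_gt1) // mcoeffZ mcoeff1 eqxx.
  by rewrite mulr1 => /eqP ->; rewrite scale0r linear0 zero_lfunE.
right; exists c, m; split=> //; apply: Dext.
- by case: (piece_scale c (mvf_piece j m_neq0)).
- move=> i ne_ij; rewrite scale_lfunE.
  rewrite (dmapX d_gt1 i (mvf_centered j (mpowX1 k m_neq0))) ffunE (negPf ne_ij).
  by rewrite linear0 scaler0.
rewrite scale_lfunE (dmapX d_gt1 j (mvf_centered j (mpowX1 k m_neq0))) ffunE eqxx.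
by rewrite Dj eq_m xmon_exp.
Qed.

Lemma outer_root_eroot alpha : outer_root k d alpha ->
  exists j m, [/\ alpha = eroot j m, m j = 0%N & m != 0%MM].
Proof.
move=> [[_ [D D_neq0 hD]] nneg].
have [[m eq_m]|[j aj]] := monomial_or_neg alpha.
  by case: nneg => i; rewrite eq_m ffunE.
have [D0|[c [m [_ ? ? ?]]]] := piece_negative hD aj; last by exists j, m.
by rewrite D0 eqxx in D_neq0.
Qed.

Lemma eroot_jet_root j m : eroot j m != 0 -> m != 0%MM -> (mdeg m < d)%N ->
  jet_root k d (eroot j m).
Proof.
move=> a_neq0 m_neq0 lt_m; split=> //.
by exists (dmon j m); [apply: mvf_neq0|apply: mvf_piece].
Qed.

Lemma eroot_neg j m : m j = 0%N -> eroot j m j = -1.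
Proof. by move=> mj; rewrite erootE mj eqxx. Qed.

Lemma eroot_outer j m : m j = 0%N -> m != 0%MM -> (mdeg m < d)%N ->
  outer_root k d (eroot j m).
Proof.
move=> mj m_neq0 lt_m; have aj := eroot_neg mj; split=> [|/(_ j)]; last by rewrite aj.
by apply: eroot_jet_root => //; apply/eqP => a0; rewrite a0 ffunE in aj.
Qed.

Lemma pder_mvf j m : m != 0%MM ->
  induces (pder (eroot j m) (@dualb k n j)) (dmon j m).
Proof.
move=> m_neq0 f; rewrite (dmapE d_gt1 (mvf_centered j (mpowX1 k m_neq0))).
congr (jpi d _); rewrite (bigD1 j) //= big1 => [|i ne_ij]; last first.
  by rewrite ffunE (negPf ne_ij) mul0r.
rewrite ffunE eqxx addr0 [in LHS](mpolyE f) raddf_sum mulr_sumr /pder.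
apply: eq_bigr => q _ /=; rewrite mderivZ mderivX -scalerAr -scalerAr mulrC -mpolyXD.
rewrite -xmon_shift scalerA; congr (_ * _ *: _).
by rewrite /dualb ffunE.
Qed.

Lemma root_subgroup_elem j m phi : m j = 0%N -> m != 0%MM ->
  root_subgroup (eroot j m) phi <-> exists c, phi = amap d (elem j m c).
Proof.
move=> mj m_neq0; split=> [[i [ai [D [hD [c hc]]]]]|[c ->]].
  have eij : j = i.
    by apply/eqP; move: ai; rewrite erootE; case: (j == i) => //; case: (m i).
  rewrite -{i}eij in ai hD.
  have DE : D = dmon j m.
    by apply: lfun_jetP => p; rewrite hD (pder_mvf j m_neq0).
  by exists c; apply/(is_exp_elem char_k d_gt1) => //; rewrite -DE.
exists j; split; first exact: eroot_neg.
exists (dmon j m); split; first exact: pder_mvf.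
by exists c; apply/(is_exp_elem char_k d_gt1).
Qed.

End Roots.

Section GeneratedGroup.
Variables (k : fieldType) (n d : nat).
Hypothesis char_k : [pchar k] =i pred0.
Hypothesis d_gt1 : (1 < d)%N.
Local Notation A := (jet k n d).
Local Notation P := {mpoly k[n]}.
Local Notation vf := {ffun 'I_n -> P}.
Local Notation x i := (@jpi k n d 'X_i).
Local Notation H := (@subgroupH k n d).
Implicit Types (F G : vf) (phi D : 'End(A)) (m q : 'X_{1..n}).

Definition linf (L : 'M[k]_n) : vf := vlin L (idvf k n).

Lemma linf_centered L : centered (linf L).
Proof. exact/centered_vlin/centered_id. Qed.

Lemma linf_comp L M : (amap d (linf L) \o amap d (linf M))%VF = amap d (linf (M *m L)).
Proof.
rewrite amap_comp; try exact: linf_centered.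
by rewrite /linf vcomp_vlin vlin_comp.
Qed.

Lemma linf1 : linf 1%:M = idvf k n.
Proof. exact: vlin1. Qed.

Lemma linf_aut L : L \in unitmx -> is_aut (amap d (linf L)).
Proof.
move=> uL; apply: (inverse_aut (psi := amap d (linf (invmx L)))).
- exact/amap_endo/linf_centered.
- by rewrite linf_comp mulVmx // linf1 amap_id.
- by rewrite linf_comp mulmxV // linf1 amap_id.
Qed.

Lemma linf_GJac L : L \in unitmx -> GJac (amap d (linf L)).
Proof.
move=> uL; apply/GJac_amap; first exact: linf_centered.
split; first exact: linf_aut.
exists (\det L); first by rewrite -unitfE -unitmxE.
by rewrite jac_vlin jac_idvf mulr1 subrr rpred0.
Qed.

(** A polynomial automorphism of k[x] has invertible, hence constant,
    Jacobian determinant. *)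
Lemma elem_GJac j m (c : k) : m j = 0%N -> m != 0%MM -> GJac (amap d (elem j m c)).
Proof.
move=> mj m_neq0; have cent b := elem_centered j b m_neq0.
apply/GJac_amap => //; split.
  apply: (inverse_aut (psi := amap d (elem j m (- c)))); first exact: amap_endo.
    by rewrite amap_comp // vcomp_elem // subrr elem0 amap_id.
  by rewrite amap_comp // vcomp_elem // addNr elem0 amap_id.
have := jac_comp (elem j m c) (elem j m (- c)).
rewrite vcomp_elem // subrr elem0 jac_idvf => /esym/mpoly_intro_unit.
case/andP=> /eqP jacC; rewrite unitfE => c_neq0.
by exists (jac (elem j m c))@_0%MM; rewrite // -jacC subrr rpred0.
Qed.

Lemma torus_linf phi : torus phi ->
  exists2 t : 'rV[k]_n, forall i, t 0 i != 0 & phi = amap d (linf (diag_mx t)).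
Proof.
move=> [haut [t t_neq0 ht]]; exists (\row_i t i) => [i|]; first by rewrite mxE.
apply: endo_ext; first exact: aut_endo.
  exact/amap_endo/linf_centered.
move=> i; rewrite ht (amapE d (linf_centered _)) msubX ffunE (bigD1 i) //= big1.
  by rewrite addr0 !mxE eqxx mulr1n ffunE linearZ.
by move=> j ne_ji; rewrite !mxE eq_sym (negPf ne_ji) mulr0n scale0r.
Qed.

Lemma linf_torus (t : 'rV[k]_n) : (forall i, t 0 i != 0) ->
  torus (amap d (linf (diag_mx t))).
Proof.
move=> t_neq0; split.
  by apply: linf_aut; rewrite unitmxE det_diag unitfE; apply/prodf_neq0 => i _.
exists (t 0) => // i.
rewrite (amapE d (linf_centered _)) msubX ffunE (bigD1 i) //= big1.
  by rewrite addr0 !mxE eqxx mulr1n ffunE linearZ.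
by move=> j ne_ji; rewrite !mxE eq_sym (negPf ne_ji) mulr0n scale0r.
Qed.

Lemma H_GJac phi : H phi -> GJac phi.
Proof.
elim=> [|f|f g _ hf _ hg|f _ hf].
- by rewrite -(amap_id k n d) -(linf1); apply/linf_GJac/unitmx1.
- case=> [/torus_linf[t t_neq0 ->]|[alpha [halpha hroot]]].
    by apply: linf_GJac; rewrite unitmxE det_diag unitfE; apply/prodf_neq0 => i _.
  have [j [m [eq_a mj m_neq0]]] := outer_root_eroot char_k d_gt1 halpha.
  move: hroot; rewrite eq_a => /(root_subgroup_elem char_k d_gt1 f mj m_neq0)[c ->].
  exact: elem_GJac.
- exact: GJac_comp.
- exact: GJac_inv.
Qed.

Lemma elem_H j m (c : k) : m j = 0%N -> m != 0%MM -> H (amap d (elem j m c)).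
Proof.
move=> mj m_neq0; have [lt_m|ge_m] := ltnP (mdeg m) d.
  apply: gen_subgroup_mem; right; exists (eroot j m); split.
    exact: eroot_outer.
  by apply/(root_subgroup_elem char_k d_gt1) => //; exists c.
have -> : amap d (elem j m c) = \1%VF; last exact: gen_subgroup_one.
rewrite -amap_id; apply: amap_congr => [||i].
- exact: elem_centered.
- exact: centered_id.
rewrite !ffunE addrAC subrr add0r mpowZ //; case: eqP => _; last exact: rpred0.
exact: mpow_leq ge_m (mpowX _ _).
Qed.

Lemma linf_elem i j (c : k) : linf (1%:M + c *: delta_mx j i) = elem j U_(i)%MM c.
Proof.
apply/ffunP => l; rewrite !ffunE.
under eq_bigr do rewrite !mxE scalerDl ffunE.
rewrite big_split /= (bigD1 l) //= eqxx scale1r big1 => [|h ne_hl]; last first.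
  by rewrite eq_sym (negPf ne_hl) scale0r.
rewrite addr0; congr (_ + _); rewrite (bigD1 i) //= eqxx andbT big1 => [|h ne_hi].
  by rewrite addr0; case: eqP => _; rewrite ?mulr1 // mulr0 scale0r scaler0.
by rewrite (negPf ne_hi) andbF mulr0 scale0r.
Qed.

Lemma linf_H L : L \in unitmx -> H (amap d (linf L)).
Proof.
apply: (GL_generated (S := fun L => H (amap d (linf L)))).
- by move=> t t_neq0; apply: gen_subgroup_mem; left; apply: linf_torus.
- move=> j i c ne_ji; rewrite linf_elem; apply: elem_H.
    by rewrite mnm1E eq_sym (negPf ne_ji).
  by rewrite mnm1_eq0.
by move=> M N hM hN; rewrite -linf_comp; apply: gen_subgroup_mul.
Qed.

End GeneratedGroup.

(** * Homogeneous divergence-free fields are sums of shears *)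

Section CoefficientExtraction.
Variables (k : fieldType) (W : lmodType k) (Pr : W -> Prop).
Hypothesis char_k : [pchar k] =i pred0.
Hypotheses (Pr0 : Pr 0) (PrD : forall u v, Pr u -> Pr v -> Pr (u + v))
  (PrZ : forall c u, Pr u -> Pr (c *: u)).

(** Inverting a Vandermonde matrix at the nodes 0, 1, ..., r - 1. *)
Lemma curve_coefficients r (V : nat -> W) :
    (forall t, Pr (\sum_(l < r) t ^+ l *: V l)) ->
  forall l, (l < r)%N -> Pr (V l).
Proof.
move=> hV l lt_l; pose a : 'rV[k]_r := \row_j (j : nat)%:R.
have uM : Vandermonde r a \in unitmx.
  rewrite unitmxE det_Vandermonde unitfE; apply/prodf_neq0 => i _.
  apply/prodf_neq0 => j lt_ij; rewrite !mxE subr_eq0.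
  apply: contraTneq lt_ij => /(natr_inj char_k) ->; by rewrite ltnn.
pose c : 'cV[k]_r := invmx (Vandermonde r a) *m delta_mx (Ordinal lt_l) 0.
have cE (i : 'I_r) : \sum_j a 0 j ^+ i * c j 0 = (i == Ordinal lt_l)%:R.
  have <- : (Vandermonde r a *m c) i 0 = (i == Ordinal lt_l)%:R.
    by rewrite mulKVmx // mxE eqxx andbT.
  by rewrite [RHS]mxE; apply: eq_bigr => j _; rewrite [X in _ = X * _]mxE.
have -> : V l = \sum_j c j 0 *: \sum_(i < r) a 0 j ^+ i *: V i.
  under eq_bigr do rewrite scaler_sumr.
  rewrite exchange_big /= (bigD1 (Ordinal lt_l)) //= [X in _ + X]big1 => [|i ne_i].
    rewrite addr0; under eq_bigr do rewrite scalerA mulrC.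
    by rewrite -scaler_suml (cE (Ordinal lt_l)) eqxx scale1r.
  under eq_bigr do rewrite scalerA mulrC.
  by rewrite -scaler_suml cE (negPf ne_i) scale0r.
by apply: big_ind => // j _; apply: PrZ.
Qed.

End CoefficientExtraction.

Section Shears.
Variables (k : fieldType) (n : nat).
Hypothesis char_k : [pchar k] =i pred0.
Local Notation P := {mpoly k[n]}.
Local Notation vf := {ffun 'I_n -> P}.
Implicit Types (p : P) (F G : vf) (m q : 'X_{1..n}) (i j : 'I_n).

Definition div F : P := \sum_i (F i)^`M(i).

Lemma divP c F G : div (c *: F + G) = c *: div F + div G.
Proof.
rewrite /div scaler_sumr -big_split; apply: eq_bigr => i _ /=.
by rewrite !ffunE linearP.
Qed.

Lemma div_sumZ (I : Type) (r : seq I) (c : I -> k) (F : I -> vf) :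
  div (\sum_(u <- r) c u *: F u) = \sum_(u <- r) c u *: div (F u).
Proof.
elim: r => [|u r IHr]; last by rewrite !big_cons divP IHr.
by rewrite !big_nil /div big1 // => i _; rewrite ffunE mderiv0.
Qed.

Lemma div_mvf j p : div (mvf j p) = p^`M(j).
Proof.
rewrite /div (bigD1 j) //= ffunE eqxx big1 ?addr0 // => i ne_ij.
by rewrite ffunE (negPf ne_ij) mderiv0.
Qed.

Lemma mvfP j c p p' : mvf j (c *: p + p') = c *: mvf j p + mvf j p'.
Proof.
apply/ffunP => i; rewrite !ffunE; case: eqP => _ //; by rewrite scaler0 addr0.
Qed.

Lemma mvf0 j : mvf j 0 = 0 :> vf.
Proof. by apply/ffunP => i; rewrite !ffunE if_same. Qed.

Lemma mvfZ j c p : mvf j (c *: p) = c *: mvf j p.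
Proof. by have := mvfP j c p 0; rewrite mvf0 !addr0. Qed.

Lemma mvf_sum j (I : Type) (r : seq I) (p : I -> P) :
  mvf j (\sum_(u <- r) p u) = \sum_(u <- r) mvf j (p u).
Proof.
elim: r => [|u r IHr]; first by rewrite !big_nil mvf0.
by rewrite !big_cons -IHr -[p u]scale1r mvfP !scale1r.
Qed.

(** When x^q does not involve x_j, this is the conjugate of x^q d/dx_j under
    the linear substitution x_i |-> x_i + t x_j. *)
Definition shear i j t q : vf :=
  let r := msub (elem i U_(j)%MM t) 'X_[q] in mvf j r - t *: mvf i r.

Lemma msub_transvection i j (t : k) q : i != j -> q j = 0%N ->
  msub (elem i U_(j)%MM t) 'X_[q] =
  \sum_(l < (q i).+1) t ^+ l *: ('C(q i, l)%:R *: 'X_[shift i U_(j)%MM l q]).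
Proof.
move=> ne_ij qj; have {1}-> : q = (U_(i) *+ q i + (q - U_(i) *+ q i))%MM.
  apply/mnmP => l; rewrite mnmDE mnmBE mulmnE mnm1E; case: eqP => [<-|_].
    by rewrite mul1n subnn addn0.
  by rewrite mul0n subn0.
rewrite mpolyXD rmorphM -mpolyXn rmorphXn /= msubX !ffunE eqxx msub_elem_fix //; last first.
  by rewrite mnmBE mulmnE mnm1E eqxx mul1n subnn.
rewrite exprDn mulr_suml; apply: eq_bigr => l _.
rewrite exprZn -scalerAr -scaler_nat -!scalerAl [LHS]scalerA [RHS]scalerA mulrC.
congr (_ *: _); rewrite !mpolyXn -!mpolyXD; congr 'X_[_]; apply/mnmP => h.
have le_l : (l <= q i)%N by rewrite -ltnS.
rewrite !(mnmDE, mnmBE, mulmnE) !mnm1E; case: (eqVneq i h) => [<-|_].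
  by rewrite !mul1n subnn addn0 [j == i]eq_sym (negPf ne_ij) mul0n !addn0.
by rewrite !mul0n !subn0 add0n addnC.
Qed.

(** The field x^m d/dx_j, corrected by a multiple of d/dx_i so as to have
    divergence zero. *)
Definition balanced i j m : vf :=
  mvf j 'X_[m] - (m i).+1%:R^-1 *: mvf i ('X_i * ('X_[m])^`M(j)).

Lemma div_balanced i j m : i != j -> div (balanced i j m) = 0.
Proof.
move=> ne_ij; rewrite /balanced addrC -scaleNr divP !div_mvf !mderivX.
rewrite -scalerAr mderivZ -mpolyXD mderivX mnmDE mnmBE !mnm1E eqxx.
rewrite [j == i]eq_sym (negPf ne_ij) subn0 add1n.
rewrite (_ : (U_(i) + (m - U_(j)) - U_(i))%MM = (m - U_(j))%MM); last first.
  by apply/mnmP => h; rewrite !(mnmBE, mnmDE) addKn.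
rewrite !scalerA -scalerDl; have h := natr_neq0 char_k (m i).
by rewrite (_ : _ + _ = 0) ?scale0r // mulrAC [- _ * _]mulNr mulVf // mulN1r addNr.
Qed.

Section Span.
Variables (e : nat) (Pr : vf -> Prop).
Hypotheses (Pr0 : Pr 0) (PrD : forall u v, Pr u -> Pr v -> Pr (u + v))
  (PrZ : forall c u, Pr u -> Pr (c *: u)).
Hypothesis Pr_shear : forall i j t q, i != j -> q j = 0%N -> mdeg q = e ->
  Pr (shear i j t q).

(** The balanced fields are, up to scalars, the coefficients of shears
    regarded as polynomials in t. *)
Lemma Pr_balanced i j m : i != j -> mdeg m = e -> Pr (balanced i j m).
Proof.
move=> ne_ij deg_m; pose q := shift j U_(i)%MM (m j) m.
have qj : q j = 0%N.
  by rewrite mnmDE mnmBE !mulmnE !mnm1E eqxx mul1n subnn (negPf ne_ij) mul0n.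
have qi : q i = (m i + m j)%N.
  by rewrite mnmDE mnmBE !mulmnE !mnm1E eqxx [j == i]eq_sym (negPf ne_ij) mul0n subn0 mul1n.
have le_mj : (U_(j) *+ m j <= m)%MM.
  apply/mnm_lepP => h; rewrite mulmnE mnm1E; case: eqP => [->|_]; by rewrite ?mul1n.
have deg_q : mdeg q = e.
  have := congr1 (@mdeg n) (submK le_mj); rewrite /q /shift !mdegD !mdegMn !mdeg1.
  by rewrite deg_m.
pose s (l : nat) : 'X_{1..n} := shift i U_(j)%MM l q.
(* V l is the coefficient of t^l in the shear, and V (m j) is proportional to
   the balanced field. *)
pose V (l : nat) : vf := 'C(q i, l)%:R *: mvf j 'X_[s l] -
   (if l is l'.+1 then 'C(q i, l')%:R *: mvf i 'X_[s l'] else 0).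
have hV t : Pr (\sum_(l < (q i).+2) t ^+ l *: V l).
  have -> : \sum_(l < (q i).+2) t ^+ l *: V l = shear i j t q; last exact: Pr_shear.
  rewrite /V; under eq_bigr do rewrite scalerBr.
  rewrite sumrB big_ord_recr /= bin_small // scale0r scaler0 addr0.
  rewrite [X in _ - X]big_ord_recl scaler0 add0r /shear msub_transvection //.
  rewrite !mvf_sum scaler_sumr; congr (_ - _); apply: eq_bigr => l _.
    by rewrite !mvfZ.
  by rewrite !mvfZ !scalerA lift0 exprS mulrA.
have := curve_coefficients char_k Pr0 PrD PrZ hV (l := m j).
rewrite qi ltnS ltnW ?ltnS ?leq_addl // => /(_ isT) hVm.
have C_neq0 : 'C(q i, m j)%:R != 0 :> k.
  by rewrite ((pcharf0P k).1 char_k) -lt0n bin_gt0 qi leq_addl.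
have -> : balanced i j m = ('C(q i, m j)%:R)^-1 *: V (m j); last exact: PrZ.
have sm : s (m j) = m.
  apply/mnmP => h; rewrite /s /q /shift !(mnmDE, mnmBE, mulmnE) !mnm1E.
  case: (eqVneq i h) => [<-|ne_ih].
    by rewrite [j == i]eq_sym (negPf ne_ij) !mul0n subn0 !mul1n addnK addn0.
  case: (eqVneq j h) => [<-|_]; last by rewrite !mul0n !subn0 !addn0.
  by rewrite !mul1n subnn !mul0n.
rewrite /balanced /V scalerBr scalerA mulVf // scale1r sm; congr (_ - _).
rewrite mderivX; case emj: (m j) => [|l]; first by rewrite scale0r mulr0 mvf0 !scaler0.
rewrite -scalerAr mvfZ !scalerA -mpolyXD; congr (_ *: mvf i 'X_[_]).
  have bE : ('C(q i, l.+1) * l.+1 = 'C(q i, l) * (m i).+1)%N.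
    by rewrite mulnC mul_bin_left mulnC qi emj addnS -addSn addnK.
  have h1 : (m i).+1%:R != 0 :> k by apply: natr_neq0.
  have h2 : 'C(q i, l.+1)%:R != 0 :> k by rewrite -emj.
  have := congr1 (fun e => e%:R : k) bE; rewrite !natrM => bk.
  apply: (mulfI h1); rewrite mulrA mulfV // mul1r; apply: (mulfI h2).
  by rewrite bk [RHS]mulrCA mulVKf // mulrC.
apply/mnmP => h; rewrite /s /q /shift !(mnmDE, mnmBE, mulmnE) !mnm1E.
case: (eqVneq i h) => [<-|ne_ih].
  rewrite [j == i]eq_sym (negPf ne_ij) !mul0n !subn0 !mul1n addn0 emj.
  by rewrite addnC addnS -addSn addnK addn1.
case: (eqVneq j h) => [<-|_]; last by rewrite !mul0n !subn0 !addn0 add0n.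
by rewrite !mul1n emj subnn !mul0n add0n subn0 subSS subn0.
Qed.

(** Subtracting balanced fields leaves a single component along d/dx_i0, whose
    coefficient does not involve x_i0 because its divergence is zero; each of
    its monomials is a shear with t = 0. The second index i1 is where n > 1
    is needed. *)
Lemma divfree_span F : (1 < n)%N ->
    (forall i m, mdeg m != e -> (F i)@_m = 0) -> div F = 0 ->
  Pr F.
Proof.
move=> n_gt1 homF divF; have n_gt0 := ltnW n_gt1.
pose i0 := Ordinal n_gt0; pose i1 := Ordinal n_gt1.
have PrN u : Pr u -> Pr (- u) by rewrite -scaleN1r; apply: PrZ.
pose B := \sum_(j | j != i0) \sum_(m <- msupp (F j)) (F j)@_m *: balanced i0 j m.
have deg_supp j m : m \in msupp (F j) -> mdeg m = e.
  by rewrite mcoeff_msupp => /eqP nz; apply/eqP; apply: contraT => /homF/nz.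
have PrB : Pr B.
  apply: big_ind => // j ne_j; rewrite big_seq; apply: big_ind => // m mj.
  by apply/PrZ/Pr_balanced; [rewrite eq_sym|apply: deg_supp mj].
have divB : div B = 0.
  have -> : B = \sum_(j <- enum 'I_n | j != i0) 1 *: \sum_(m <- msupp (F j)) (F j)@_m *: balanced i0 j m.
    by rewrite big_enum_cond /=; apply: eq_bigr => j _; rewrite scale1r.
  rewrite -big_filter div_sumZ big_filter big1 // => j ne_j.
  rewrite div_sumZ big1 ?scaler0 // => m _.
  by rewrite div_balanced ?scaler0 // eq_sym.
have balE i j m : i != i0 -> balanced i0 j m i = if i == j then 'X_[m] else 0.
  move=> ne_i; rewrite !ffunE (negPf ne_i) scaler0 subr0 //.
have B_other i : i != i0 -> B i = F i.
  move=> ne_i; rewrite /B sum_ffunE (bigD1 i) //= [X in _ + X]big1 => [|j /andP[_ ne_ji]].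
    rewrite addr0 sum_ffunE [RHS]mpolyE; apply: eq_bigr => m _.
    by rewrite ffunE balE // eqxx.
  rewrite sum_ffunE big1 // => m _; rewrite ffunE balE // eq_sym (negPf ne_ji) scaler0 //.
pose g := F i0 - B i0.
have FB : F - B = mvf i0 g.
  apply/ffunP => i; rewrite !ffunE; have [->//|ne_i] := eqVneq i i0.
  by rewrite B_other // subrr.
have dg : g^`M(i0) = 0.
  by rewrite -div_mvf -FB addrC -scaleN1r divP divB divF scaler0 addr0.
have hom_g m : mdeg m != e -> g@_m = 0.
  move=> deg_m; rewrite mcoeffB homF // sub0r sum_ffunE raddf_sum big1 ?oppr0 //= => j ne_j.
  rewrite sum_ffunE raddf_sum big_seq big1 //= => q qj.
  rewrite ffunE mcoeffZ !ffunE eq_sym (negPf ne_j) sub0r eqxx mderivX mcoeffN mcoeffZ.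
  rewrite -scalerAr mcoeffZ -mpolyXD mcoeffX; case: eqP => [eqm|_]; last by rewrite !(mulr0, oppr0).
  case: (posnP (q j)) => [->|qj_gt0]; first by rewrite mul0r !(mulr0, oppr0).
  case/eqP: deg_m; rewrite -eqm mdegD mdeg1 -(deg_supp _ _ qj).
  have le_q : (U_(j) <= q)%MM by rewrite lep1mP -lt0n.
  by have := congr1 (@mdeg n) (submK le_q); rewrite mdegD mdeg1 addnC => ->.
rewrite -(subrK B F) FB; apply: PrD => //; rewrite [g]mpolyE mvf_sum big_seq.
apply: big_ind => // m mg; rewrite mvfZ; apply: PrZ.
have g_m : g@_m != 0 by rewrite -mcoeff_msupp.
have deg_m : mdeg m = e by apply/eqP; apply: contraNT g_m => /hom_g ->.
have m0 : m i0 = 0%N.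
  apply/eqP; apply: contraNT g_m; rewrite -lt0n => m_gt0.
  have := congr1 (mcoeff (m - U_(i0))%MM) dg.
  rewrite mcoeff_deriv mcoeff0 submK ?lep1mP -?lt0n // -mulr_natr => /eqP.
  by rewrite mulf_eq0 (negPf (natr_neq0 char_k _)) orbF.
have ne10 : i1 != i0 by [].
have := Pr_shear 0 ne10 m0 deg_m.
by rewrite /shear elem0 msub_idvf scale0r subr0.
Qed.

End Span.

End Shears.

(** * Every automorphism with constant Jacobian is generated *)

Section ConstantJacobianGenerated.
Variables (k : fieldType) (n d : nat).
Hypothesis char_k : [pchar k] =i pred0.
Hypothesis d_gt1 : (1 < d)%N.
Hypothesis n_gt1 : (1 < n)%N.
Local Notation A := (jet k n d).
Local Notation P := {mpoly k[n]}.
Local Notation vf := {ffun 'I_n -> P}.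
Local Notation x i := (@jpi k n d 'X_i).
Local Notation H := (@subgroupH k n d).
Implicit Types (F G U W : vf) (phi D : 'End(A)) (m q : 'X_{1..n}) (p : P).

Definition near_id e F := forall i, F i - 'X_i \in mpow k n e.

Lemma near_id_centered e F : (0 < e)%N -> near_id e F -> centered F.
Proof.
move=> e_gt0 hF i; rewrite -(subrK 'X_i (F i)) rpredD //.
  exact: mpow_leq (hF i).
by rewrite -(mdeg1 i) mpowX.
Qed.

Lemma unipotentP F : centered F -> linmx F = 1%:M -> near_id 2 F.
Proof.
move=> hF lF i; apply/mpow_coeffP => m; rewrite ltnS leq_eqVlt => /orP[].
  case/mdeg1P=> j /eqP ->; rewrite mcoeffB mcoeffXU.
  have := congr1 (fun M : 'M_n => M i j) lF; rewrite !mxE => ->.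
  by rewrite eq_sym subrr.
rewrite ltnS leqn0 mdeg_eq0 => /eqP ->; have := hF i; rewrite mpow1E => /eqP F0.
by rewrite mcoeffB F0 mcoeffX mnm1_eq0 subrr.
Qed.

Lemma elemE j m (c : k) i :
  elem j m c i = 'X_i + (if i == j then c *: 'X_[m] else 0).
Proof. by rewrite !ffunE; case: eqP => _; rewrite ?scaler0. Qed.

(** Conjugating a root element by a transvection gives a shear. *)
Lemma vcomp_shear i j (t c : k) q : i != j -> q j = 0%N ->
  vcomp (vcomp (elem i U_(j)%MM t) (elem j q c)) (elem i U_(j)%MM (- t)) =
  idvf k n + c *: shear i j t q.
Proof.
move=> ne_ij qj; set tau := elem i U_(j)%MM t.
set Q := msub tau 'X_[q].
have tauE l : vcomp tau (elem j q c) l = tau l + (if l == j then c *: Q else 0).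
  rewrite ffunE elemE raddfD /= msubX; congr (_ + _).
  by case: eqP => _; [rewrite linearZ|rewrite raddf0].
have RE l : (idvf k n + c *: shear i j t q) l =
    'X_l + c *: ((if l == j then Q else 0) - t *: (if l == i then Q else 0)).
  by rewrite !ffunE.
apply/ffunP => l; rewrite ffunE elemE raddfD /= msubX tauE RE {1}/tau elemE.
have [->|ne_li] := eqVneq l i; last first.
  by rewrite raddf0 scaler0 subr0 !addr0; case: eqP; rewrite ?scaler0.
rewrite (negPf ne_ij) linearZ /= msubX tauE eqxx {1}/tau elemE.
rewrite [j == i]eq_sym (negPf ne_ij) !addr0 sub0r scaleNr scalerDr opprD addrA addrK.
by rewrite scalerN !scalerA mulrC.
Qed.

(** F occurs as the leading term, of degree e, of an element of H. *)
Definition leading e F := (forall i, F i \in mpow k n e) /\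
  exists2 W, H (amap d W) & forall i, W i - 'X_i - F i \in mpow k n e.+1.

(** By [vcomp_shear], no terms of higher degree even appear. *)
Lemma leading_shear e i j (t c : k) q : i != j -> q j = 0%N -> mdeg q = e ->
  (0 < e)%N -> leading e (c *: shear i j t q).
Proof.
move=> ne_ij qj deg_q e_gt0; have q_neq0 : q != 0%MM by rewrite -mdeg_eq0 deg_q -lt0n.
have Uj : (U_(j) : 'X_{1..n})%MM i = 0%N by rewrite mnm1E eq_sym (negPf ne_ij).
have Uj0 : (U_(j) : 'X_{1..n})%MM != 0%MM by rewrite mnm1_eq0.
have c1 b : centered (elem i U_(j)%MM b) by apply: elem_centered.
have c2 : centered (elem j q c) by apply: elem_centered.
split=> [l|].
  rewrite !ffunE; apply/mpowZ/rpredB; [|apply: mpowZ]; case: eqP => _;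
    rewrite ?rpred0 //; apply: msub_mpow;
    by [exact: c1|rewrite -deg_q mpowX].
exists (idvf k n + c *: shear i j t q) => [|l]; last first.
  rewrite [(idvf k n + _) l]ffunE [idvf k n l]ffunE [X in X - _ \in _]addrAC.
  by rewrite subrr add0r subrr rpred0.
rewrite -vcomp_shear // -!amap_comp //; last exact: centered_vcomp.
by apply: gen_subgroup_mul; [apply: gen_subgroup_mul|]; apply: elem_H.
Qed.

Lemma leading0 e : leading e 0.
Proof.
split=> [i|]; first by rewrite ffunE rpred0.
exists (idvf k n) => [|i]; first by rewrite amap_id; apply: gen_subgroup_one.
by rewrite !ffunE subr0 subrr rpred0.
Qed.

Lemma leading_near_id e F W : (1 < e)%N -> (forall i, F i \in mpow k n e) ->
  (forall i, W i - 'X_i - F i \in mpow k n e.+1) -> near_id 2 W.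
Proof.
move=> e_gt1 hF hW i; rewrite -(subrK (F i) (W i - 'X_i)) rpredD //.
  by apply: mpow_leq (hW i); rewrite ltnS ltnW.
exact: mpow_leq (hF i).
Qed.

(** Composition adds leading terms: an element tangent to the identity changes
    G only in degrees above e. *)
Lemma leadingD e F G : (1 < e)%N -> leading e F -> leading e G -> leading e (F + G).
Proof.
move=> e_gt1 [hF [W HW hW]] [hG [W' HW' hW']]; split=> [i|].
  by rewrite ffunE rpredD.
have W2 := leading_near_id e_gt1 hF hW; have W2' := leading_near_id e_gt1 hG hW'.
have cW := near_id_centered (isT : (0 < 2)%N) W2.
have cW' := near_id_centered (isT : (0 < 2)%N) W2'.
exists (vcomp W W') => [|i].
  by rewrite -amap_comp //; apply: gen_subgroup_mul.
rewrite !ffunE.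
have -> : msub W (W' i) - 'X_i - (F i + G i) = (W i - 'X_i - F i) +
   (msub W (G i) - G i + msub W (W' i - 'X_i - G i)).
  by rewrite !raddfB /= msubX; ring.
apply: rpredD; [exact: hW|apply: rpredD].
  exact: msub_unip W2 (hG i).
exact: msub_mpow cW (hW' i).
Qed.

Definition hpart e p : P := \sum_(m <- msupp p | mdeg m == e) p@_m *: 'X_[m].

Lemma mcoeff_hpart e p m : (hpart e p)@_m = if mdeg m == e then p@_m else 0.
Proof.
rewrite /hpart raddf_sum /=.
under eq_bigr do rewrite mcoeffZ mcoeffX.
have [m_p|m_p] := boolP (m \in msupp p); last first.
  rewrite (memN_msupp_eq0 m_p) if_same big1_seq // => q /andP[_ qp].
  by case: eqP => [eqm|_]; [rewrite -eqm qp in m_p|rewrite mulr0].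
rewrite -big_filter; case: ifP => [deg_m|deg_m].
  rewrite (bigD1_seq m) ?filter_uniq ?msupp_uniq ?mem_filter ?deg_m //= eqxx mulr1.
  by rewrite big1 ?addr0 // => q /negPf ->; rewrite mulr0.
rewrite big1_seq // => q; rewrite mem_filter => /andP[_ /andP[deg_q _]].
by case: eqP => [eqm|_]; [rewrite -eqm deg_q in deg_m|rewrite mulr0].
Qed.

Lemma hpart_diff e p : p \in mpow k n e -> p - hpart e p \in mpow k n e.+1.
Proof.
move=> hp; apply/mpow_coeffP => m; rewrite ltnS mcoeffB mcoeff_hpart leq_eqVlt.
case: eqP => [_|_ /= lt_m]; first by rewrite subrr.
by rewrite (mpow_coeff0 hp lt_m) subr0.
Qed.

(** By descending induction on the order of contact e with the identity: the
    leading term of degree e has divergence zero, because the Jacobian is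
    constant, hence it can be cancelled by an element of H. *)
Lemma near_id_H r e U : (d <= e + r)%N -> (1 < e)%N ->
  near_id e U -> GJac (amap d U) -> H (amap d U).
Proof.
elim: r e U => [|r IHr] e U le_d e_gt1 hU hJ.
  have -> : amap d U = \1%VF; last exact: gen_subgroup_one.
  rewrite -amap_id; apply: amap_congr; [|exact: centered_id|].
    by apply: (near_id_centered _ hU); apply: ltnW.
  by move=> i; rewrite ffunE; apply: mpow_leq (hU i); rewrite addn0 in le_d.
have e_gt0 := ltnW e_gt1; have cU := near_id_centered e_gt0 hU.
have U2 : near_id 2 U by move=> i; apply: mpow_leq (hU i).
have [le_de|lt_ed] := leqP d e; first by apply: (IHr e) => //; rewrite (leq_trans le_de) ?leq_addr.
pose F : vf := [ffun i => - hpart e (U i - 'X_i)].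
have hF i : F i \in mpow k n e.
  apply/mpow_coeffP => m lt_m; rewrite ffunE mcoeffN mcoeff_hpart.
  by rewrite (ltn_eqF lt_m) oppr0.
have divF : div F = 0.
  apply/mpolyP => m; rewrite mcoeff0 raddf_sum /=.
  have [deg_m|deg_m] := eqVneq (mdeg m).+1 e; last first.
    rewrite big1 // => i _; rewrite mcoeff_deriv ffunE mcoeffN mcoeff_hpart.
    by rewrite mdegD mdeg1 addn1 (negPf deg_m) oppr0 mul0rn.
  have [_ [c _ hc]] := (GJac_amap d cU).1 hJ.
  have hp : jac U - jac (idvf k n) - \sum_i (U i - idvf k n i)^`M(i) \in mpow k n e.
    have -> : e = e.-1.+1 by rewrite prednK.
    apply: jac_perturb => [|i|i]; first by rewrite -ltnS prednK.
      by rewrite ffunE subrr rpred0.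
    by rewrite ffunE prednK.
  have lt_m : (mdeg m < e)%N by rewrite -deg_m.
  have lt_md : (mdeg m < d.-1)%N by rewrite -ltnS deg_m prednK // ltnW.
  have m_neq0 : m != 0%MM.
    by apply: contraTneq e_gt1 => m0; rewrite -deg_m m0 mdeg0.
  have := mpow_coeff0 hp lt_m; have := mpow_coeff0 hc lt_md.
  rewrite !mcoeffB mcoeffC jac_idvf mcoeff1 (negPf m_neq0) mulr0 !subr0 => ->.
  rewrite sub0r => /eqP; rewrite oppr_eq0 raddf_sum /= => /eqP h.
  rewrite -[RHS]oppr0 -[in RHS]h -sumrN; apply: eq_bigr => i _.
  rewrite !mcoeff_deriv !ffunE mcoeffN mcoeff_hpart mdegD mdeg1 addn1 deg_m eqxx.
  by rewrite mulNrn.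
have [_ [W HW hW]] : leading e F.
  rewrite -[F]scale1r; move: (1 : k).
  apply: (divfree_span char_k (e := e) (Pr := fun F => forall c, leading e (c *: F))) => //.
  - by move=> c; rewrite scaler0; apply: leading0.
  - by move=> u v hu hv c; rewrite scalerDr; apply: leadingD.
  - by move=> b u hu c; rewrite scalerA.
  - by move=> i j t q ne_ij qj deg_q c; apply: leading_shear.
  by move=> i m deg_m; rewrite ffunE mcoeffN mcoeff_hpart (negPf deg_m) oppr0.
have W2 := leading_near_id e_gt1 hF hW.
have cW := near_id_centered (isT : (0 < 2)%N) W2.
have JW := H_GJac char_k d_gt1 HW.
have HUW : H (amap d U \o amap d W)%VF.
  have JUW := GJac_comp d_gt1 hJ JW; move: JUW; rewrite amap_comp // => JUW.
  apply: (IHr e.+1) => //; first by rewrite addSnnS.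
  move=> i; rewrite ffunE.
  have -> : msub U (W i) - 'X_i = (U i - 'X_i - hpart e (U i - 'X_i)) +
      (msub U (F i) - F i + msub U (W i - 'X_i - F i)).
    have -> : hpart e (U i - 'X_i) = - F i by rewrite ffunE opprK.
    by rewrite !(raddfB (msub U)) /= msubX; ring.
  apply: rpredD; [exact: hpart_diff|apply: rpredD].
    exact: msub_unip U2 (hF i).
  exact: msub_mpow cU (hW i).
have -> : amap d U = ((amap d U \o amap d W) \o (amap d W)^-1)%VF.
  by rewrite -comp_lfunA lker0_compfV ?comp_lfun1r //; apply: aut_lker JW.1.
by apply: gen_subgroup_mul => //; apply: gen_subgroup_inv.
Qed.

Lemma linear_unipotent F : centered F -> linmx F \in unitmx ->
  exists U, [/\ near_id 2 U, F = vlin (linmx F) U & U = vlin (invmx (linmx F)) F].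
Proof.
move=> cF uL; exists (vlin (invmx (linmx F)) F).
have h : F = vlin (linmx F) (vlin (invmx (linmx F)) F).
  by rewrite vlin_comp mulmxV // vlin1.
split=> //; apply: unipotentP; first exact: centered_vlin.
by rewrite linmx_vlin mulVmx.
Qed.

Lemma aut_linmx phi : is_aut phi -> linmx (vf_of phi) \in unitmx.
Proof. by move=> h; rewrite unitmxE unitfE -jac_const; apply: aut_jac_const. Qed.

Theorem GJac_H phi : GJac phi -> H phi.
Proof.
move=> hJ; have haut := hJ.1; have cF := aut_centered d_gt1 haut.
have uL := aut_linmx haut; set L := linmx _ in uL.
have [U [U2 FE UE]] := linear_unipotent cF uL; rewrite -/L in FE UE.
have cU := near_id_centered (isT : (0 < 2)%N) U2.
have phiE : phi = (amap d U \o amap d (linf L))%VF.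
  rewrite amap_comp //; last exact: linf_centered.
  by rewrite vcomp_vlin -FE; apply: aut_amap.
rewrite phiE; apply: gen_subgroup_mul; last exact: linf_H.
apply: (near_id_H (r := d) (e := 2)) => //; first exact: leq_addl.
have -> : amap d U = (phi \o amap d (linf (invmx L)))%VF.
  rewrite {1}(aut_amap d_gt1 haut) amap_comp //; last exact: linf_centered.
  by rewrite vcomp_vlin -UE.
by apply: GJac_comp => //; apply: linf_GJac; rewrite unitmx_inv.
Qed.

End ConstantJacobianGenerated.

(** * The Lie algebra of H *)

Section LieAlgebra.
Variables (k : fieldType) (n d : nat).
Hypothesis char_k : [pchar k] =i pred0.
Hypothesis d_gt1 : (1 < d)%N.
Hypothesis n_gt1 : (1 < n)%N.
Local Notation A := (jet k n d).
Local Notation P := {mpoly k[n]}.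
Local Notation vf := {ffun 'I_n -> P}.
Local Notation Zn := {ffun 'I_n -> int}.
Local Notation x i := (@jpi k n d 'X_i).
Local Notation dmon j m := (@dmap k n d (mvf j 'X_[m])).
Local Notation H := (@subgroupH k n d).
Implicit Types (F G U W : vf) (phi psi D : 'End(A)) (m q : 'X_{1..n}) (p : P) (alpha : Zn).

Lemma lfun_monP phi psi :
  (forall m, phi (jpi d 'X_[m]) = psi (jpi d 'X_[m])) -> phi = psi.
Proof.
move=> h; apply: lfun_jetP; elim/mpolyind => [|c m p _ _ IHp].
  by rewrite !raddf0.
by rewrite !linearP /= h IHp.
Qed.

Lemma iter_scale D c l v : iter l (c *: D) v = c ^+ l *: iter l D v.
Proof.
elim: l => [|l IHl]; first by rewrite expr0 scale1r.
by rewrite !iterS IHl scale_lfunE linearZ scalerA -exprS.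
Qed.

(** Differentiating the conjugates of a root subgroup at the identity. *)
Lemma Lie_conj g g' j m : m j = 0%N -> m != 0%MM -> H g -> H g' ->
  (g \o g')%VF = \1%VF -> Lie H (g \o (dmon j m \o g'))%VF.
Proof.
move=> mj m_neq0 Hg Hg' gg'; set D := dmon j m.
pose E l : 'End(A) := l`!%:R^-1 *: iter l (comp_lfun D) \1%VF.
have EE l v : E l v = l`!%:R^-1 *: iter l D v.
  rewrite scale_lfunE; congr (_ *: _); elim: l => [|l IHl]; first by rewrite id_lfunE.
  by rewrite !iterS comp_lfunE IHl.
pose w l : 'End(A) := (g \o (E l \o g'))%VF.
have E1 : E 1%N = D.
  by apply/lfunP => v; rewrite EE /= invr1 scale1r.
have E0 : E 0%N = \1%VF by apply/lfunP => v; rewrite EE /= invr1 scale1r id_lfunE.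
have w0 : w 0%N = \1%VF by rewrite /w E0 comp_lfun1l.
have -> : (g \o (D \o g'))%VF = w 1%N by rewrite /w E1.
rewrite /Lie -w0; apply: (tangent_curve char_k (q := 1) (r := d)) => //.
  exact: oner_neq0.
move=> c _.
have -> : \sum_(l < d) c ^+ l *: w l = (g \o (amap d (elem j m c) \o g'))%VF.
  apply/lfunP => v; rewrite !comp_lfunE sum_lfunE.
  rewrite (exp_elem char_k d_gt1 mj m_neq0 (r := d)); last first.
    by move=> u; apply: dmap_nilpotent.
  rewrite linear_sum; apply: eq_bigr => l _ /=.
  by rewrite scale_lfunE !comp_lfunE EE -linearZ iter_scale !scalerA mulrC.
by apply: gen_subgroup_mul => //; apply: gen_subgroup_mul => //; apply: elem_H.
Qed.

Lemma der_conj g g' D : is_endo g -> is_endo g' -> (g \o g')%VF = \1%VF ->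
  is_der D -> is_der (g \o (D \o g'))%VF.
Proof.
move=> [_ gM] [_ gM'] /lfunP gg' hD a b; rewrite !comp_lfunE gM' hD raddfD /= !gM.
by have := gg' a; have := gg' b; rewrite !comp_lfunE !id_lfunE => -> ->.
Qed.

Lemma shear_centered i j (t : k) q : i != j -> q != 0%MM -> centered (shear i j t q).
Proof.
move=> ne_ij q_neq0 l; rewrite !ffunE.
have h : msub (elem i U_(j)%MM t) 'X_[q] \in mpow k n 1.
  by apply: msub_mpow; [apply: elem_centered; rewrite mnm1_eq0|apply: mpowX1].
by apply/rpredB; [|apply: mpowZ]; case: eqP => _; rewrite ?rpred0.
Qed.

(** The shear field is the conjugate of the root derivation x^q d/dx_j by the
    transvection x_i |-> x_i + t x_j. *)
Lemma Lie_shear i j t q : i != j -> q j = 0%N -> q != 0%MM ->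
  Lie H (dmap d (shear i j t q)).
Proof.
move=> ne_ij qj q_neq0.
have Uj : (U_(j) : 'X_{1..n})%MM i = 0%N by rewrite mnm1E eq_sym (negPf ne_ij).
have Uj0 : (U_(j) : 'X_{1..n})%MM != 0%MM by rewrite mnm1_eq0.
have cent (b : k) : centered (elem i U_(j)%MM b) by apply: elem_centered.
pose g b : 'End(A) := amap d (elem i U_(j)%MM b).
have gg : (g t \o g (- t))%VF = \1%VF.
  by rewrite /g amap_comp // vcomp_elem // subrr elem0 amap_id.
have Hg b : H (g b) by apply: elem_H.
have -> : dmap d (shear i j t q) = (g t \o (dmon j q \o g (- t)))%VF; last first.
  exact: Lie_conj.
have cq := mvf_centered j (mpowX1 k q_neq0).
have csh := shear_centered t ne_ij q_neq0.
apply: der_ext; first exact: dmap_der.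
  by apply: der_conj => //; [exact: amap_endo|exact: amap_endo|exact: dmap_der].
move=> l; rewrite (dmapX d_gt1 l csh) !comp_lfunE.
rewrite /g (amapE d (cent (- t))) msubX elemE.
have DX h : dmon j q (x h) = if h == j then jpi d 'X_[q] else 0.
  by rewrite (dmapX d_gt1 h cq) ffunE; case: eqP => // _; rewrite raddf0.
have DX' : dmon j q (jpi d ('X_l + (if l == i then - t *: 'X_j else 0))) =
    (if l == j then jpi d 'X_[q] else 0) - t *: (if l == i then jpi d 'X_[q] else 0).
  rewrite !raddfD /= DX; congr (_ + _); case: eqP => _.
    by rewrite !linearZ /= DX eqxx scaleNr ?scalerN.
  by rewrite !raddf0.
rewrite DX' raddfB /= linearZ /= !ffunE raddfB /= linearZ /=.
by congr (_ - t *: _); case: eqP => _; rewrite ?raddf0 // (amapE d (cent t)).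
Qed.

Lemma Lie_divfree e F : (0 < e)%N ->
  (forall i m, mdeg m != e -> (F i)@_m = 0) -> div F = 0 -> Lie H (dmap d F).
Proof.
move=> e_gt0 homF divF.
apply: (divfree_span char_k (e := e) (Pr := fun F => Lie H (dmap d F))) => //.
- by rewrite dmap0; apply: tangent0.
- by move=> u v; rewrite dmapD; apply: tangentD.
- by move=> c u; rewrite dmapZ; apply: tangentZ.
move=> i j t q ne_ij qj deg_q; apply: Lie_shear => //.
by rewrite -mdeg_eq0 deg_q -lt0n.
Qed.

Definition diagop_fun (f : 'X_{1..n} -> k) (a : A) : A :=
  \sum_(m : 'X_{1..n < d}) (jrep a)@_m *: (f m *: jpi d 'X_[m]).
Fact diagop_fun_is_linear f : linear (diagop_fun f).
Proof.
move=> c a b; rewrite /diagop_fun scaler_sumr -big_split; apply: eq_bigr => m _ /=.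
by rewrite linearP /= mcoeffD mcoeffZ scalerDl -scalerA.
Qed.
HB.instance Definition _ f :=
  GRing.isLinear.Build k A A *:%R (diagop_fun f) (diagop_fun_is_linear f).
Definition diagop f : 'End(A) := linfun (diagop_fun f).

Lemma diagopE f m : diagop f (jpi d 'X_[m]) = f m *: jpi d 'X_[m].
Proof.
rewrite lfunE /= /diagop_fun; have [lt_m|ge_m] := ltnP (mdeg m) d; last first.
  have h : jpi d 'X_[m] = 0 :> A by apply/jpi_eq0; apply: mpow_leq ge_m (mpowX _ _).
  by rewrite h linear0 scaler0 big1 // => q _; rewrite mcoeff0 scale0r.
rewrite (bigD1 (BMultinom lt_m)) //= jrep_coeff // mcoeffX eqxx scale1r.
rewrite big1 ?addr0 // => q ne_q; rewrite jrep_coeff ?bmdeg // mcoeffX.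
case: eqP => [eq_q|]; last by rewrite scale0r.
by case/eqP: ne_q; apply: val_inj; rewrite /= eq_q.
Qed.

(** The derivation x_j d/dx_j is the velocity of the torus elements scaling
    x_j by 1 + c; on x^m they act by the binomial expansion of (1 + c)^(m_j). *)
Lemma Lie_torus_dmon j : Lie (@torus k n d) (dmon j U_(j)%MM).
Proof.
have Uj0 : (U_(j) : 'X_{1..n})%MM != 0%MM by rewrite mnm1_eq0.
pose w l : 'End(A) := diagop (fun m => ('C(m j, l))%:R).
have w0 : w 0%N = \1%VF.
  by apply: lfun_monP => m; rewrite diagopE bin0 scale1r id_lfunE.
have -> : dmon j U_(j)%MM = w 1%N.
  apply: lfun_monP => m; rewrite diagopE bin1 dmap_mvfX //.
  case: (posnP (m j)) => [->|mj]; first by rewrite !scale0r.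
  by rewrite submK // lep1mP -lt0n.
(* The value c = -1 is excluded: there the curve leaves the torus. *)
rewrite /Lie -w0; apply: (tangent_curve char_k (q := 'X + 1) (r := d)) => //.
  by rewrite (_ : 'X + 1 = 'X - (- 1)%:P) ?polyXsubC_eq0 // polyCN opprK.
move=> c; rewrite hornerD hornerX hornerC => c_neq0.
pose t : 'rV[k]_n := \row_l (if l == j then c + 1 else 1).
have -> : \sum_(l < d) c ^+ l *: w l = amap d (linf (diag_mx t)).
  apply: lfun_monP => m; rewrite sum_lfunE (amapE d (linf_centered _)).
  have [lt_m|ge_m] := ltnP (mdeg m) d; last first.
    have h : jpi d 'X_[m] = 0 :> A by apply/jpi_eq0; apply: mpow_leq ge_m (mpowX _ _).
    rewrite h big1 => [|l _]; last by rewrite linear0.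
    apply/esym/jpi_eq0/msub_mpow; first exact: linf_centered.
    exact: mpow_leq ge_m (mpowX _ _).
  have -> : msub (linf (diag_mx t)) 'X_[m] = (c + 1) ^+ m j *: 'X_[m].
    have linE i : linf (diag_mx t) i = t 0 i *: 'X_i.
      rewrite ffunE (bigD1 i) //= big1 => [|l ne_l].
        by rewrite addr0 !mxE eqxx mulr1n ffunE.
      by rewrite !mxE [i == l]eq_sym (negPf ne_l) mulr0n scale0r.
    rewrite {1}mpolyXE_id rmorph_prod.
    under eq_bigr do rewrite rmorphXn /= msubX linE exprZn.
    rewrite scaler_prod -mpolyXE_id; congr (_ *: _).
    rewrite (bigD1 j) //= mxE eqxx big1 ?mulr1 // => i ne_ij.
    by rewrite mxE (negPf ne_ij) expr1n.
  rewrite linearZ /= [c + 1]addrC exprDn scaler_suml.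
  have le_mj : ((m j).+1 <= d)%N.
    by apply: leq_ltn_trans lt_m; rewrite mdegE (bigD1 j) //= leq_addr.
  pose T l : A := (c ^+ l * ('C(m j, l))%:R) *: jpi d 'X_[m].
  rewrite (eq_bigr (fun l : 'I_d => T l)) => [|l _]; last first.
    by rewrite scale_lfunE diagopE scalerA.
  rewrite [RHS](eq_bigr (fun l : 'I_(m j).+1 => T l)) => [|l _]; last first.
    by rewrite expr1n mul1r /T mulr_natr.
  rewrite -!(big_mkord xpredT T) (big_cat_nat (n := (m j).+1)) //=.
  rewrite [X in _ + X]big_nat [X in _ + X]big1 ?addr0 // => l /andP[lt_l _].
  by rewrite /T bin_small // mulr0 scale0r.
by apply: linf_torus => i; rewrite mxE; case: (i == j); rewrite ?oner_eq0.
Qed.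

Lemma torus_H phi : torus phi -> H phi.
Proof. by move=> h; apply: gen_subgroup_mem; left. Qed.

Lemma polyfun_jrep a m : polyfun (@coords k 'End(A)) (fun phi => (jrep (phi a))@_m).
Proof.
apply: polyfun_linear => c u v.
by rewrite add_lfunE scale_lfunE linearP /= mcoeffD mcoeffZ.
Qed.

Lemma jrep_line D c a :
  jrep ((\1%VF + c *: D : 'End(A)) a) = jrep a + c *: jrep (D a).
Proof. by rewrite add_lfunE id_lfunE scale_lfunE raddfD /= linearZ. Qed.

(** Multiplicativity is a family of quadratic equations, whose differentials
    at the identity express the Leibniz rule. *)
Lemma Lie_der (X : 'End(A) -> Prop) D : (forall phi, X phi -> is_endo phi) ->
  Lie X D -> is_der D.
Proof.
move=> Xendo hD a b; apply: jet_eqP => m lt_m.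
pose g phi := (jrep (phi (a * b)))@_m - (jrep (phi a) * jrep (phi b))@_m.
have hg : polyfun (@coords k 'End(A)) g.
  apply: polyfunB; first exact: polyfun_jrep.
  by apply: polyfamM => q; apply: polyfun_jrep.
have g0 phi : X phi -> g phi = 0.
  move=> /Xendo[_ phiM]; rewrite /g phiM -[in LHS](jrepK (phi a)) -{1}(jrepK (phi b)).
  by rewrite -rmorphM jrep_coeff ?jrepK // subrr.
pose q : {poly k} := ((jrep (a * b))@_m - (jrep a * jrep b)@_m)%:P +
  ((jrep (D (a * b)))@_m - (jrep a * jrep (D b) + jrep (D a) * jrep b)@_m) *: 'X
  - (jrep (D a) * jrep (D b))@_m *: 'X^2.
have gq c : g (\1%VF + c *: D) = q.[c].
  rewrite /g !jrep_line /q !hornerD hornerN hornerC !hornerZ hornerX hornerXn !mcoeffD !mcoeffZ.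
  rewrite !mulrDl !mulrDr !mcoeffD -!scalerAl -!scalerAr !mcoeffZ.
  by ring.
have := tangent_line char_k hg g0 hD gq.
rewrite /q !coefD coefN !coefZ coefC coefX coefXn /= mulr1 mulr0 subr0 add0r => /eqP.
rewrite subr_eq0 => /eqP ->.
have -> : a * D b + D a * b = jpi d (jrep a * jrep (D b) + jrep (D a) * jrep b).
  by rewrite rmorphD !rmorphM /= !jrepK.
by rewrite jrep_coeff.
Qed.

(** Only the trace survives modulo the square of the indeterminate, by
    [det_near1] for the ideal of the multiples of this square. *)
Lemma det_line (M : 'M[P]_n) : exists Q : {poly P},
  Q`_1 = \tr M /\ forall c : k, \det (1%:M + c%:MP *: M) = Q.[c%:MP].
Proof.
pose E : 'M[{poly P}]_n := 'X *: map_mx polyC M.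
exists (\det (1%:M + E)); split.
  have := det_near1 (Q := fun p : {poly P} => p`_0 = 0 /\ p`_1 = 0) (E := E).
  case=> [|a b [a0 a1] [b0 b1]|a b [b0 b1]|i j l h|_ /eqP].
  - by rewrite !coef0.
  - by rewrite !coefD a0 a1 b0 b1 addr0.
  - by rewrite !coefM !big_ord_recr !big_ord0 /= b0 b1 !mulr0 !addr0.
  - by rewrite !mxE mulrACA -expr2 !coefXnM.
  rewrite !coefB coef1 subr0 subr_eq0 => /eqP ->.
  by rewrite /mxtrace coef_sum; apply: eq_bigr => i _; rewrite !mxE coefXM coefC.
move=> c; rewrite -[RHS]/(horner_eval c%:MP (\det (1%:M + E))) -det_map_mx.
congr (\det _); apply/matrixP => i j.
by rewrite !mxE /= /horner_eval hornerD hornerM hornerX hornerC -polyC_natr hornerC.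
Qed.

(** The higher coefficients of the Jacobian determinant are equations of H,
    with the coefficients of the divergence as differentials at 1. *)
Lemma Lie_H_div D m : Lie H D -> (0 < mdeg m)%N -> (mdeg m < d.-1)%N ->
  (div (vf_of D))@_m = 0.
Proof.
move=> hD m_gt0 lt_m; pose g phi := (jac (vf_of phi))@_m.
have hg : polyfun (@coords k 'End(A)) g.
  apply: polyfam_jac => i q; apply: (polyfun_ext _ (polyfun_jrep (x i) q)) => phi.
  by rewrite ffunE.
have g0 phi : H phi -> g phi = 0.
  move=> /(H_GJac char_k d_gt1) hJ.
  have [c _ /mpow_coeff0 hc] := GJac_const d_gt1 hJ.
  have := hc m lt_m; rewrite mcoeffB mcoeffC; case: eqP => [m0|_].
    by rewrite m0 mdeg0 in m_gt0.
  by rewrite mulr0 subr0.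
have [Q [Q1 hQ]] := det_line (jacmx (vf_of D)).
pose q : {poly k} := \poly_(l < size Q) (Q`_l)@_m.
have gq c : g (\1%VF + c *: D) = q.[c].
  rewrite /g /jac.
  have -> : jacmx (vf_of (\1%VF + c *: D)) = 1%:M + c%:MP *: jacmx (vf_of D).
    apply/matrixP => i j; rewrite !mxE !ffunE jrep_line.
    have -> : jrep (x i) = 'X_i by apply/esym/jrep_uniq; rewrite ?msizeX ?mdeg1.
    rewrite mderivD mderivZ mul_mpolyC; congr (_ + _).
    by rewrite mderivXU.
  rewrite hQ horner_coef horner_poly raddf_sum; apply: eq_bigr => l _ /=.
  by rewrite -rmorphXn mulrC mcoeffCM mulrC.
have := tangent_line char_k hg g0 hD gq; rewrite coef_poly.
have divE : div (vf_of D) = Q`_1.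
  by rewrite Q1; apply: eq_bigr => i _; rewrite mxE.
case: ifP => [_ <-|/negbT]; first by rewrite divE.
by rewrite -leqNgt divE => /leq_sizeP/(_ 1%N (leqnn _)) ->; rewrite mcoeff0.
Qed.

Lemma Lie_H_der D : Lie H D -> is_der D.
Proof. by apply: Lie_der => phi /(H_GJac char_k d_gt1)[/aut_endo]. Qed.

End LieAlgebra.

Section RootDecomposition.
Variables (k : fieldType) (n d : nat).
Hypothesis char_k : [pchar k] =i pred0.
Hypothesis d_gt1 : (1 < d)%N.
Hypothesis n_gt1 : (1 < n)%N.
Local Notation A := (jet k n d).
Local Notation P := {mpoly k[n]}.
Local Notation vf := {ffun 'I_n -> P}.
Local Notation Zn := {ffun 'I_n -> int}.
Local Notation x i := (@jpi k n d 'X_i).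
Local Notation dmon j m := (@dmap k n d (mvf j 'X_[m])).
Local Notation H := (@subgroupH k n d).
Implicit Types (F G U W : vf) (phi psi D : 'End(A)) (m q : 'X_{1..n}) (p : P) (alpha : Zn).

Lemma dmap_sum (I : Type) (r : seq I) (B : pred I) (F : I -> vf) :
  dmap d (\sum_(i <- r | B i) F i) = \sum_(i <- r | B i) dmap d (F i).
Proof.
elim: r => [|i r IHr]; first by rewrite !big_nil dmap0.
by rewrite !big_cons; case: (B i); rewrite ?dmapD IHr.
Qed.

Lemma eroot_shift j m : eroot j (m + U_(j))%MM = expZ m.
Proof. by rewrite /eroot expZD addrK. Qed.

(** The component of degree alpha. Terms of degree at least d vanish in A;
    dropping them keeps the sum finite. *)
Definition gpart alpha F : vf := [ffun j =>
  \sum_(m : 'X_{1..n < d} | eroot j m == alpha) (F j)@_m *: 'X_[m]].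

Lemma mcoeff_gpart alpha F j m : (gpart alpha F j)@_m =
  if (mdeg m < d)%N && (eroot j m == alpha) then (F j)@_m else 0.
Proof.
rewrite ffunE raddf_sum /=; under eq_bigr do rewrite mcoeffZ mcoeffX.
have [lt_m|ge_m] /= := ltnP (mdeg m) d; last first.
  rewrite big1 // => q _; case: eqP => [eqm|_]; last by rewrite mulr0.
  by move: ge_m; rewrite -eqm leqNgt bmdeg.
case: ifP => [eq_a|ne_a].
  rewrite (bigD1 (BMultinom lt_m)) //= eqxx mulr1 big1 ?addr0 // => q /andP[_ ne_q].
  case: eqP => [eq_q|_]; last by rewrite mulr0.
  by case/eqP: ne_q; apply: val_inj.
rewrite big1 // => q eq_a; case: eqP => [eqm|_]; last by rewrite mulr0.
by rewrite -eqm eq_a in ne_a.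
Qed.

Lemma gpartE alpha F :
  gpart alpha F = \sum_(u : 'I_n * 'X_{1..n < d} | eroot u.1 u.2 == alpha)
     (F u.1)@_u.2 *: mvf u.1 'X_[u.2].
Proof.
rewrite -(pair_big_dep xpredT (fun j (m : 'X_{1..n < d}) => eroot j m == alpha)
  (fun j (m : 'X_{1..n < d}) => (F j)@_m *: mvf j 'X_[m])) /=.
apply/ffunP => i; rewrite ffunE sum_ffunE (bigD1 i) //= [X in _ + X]big1 => [|j ne_ji].
  rewrite addr0 sum_ffunE; apply: eq_bigr => m _; by rewrite !ffunE eqxx.
by rewrite sum_ffunE big1 // => m _; rewrite !ffunE eq_sym (negPf ne_ji) scaler0.
Qed.

Lemma gpart_centered alpha F : centered F -> centered (gpart alpha F).
Proof.
move=> hF j; rewrite mpow1E mcoeff_gpart; case: ifP => // _.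
by have := hF j; rewrite mpow1E.
Qed.

Lemma gpart_dmap alpha F : centered F ->
  dmap d (gpart alpha F) = \sum_(u : 'I_n * 'X_{1..n < d} |
     (eroot u.1 u.2 == alpha) && (u.2 != 0%MM :> 'X_{1..n}))
     (F u.1)@_u.2 *: dmon u.1 u.2.
Proof.
move=> hF; rewrite gpartE dmap_sum big_mkcondr /=; apply: eq_bigr => u _.
rewrite dmapZ; case: ifP => // /negbFE/eqP u0.
by have := hF u.1; rewrite u0 mpow1E => /eqP ->; rewrite scale0r.
Qed.

Lemma gpart_piece alpha F : centered F -> der_piece alpha (dmap d (gpart alpha F)).
Proof.
move=> hF; rewrite gpart_dmap //; apply: piece_sum => u /andP[/eqP <- u0].
by apply/piece_scale/mvf_piece.
Qed.

Lemma div_gpart alpha F q : (mdeg q < d.-1)%N ->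
  (div (gpart alpha F))@_q = if expZ q == alpha then (div F)@_q else 0.
Proof.
move=> lt_q; rewrite /div !raddf_sum /=.
have lt_q' j : (mdeg (q + U_(j))%MM < d)%N by rewrite mdegD mdeg1 addn1 -ltn_predRL.
case: ifP => eq_a; [apply: eq_bigr => j _|apply: big1 => j _];
  by rewrite !mcoeff_deriv mcoeff_gpart lt_q' eroot_shift eq_a ?mul0rn.
Qed.

Lemma divergence_dmap F : centered F -> divergence (dmap d F) = jpi d.-1 (div F).
Proof. by move=> hF; apply: divergenceE => i; rewrite (dmapX d_gt1 i hF). Qed.

Lemma nonneg_eroot j m q : eroot j m = expZ q -> m = (q + U_(j))%MM.
Proof.
by move=> /eqP; rewrite subr_eq -expZD => /eqP/expZ_inj.
Qed.

Lemma Lie_torus_zero F : centered F -> Lie (@torus k n d) (dmap d (gpart 0 F)).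
Proof.
move=> hF; rewrite gpart_dmap //; apply: tangent_sum => -[j m] /= /andP[/eqP e0 _].
apply: tangentZ; suff -> : (m : 'X_{1..n}) = U_(j)%MM by apply: Lie_torus_dmon.
by apply: expZ_inj; apply/eqP; rewrite -subr_eq0 -/(eroot j m) e0.
Qed.

(** The torus acts diagonally on the generators: the other coefficients of the
    image of x_i are linear equations of the torus. *)
Lemma Lie_torus_piece D : Lie (@torus k n d) D -> der_piece 0 D.
Proof.
move=> hD; have hder : is_der D.
  by apply: (Lie_H_der char_k d_gt1); apply: tangent_sub hD => phi; apply: torus_H.
have cF := der_centered char_k d_gt1 hder.
rewrite (der_dmap char_k d_gt1 hder).
have -> : dmap d (vf_of D) = dmap d (gpart 0 (vf_of D)); last exact: gpart_piece.
congr dmap; apply/ffunP => i; apply/mpolyP => m; rewrite mcoeff_gpart.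
have [lt_m|ge_m] /= := ltnP (mdeg m) d; last first.
  apply/memN_msupp_eq0/msize_mdeg_ge; rewrite ffunE.
  exact: leq_trans (msize_jrep _) ge_m.
case: eqP => // ne_m; rewrite ffunE.
have ne_mi : m != U_(i)%MM.
  by apply/eqP => eqm; case: ne_m; rewrite eqm /eroot subrr.
pose g phi := (jrep (phi (x i)))@_m.
have g0 phi : torus phi -> g phi = 0.
  case=> _ [t _ ht]; rewrite /g ht linearZ /= mcoeffZ jrep_coeff // mcoeffX.
  by rewrite eq_sym (negPf ne_mi) mulr0.
pose q : {poly k} := ((jrep (x i))@_m)%:P + (jrep (D (x i)))@_m *: 'X.
have := tangent_line char_k (q := q) (polyfun_jrep _ m) g0 hD.
rewrite coefD coefC coefZ coefX mulr1 add0r; apply => c.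
by rewrite jrep_line mcoeffD mcoeffZ hornerD hornerC hornerZ hornerX mulrC.
Qed.

Lemma piece_coeff alpha D i m : der_piece alpha D -> (mdeg m < d)%N ->
  eroot i m != alpha -> (jrep (D (x i)))@_m = 0.
Proof.
move=> hD lt_m ne_m; have [c ->] := piece_gen i hD.
rewrite linearZ /= mcoeffZ jrep_coeff //.
have [[q eq_q]|[l bl]] := monomial_or_neg (expZ U_(i)%MM + alpha); last first.
  by rewrite (xmon_neg k bl) mcoeff0 mulr0.
rewrite eq_q xmon_exp mcoeffX; case: eqP => [eq_qm|_]; last by rewrite mulr0.
by case/eqP: ne_m; rewrite /eroot -eq_qm -eq_q addrC addKr.
Qed.

Lemma LieH_piece_der alpha D : LieH_piece alpha D -> der_piece alpha D.
Proof. by case=> [[-> /Lie_torus_piece]|[_]|[_ []]]. Qed.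

(** Components of distinct degrees involve distinct monomials. *)
Lemma pieces_independent (s : seq Zn) (f : Zn -> 'End(A)) : uniq s ->
    (forall alpha, alpha \in s -> der_piece alpha (f alpha)) ->
    \sum_(alpha <- s) f alpha = 0 ->
  forall alpha, alpha \in s -> f alpha = 0.
Proof.
move=> uniq_s hf sum0 alpha alpha_s.
have der0 : is_der (0 : 'End(A)) by case: (piece0 k d (0 : Zn)).
apply: der_ext; [exact: (hf _ alpha_s).1|by []|move=> i].
rewrite zero_lfunE; apply: jet_eqP => m lt_m; rewrite linear0 mcoeff0.
have [eq_a|ne_a] := eqVneq (eroot i m) alpha; last exact: piece_coeff (hf _ alpha_s) lt_m ne_a.
have := congr1 (fun D : 'End(A) => (jrep (D (x i)))@_m) sum0.
have sumE (r : seq Zn) : (jrep ((\sum_(beta <- r) f beta) (x i)))@_m =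
    \sum_(beta <- r) (jrep (f beta (x i)))@_m.
  elim: r => [|beta r IHr]; first by rewrite !big_nil zero_lfunE linear0 mcoeff0.
  by rewrite !big_cons add_lfunE linearD mcoeffD IHr.
rewrite zero_lfunE linear0 mcoeff0 sumE (bigD1_seq alpha) //=.
rewrite big_seq_cond big1 ?addr0 // => beta /andP[beta_s ne_ba].
by apply: piece_coeff (hf _ beta_s) lt_m _; rewrite eq_a eq_sym.
Qed.

(** For an inner degree the components of D are multiples of x^(a + e_i), so
    that div D is a multiple of x^a and vanishes already in k[x]. *)
Lemma LieH_piece_Lie alpha D : LieH_piece alpha D -> Lie H D.
Proof.
have Lie0 : Lie H 0 by apply: tangent0.
case=> [[_]|[[_ nneg] hD]|[[_ nneg] [hD divD]]].
- by apply: tangent_sub => phi; apply: torus_H.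
- have [[m eq_m]|[j aj]] := monomial_or_neg alpha.
    by case: nneg => i; rewrite eq_m ffunE.
  have [->//|[c [m [-> _ mj m_neq0]]]] := piece_negative char_k d_gt1 hD aj.
  apply/tangentZ/(Lie_divfree char_k d_gt1 n_gt1 (e := mdeg m)).
  + by rewrite lt0n mdeg_eq0.
  + move=> i q ne_q; rewrite ffunE; case: eqP => _; last by rewrite mcoeff0.
    by rewrite mcoeffX; case: eqP => // eqm; rewrite eqm eqxx in ne_q.
  by rewrite div_mvf mderivX mj scale0r.
have [a eq_a] := expZ_nonneg nneg.
have hder := hD.1; have cF := der_centered char_k d_gt1 hder.
set F := vf_of D in cF.
have DE : D = dmap d F by apply: der_dmap.
have F0 i m : m != (a + U_(i))%MM -> (F i)@_m = 0.
  move=> ne_m; have [lt_m|ge_m] := ltnP (mdeg m) d; last first.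
    apply/memN_msupp_eq0/msize_mdeg_ge; rewrite ffunE.
    exact: leq_trans (msize_jrep _) ge_m.
  rewrite ffunE; apply: piece_coeff hD lt_m _.
  by rewrite eq_a; apply: contra ne_m => /eqP/nonneg_eroot ->.
rewrite DE; apply: (Lie_divfree char_k d_gt1 n_gt1 (e := (mdeg a).+1)) => //.
  move=> i m ne_m; apply: F0; apply: contra ne_m => /eqP ->.
  by rewrite mdegD mdeg1 addn1.
move: divD; rewrite DE divergence_dmap // => /jpi_eq0 hdiv.
apply/mpolyP => m; rewrite mcoeff0; have [lt_m|ge_m] := ltnP (mdeg m) d.-1.
  exact: mpow_coeff0 hdiv lt_m.
rewrite raddf_sum big1 //= => i _; rewrite mcoeff_deriv memN_msupp_eq0 ?mul0rn //.
apply/msize_mdeg_ge; rewrite ffunE; apply: (leq_trans (msize_jrep _)).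
by rewrite mdegD mdeg1 addn1 -(prednK (ltnW d_gt1)) ltnS.
Qed.

Theorem Lie_H_direct_sum :
  internal_direct_sum (fun alpha : Zn => alpha = 0 \/ jet_root k d alpha)
    (@LieH_piece k n d) (Lie H).
Proof.
split=> [D|s f uniq_s hf sum0 alpha alpha_s]; last first.
  apply: (pieces_independent uniq_s _ sum0) => // beta /hf[_].
  exact: LieH_piece_der.
split=> [hD|[s [f [_ hf ->]]]]; last first.
  by rewrite big_seq; apply: tangent_sum => alpha /hf[_] /LieH_piece_Lie.
have hder := Lie_H_der char_k d_gt1 hD.
have cF := der_centered char_k d_gt1 hder; set F := vf_of D in cF.
pose s := undup [seq eroot u.1 (val u.2) |
  u <- [seq u <- enum {: 'I_n * 'X_{1..n < d}} | val u.2 != 0%MM]].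
have sP alpha : alpha \in s ->
    exists j m, [/\ alpha = eroot j m, m != 0%MM & (mdeg m < d)%N].
  rewrite mem_undup => /mapP[[j m]]; rewrite mem_filter => /andP[/= m_neq0 _] ->.
  by exists j, m; rewrite bmdeg.
exists s, (fun alpha => dmap d (gpart alpha F)); split; first exact: undup_uniq.
  move=> alpha /sP[j [m [eq_a m_neq0 lt_m]]].
  have piece := gpart_piece alpha cF.
  have [a0|a_neq0] := eqVneq alpha 0.
    split; [by left|apply: Or31; split=> //].
    by rewrite a0; apply: Lie_torus_zero.
  have root : jet_root k d alpha by rewrite eq_a in a_neq0 *; apply: eroot_jet_root.
  split; first by right.
  have [/forallP nneg|neg] := boolP [forall i, 0 <= alpha i]; last first.
    by apply: Or32; do ! split=> //; apply/forallP.
  apply: Or33; do ! split=> //.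
  rewrite divergence_dmap; last exact: gpart_centered.
  apply/jpi_eq0/mpow_coeffP => q lt_q; rewrite div_gpart //.
  case: eqP => // eq_q; apply: (Lie_H_div char_k d_gt1 hD) => //.
  rewrite lt0n mdeg_eq0; apply: contra_neq a_neq0 => q0.
  by rewrite -eq_q q0; apply/ffunP => i; rewrite !ffunE mnm0E.
rewrite -dmap_sum {1}(der_dmap char_k d_gt1 hder) -/F; congr dmap.
apply/ffunP => j; apply/mpolyP => m; rewrite sum_ffunE raddf_sum /=.
under eq_bigr do rewrite mcoeff_gpart.
have [lt_m|ge_m] /= := ltnP (mdeg m) d; last first.
  rewrite big1 //; apply/memN_msupp_eq0/msize_mdeg_ge; rewrite ffunE.
  exact: leq_trans (msize_jrep _) ge_m.
have [m0|m_neq0] := eqVneq m 0%MM.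
  have -> : (F j)@_m = 0 by have := cF j; rewrite mpow1E m0 => /eqP.
  by rewrite big1 // => alpha _; rewrite if_same.
have in_s : eroot j m \in s.
  rewrite mem_undup; apply/mapP; exists (j, BMultinom lt_m) => //.
  by rewrite mem_filter m_neq0 mem_enum.
rewrite (bigD1_seq (eroot j m)) ?undup_uniq //= eqxx big1 ?addr0 // => alpha.
by rewrite eq_sym => /negPf ->.
Qed.

End RootDecomposition.

(** * Dimensions *)

Section MonomialCount.
Variable n : nat.

Lemma card_bmultinom b : #|{: 'X_{1..n < b.+1}}| = 'C(n + b, n).
Proof.
rewrite -card_partial_ord_partitions -cardsT.
pose f (m : 'X_{1..n < b.+1}) : n.-tuple 'I_b.+1 := [tuple inord (m i) | i < n].
have le_m (m : 'X_{1..n < b.+1}) i : (m i < b.+1)%N.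
  by apply: leq_ltn_trans (bmdeg m); rewrite mdegE (bigD1 i) //= leq_addr.
have fE m i : tnth (f m) i = m i :> nat by rewrite tnth_mktuple inordK.
rewrite -(card_imset (f := f)); last first.
  move=> m m' eq_f; apply: val_inj; apply/mnmP => i /=.
  by rewrite -!fE eq_f.
congr #|pred_of_set _|; apply/setP => t; rewrite inE big_tuple.
apply/imsetP/idP => [[m _ ->]|le_t].
  under eq_bigr do rewrite fE.
  by rewrite -mdegE -ltnS bmdeg.
have lt_t : (mdeg [multinom (tnth t i : nat) | i < n] < b.+1)%N.
  by rewrite mdegE; under eq_bigr do rewrite mnmE.
exists (BMultinom lt_t) => //; apply: eq_from_tnth => i; apply: val_inj.
by rewrite /= fE /= mnmE.
Qed.

End MonomialCount.

Section Dimensions.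
Variables (k : fieldType) (n d : nat).
Hypothesis char_k : [pchar k] =i pred0.
Hypothesis d_gt1 : (1 < d)%N.
Hypothesis n_gt1 : (1 < n)%N.
Local Notation A := (jet k n d).
Local Notation P := {mpoly k[n]}.
Local Notation vf := {ffun 'I_n -> P}.
Local Notation Zn := {ffun 'I_n -> int}.
Local Notation x i := (@jpi k n d 'X_i).
Local Notation H := (@subgroupH k n d).
Local Notation coef_index := ('I_n * 'X_{1..n < d})%type.
Implicit Types (F G U W : vf) (phi psi D : 'End(A)) (m q : 'X_{1..n}) (p : P) (u : coef_index).

(** A polynomial killed modulo m^d lies in every m^e with e <= d, since U acts
    trivially on the graded pieces. *)
Lemma near_id_aut U : near_id 2 U -> is_aut (amap d U).
Proof.
move=> U2; have cU := near_id_centered (isT : (0 < 2)%N) U2.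
have ker0 : lker (amap d U) == 0%VS.
  rewrite -subv0; apply/subvP => a; rewrite memv_ker memv0 -[a]jrepK.
  rewrite (amapE d cU) => /eqP/jpi_eq0 h; apply/eqP/jpi_eq0.
  move: (jrep a) h => p hp; suff h e : (e <= d)%N -> p \in mpow k n e by apply: h.
  elim: e => [_|e IHe lt_e]; first exact: mpow0.
  have -> : p = msub U p - (msub U p - p) by rewrite opprB addrC subrK.
  by rewrite rpredB //; [apply: mpow_leq hp|apply/msub_unip/IHe/ltnW].
apply: (inverse_aut (psi := (amap d U)^-1%VF)).
- exact: amap_endo.
- exact: lker0_compfV.
- exact: lker0_compVf.
Qed.

Lemma vlin_linf U L : near_id 2 U ->
  amap d (vlin L U) = (amap d U \o amap d (linf L))%VF.
Proof.
move=> U2; rewrite amap_comp; first by rewrite vcomp_vlin.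
  exact: near_id_centered U2.
exact: linf_centered.
Qed.

Lemma vlin_aut L U : L \in unitmx -> near_id 2 U -> is_aut (amap d (vlin L U)).
Proof.
by move=> uL U2; rewrite vlin_linf //; apply: aut_comp; [apply: near_id_aut|apply: linf_aut].
Qed.

Lemma near_id_linmx U : near_id 2 U -> linmx U = 1%:M.
Proof.
move=> U2; apply/matrixP => i j; rewrite !mxE.
have lt2 : (mdeg (U_(j) : 'X_{1..n})%MM < 2)%N by rewrite mdeg1.
by have /eqP := mpow_coeff0 (U2 i) lt2; rewrite mcoeffB mcoeffXU subr_eq0 => /eqP.
Qed.


Lemma jet_expand (a : A) : a = \sum_(m : 'X_{1..n < d}) (jrep a)@_m *: jpi d 'X_[m].
Proof.
rewrite -[LHS]jrepK {1}/jrep linear_sum; apply: eq_bigr => m _ /=.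
by rewrite linearZ /= mcoeff_jrep bmdeg.
Qed.

Definition unit_fun (w : 'X_{1..n < d} * 'X_{1..n < d}) (a : A) : A :=
  (jrep a)@_w.1 *: jpi d 'X_[w.2].
Fact unit_fun_is_linear w : linear (unit_fun w).
Proof.
by move=> b a1 a2; rewrite /unit_fun linearP /= mcoeffD mcoeffZ scalerDl -scalerA.
Qed.
HB.instance Definition _ w :=
  GRing.isLinear.Build k A A *:%R (unit_fun w) (unit_fun_is_linear w).
Definition unit_end w : 'End(A) := linfun (unit_fun w).

Lemma end_expand phi :
  phi = \sum_(w : 'X_{1..n < d} * 'X_{1..n < d})
           (jrep (phi (jpi d 'X_[w.1])))@_w.2 *: unit_end w.
Proof.
apply/lfunP => a; rewrite sum_lfunE.
rewrite -(pair_big xpredT xpredT (fun m q : 'X_{1..n < d} =>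
  ((jrep (phi (jpi d 'X_[m])))@_q *: unit_end (m, q)) a)) /=.
rewrite {1}(jet_expand a) linear_sum; apply: eq_bigr => m _ /=.
rewrite linearZ /= {1}(jet_expand (phi _)) scaler_sumr; apply: eq_bigr => q _.
by rewrite scale_lfunE lfunE /= /unit_fun /= !scalerA mulrC.
Qed.

Lemma amap_polyfun (T : Type) (N : nat) (c : T -> 'I_N -> k) (F : T -> vf) l :
    (forall t, centered (F t)) -> (forall i, polyfam c (fun t => F t i)) ->
  polyfun c (fun t => coords (amap d (F t)) l).
Proof.
move=> cF hF; apply: (@polyfun_ext _ _ _ _ (fun t =>
    \sum_(w : 'X_{1..n < d} * 'X_{1..n < d})
       (msub (F t) 'X_[w.1])@_w.2 * coords (unit_end w) l)) => [t|].
  rewrite [in RHS](end_expand (amap d (F t))) /coords linear_sum.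
  apply: eq_bigr => w _ /=; rewrite linearZ /= (amapE d (cF t)) jrep_coeff //.
  exact: bmdeg.
apply: polyfun_sum => w _; apply: polyfunM; last exact: polyfun_const.
exact: polyfam_msubX.
Qed.

Section LinearTimesUnipotent.
Variables (pr : pred coef_index) (U : ({u | pr u} -> k) -> vf).
Hypotheses (U_near : forall z, near_id 2 (U z))
  (U_poly : forall i, polyfam (@fcoords k _) (fun z => U z i))
  (U_coef : forall z (v : {u | pr u}), (U z (val v).1)@_(val v).2 = z v).

Local Notation param := ('I_n * 'I_n + {u | pr u})%type.

Definition lin_of (y : param -> k) : 'M[k]_n := \matrix_(i, j) y (inl (i, j)).
Definition unip_of (y : param -> k) : {u | pr u} -> k := fun v => y (inr v).

(** The entries of the linear part L, and the free coefficients of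
    adj L times the tuple, are independent functions. *)
Lemma dimension_LU (X : 'End(A) -> Prop) :
    (forall phi, X phi <->
       exists2 L, L \in unitmx & exists z, phi = amap d (vlin L (U z))) ->
  has_dimension X (n * n + #|pr|).
Proof.
move=> XP; have -> : (n * n + #|pr| = #|{: param}|)%N.
  by rewrite card_sum card_prod card_ord card_sig.
pose Phi (y : param -> k) := amap d (vlin (lin_of y) (U (unip_of y))).
pose F phi := vf_of phi.
pose g (j : param) phi : k := match j with
  | inl ij => linmx (F phi) ij.1 ij.2
  | inr v => \sum_l (\adj (linmx (F phi))) (val v).1 l * (F phi l)@_(val v).2
  end.
have cU z : centered (U z) by apply: near_id_centered (U_near z).
have F_poly i m : polyfun (@coords k 'End(A)) (fun phi => (F phi i)@_m).
  by apply: (polyfun_ext _ (polyfun_jrep (x i) m)) => phi; rewrite ffunE.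
have lin_poly i j : polyfun (@fcoords k param) (fun y => lin_of y i j).
  apply: (polyfun_ext _ (polyfun_coord _ (enum_rank (inl (i, j) : param)))) => y.
  by rewrite /fcoords enum_rankK mxE.
apply: (dimension_param char_k (Phi := Phi) (g := g) (q := fun y => \det (lin_of y))).
- move=> l; apply: amap_polyfun => [y|i]; first exact: centered_vlin.
  apply: (@polyfam_ext _ _ _ _ _ (fun y => \sum_j lin_of y i j *: U (unip_of y) j)).
    by move=> y; rewrite ffunE.
  apply: polyfam_sum => j _; apply: polyfamZ => // m.
  apply: (@polyfun_comp _ _ _ _ _ (@fcoords k _) _ unip_of (fun z => (U z j)@_m)).
    move=> h; apply: (polyfun_ext _ (polyfun_coord _
      (enum_rank (inr (enum_val h) : param)))) => y.
    by rewrite /fcoords enum_rankK.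
  exact: U_poly.
- move=> phi /XP[L _ [z ->]].
  pose y (j : param) := match j with inl ij => L ij.1 ij.2 | inr v => z v end.
  exists y; rewrite /Phi (_ : lin_of y = L) //.
  by apply/matrixP => i j; rewrite mxE.
- have L_poly i j : polyfun (@coords k 'End(A)) (fun phi => linmx (F phi) i j).
    by apply: (polyfun_ext _ (F_poly i U_(j)%MM)) => phi; rewrite mxE.
  case=> [[i j]|v] /=; first exact: L_poly.
  apply: polyfun_sum => l _; apply: polyfunM; last exact: F_poly.
  apply: (@polyfun_ext _ _ _ _ (fun phi => cofactor (linmx (F phi)) l (val v).1)).
    by move=> phi; rewrite mxE.
  apply: polyfunM; first exact: polyfun_const.
  apply: polyfun_det => i j; apply: (polyfun_ext _ (L_poly (lift l i) (lift (val v).1 j))) => phi.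
  by rewrite [RHS]mxE [RHS]mxE.
- exact: polyfun_det.
- exists (fun j : param => match j with inl ij => (ij.1 == ij.2)%:R | inr v => 0 end).
  rewrite (_ : lin_of _ = 1%:M) ?det1 ?oner_neq0 //.
  by apply/matrixP => i j; rewrite !mxE.
move=> y det_neq0; set L := lin_of y in det_neq0 *.
(* Multiplying by adj L turns the free coefficients z into det L times z. *)
pose z v := (\det L)^-1 * unip_of y v.
have uL : L \in unitmx by rewrite unitmxE unitfE.
exists (amap d (vlin L (U z))); first by apply/XP; exists L => //; exists z.
have cV : centered (vlin L (U z)) by apply: centered_vlin.
have FE l m : (mdeg m < d)%N -> (F (amap d (vlin L (U z))) l)@_m = (vlin L (U z) l)@_m.
  by move=> lt_m; rewrite ffunE (amapE d cV) msubX jrep_coeff.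
have LE : linmx (F (amap d (vlin L (U z)))) = L.
  rewrite -[RHS]mulmx1 -(near_id_linmx (U_near z)) -linmx_vlin.
  by apply/matrixP => i j; rewrite !mxE FE ?mdeg1.
case=> [[i j]|v] /=; first by rewrite LE mxE.
rewrite LE; under eq_bigr do rewrite FE ?bmdeg //.
have <- : (vlin (\adj L) (vlin L (U z)) (val v).1)@_(val v).2 =
    \sum_l (\adj L) (val v).1 l * (vlin L (U z) l)@_(val v).2.
  by rewrite ffunE raddf_sum; apply: eq_bigr => l _; rewrite /= mcoeffZ.
rewrite vlin_comp mul_adj_mx ffunE raddf_sum (bigD1 (val v).1) //= big1 => [|l ne_l].
  by rewrite addr0 mcoeffZ U_coef mxE eqxx mulr1n /z mulVKf.
by rewrite mcoeffZ mxE eq_sym (negPf ne_l) mulr0n mul0r.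
Qed.

End LinearTimesUnipotent.

Definition zext (pr : pred coef_index) (z : {u | pr u} -> k) u : k :=
  oapp z 0 (insub u).

(** The identity perturbed by monomials at the indices satisfying pr; it stays
    tangent to the identity when these indices have degree at least 2. *)
Definition ubase (pr : pred coef_index) (z : {u | pr u} -> k) : vf :=
  [ffun i => 'X_i + \sum_(m : 'X_{1..n < d}) zext z (i, m) *: 'X_[m]].

Lemma zext_val (pr : pred coef_index) (z : {u | pr u} -> k) v : zext z (val v) = z v.
Proof. by rewrite /zext valK. Qed.

Lemma zext_out (pr : pred coef_index) (z : {u | pr u} -> k) u : ~~ pr u -> zext z u = 0.
Proof. by move=> npr; rewrite /zext insubN. Qed.

Lemma mcoeff_ubase (pr : pred coef_index) (z : {u | pr u} -> k) i (m : 'X_{1..n < d}) :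
  (ubase z i)@_m = ((m : 'X_{1..n}) == U_(i)%MM)%:R + zext z (i, m).
Proof.
rewrite ffunE mcoeffD mcoeffX eq_sym raddf_sum (bigD1 m) //= mcoeffZ mcoeffX eqxx.
rewrite mulr1 big1 ?addr0 // => q ne_q; rewrite mcoeffZ mcoeffX.
case: eqP => [eq_q|]; last by rewrite mulr0.
by case/eqP: ne_q; apply: val_inj.
Qed.

Lemma ubase_near (pr : pred coef_index) (z : {u | pr u} -> k) : (forall u, pr u -> 1 < mdeg u.2)%N ->
  near_id 2 (ubase z).
Proof.
move=> hpr i; rewrite ffunE addrC addKr; apply: rpred_sum => m _.
have [/hpr lt_m|npr] := boolP (pr (i, m)); last by rewrite zext_out // scale0r rpred0.
by apply: mpowZ; apply: mpow_leq lt_m (mpowX _ _).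
Qed.

Lemma ubase_poly (pr : pred coef_index) i : polyfam (@fcoords k _) (fun z : {u | pr u} -> k => ubase z i).
Proof.
apply: (@polyfam_ext _ _ _ _ _ (fun z => 'X_i +
  \sum_(m : 'X_{1..n < d}) zext z (i, m) *: 'X_[m])) => [z|]; first by rewrite ffunE.
apply: polyfamD; first exact: polyfam_const.
apply: polyfam_sum => m _; apply: polyfamZ; last exact: polyfam_const.
rewrite /zext; case: insubP => [v _ _|_] /=; last exact: polyfun_const.
apply: (polyfun_ext _ (polyfun_coord _ (enum_rank v))) => z.
by rewrite /fcoords enum_rankK.
Qed.

Definition higher u := (1 < mdeg u.2)%N.

(** With no condition on the Jacobian all higher coefficients are free. *)
Lemma dimension_aut : has_dimension (@is_aut k n d) (n * n + #|higher|).
Proof.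
apply: (@dimension_LU higher (@ubase higher)).
- by move=> z; apply: ubase_near.
- exact: ubase_poly.
- move=> z v; rewrite mcoeff_ubase -surjective_pairing zext_val.
  rewrite (_ : (_ == _) = false) ?add0r //; apply/negP => /eqP eq_m.
  by have := valP v; rewrite /higher /= eq_m mdeg1.
move=> phi; split=> [haut|[L uL [z ->]]]; last by apply/vlin_aut => //; apply: ubase_near.
have cF := aut_centered d_gt1 haut; have uL := aut_linmx d_gt1 haut.
have [U [U2 FE _]] := linear_unipotent cF uL; exists (linmx (vf_of phi)) => //.
pose z (v : {u | higher u}) := (U (val v).1)@_(val v).2; exists z.
have z2 : near_id 2 (ubase z) by apply: ubase_near.
have phiE : phi = amap d (vlin (linmx (vf_of phi)) U) by rewrite -FE; apply: aut_amap.
rewrite [LHS]phiE (vlin_linf _ U2) (vlin_linf _ z2).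
have -> : amap d U = amap d (ubase z); last by [].
apply: amap_congr; [exact: near_id_centered U2|exact: near_id_centered z2|move=> i].
apply/mpow_coeffP => m lt_m; rewrite mcoeffB (mcoeff_ubase _ _ (BMultinom lt_m)).
have [h|h] := boolP (higher (i, BMultinom lt_m)).
  rewrite -[(i, _)]/(val (Sub (i, BMultinom lt_m) h : {u | higher u})) zext_val /=.
  rewrite (_ : (_ == _) = false) ?add0r ?subrr //; apply/negP => /eqP eq_m.
  by move: h; rewrite /higher /= eq_m mdeg1.
have lt2 : (mdeg m < 2)%N by rewrite ltnNge.
rewrite zext_out // addr0 /=; have /eqP := mpow_coeff0 (U2 i) lt2.
by rewrite mcoeffB mcoeffX subr_eq0 => /eqP ->; rewrite eq_sym subrr.
Qed.

Section ConstantJacobian.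
Variable i0 : 'I_n.

(** The coefficient of x^(a + e_i0) in the component i0 is the one that the
    Jacobian condition in degree a determines from the others. *)
Definition free u := higher u && ~~ ((u.1 == i0) && (0 < u.2 i0)%N).

(** Adding to the component i0 a multiple of x_i0 times the degree t part of
    the Jacobian determinant makes this part vanish. *)
Definition correction t F : P := - \sum_(m : 'X_{1..n < d} | mdeg m == t)
  ((jac F)@_m / (m i0).+1%:R) *: 'X_[m + U_(i0)].
Fixpoint ustep (z : {u | free u} -> k) t : vf :=
  if t is t'.+1 then ustep z t' + mvf i0 (correction t (ustep z t')) else ubase z.

Lemma free_higher u : free u -> (1 < mdeg u.2)%N.
Proof. by case/andP. Qed.

Lemma correction_mpow t F : correction t F \in mpow k n t.+1.
Proof.
rewrite rpredN; apply: rpred_sum => m /eqP deg_m; apply: mpowZ.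
by have := mpowX k (m + U_(i0))%MM; rewrite mdegD mdeg1 addn1 deg_m.
Qed.

Lemma ustep_near z t : near_id 2 (ustep z t).
Proof.
elim: t => [|t IHt] /=; first exact/ubase_near/free_higher.
move=> i; rewrite ffunE addrAC rpredD // ffunE; case: eqP => _; last exact: rpred0.
exact: mpow_leq (correction_mpow _ _).
Qed.

Lemma ustep_poly t i : polyfam (@fcoords k _) (fun z => ustep z t i).
Proof.
elim: t i => [|t IHt] i; first exact: ubase_poly.
apply: (@polyfam_ext _ _ _ _ _ (fun z => ustep z t i + (i == i0)%:R *:
   ((-1) *: \sum_(m : 'X_{1..n < d} | mdeg m == t.+1)
     ((jac (ustep z t))@_m * (m i0).+1%:R^-1) *: 'X_[m + U_(i0)]))).
  move=> z; rewrite /= !ffunE /correction scaleN1r; case: eqP => _; first by rewrite scale1r.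
  by rewrite scale0r.
apply: polyfamD => //; apply: polyfamZ; first exact: polyfun_const.
apply: polyfamZ; first exact: polyfun_const.
apply: polyfam_sum => m _; apply: polyfamZ; last exact: polyfam_const.
by apply: polyfunM; [apply: polyfam_jac|apply: polyfun_const].
Qed.

Lemma ustep_coef z t (v : {u | free u}) : (ustep z t (val v).1)@_(val v).2 = z v.
Proof.
elim: t => [|t IHt] /=.
  rewrite mcoeff_ubase -surjective_pairing zext_val.
  rewrite (_ : (_ == _) = false) ?add0r //; apply/negP => /eqP eq_m.
  by have := free_higher (valP v); rewrite /= eq_m mdeg1.
rewrite ffunE mcoeffD IHt ffunE; case: eqP => [eq_i|_]; last by rewrite mcoeff0 addr0.
rewrite mcoeffN raddf_sum big1 ?oppr0 ?addr0 //= => m _; rewrite mcoeffZ mcoeffX.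
case: eqP => [eq_m|]; last by rewrite mulr0.
have /andP[_] := valP v; rewrite eq_i eqxx /= -eq_m mnmDE mnm1E eqxx addn1 //.
Qed.

Lemma ustep_jac z t : (t.+1 < d)%N -> jac (ustep z t) - 1 \in mpow k n t.+1.
Proof.
elim: t => [_|t IHt lt_t].
  rewrite -(jac_idvf k n); apply: (jac_congr (e := 2)) => i.
  by rewrite [X in _ - X]ffunE; apply: ustep_near.
set F := ustep z t; set G := ustep z t.+1.
have GF i : G i - F i = mvf i0 (correction t.+1 F) i.
  by rewrite /G /= [in LHS]ffunE addrC addKr.
have hp := jac_perturb (F := F) (G := G) (e := t.+1) isT (ustep_near z t).
have {}hp : jac G - jac F - (correction t.+1 F)^`M(i0) \in mpow k n t.+2.
  rewrite -(div_mvf i0) /div; under eq_bigr do rewrite -GF.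
  apply: hp => i; rewrite GF ffunE; case: eqP => _; last exact: rpred0.
  exact: correction_mpow.
have -> : jac G - 1 = (jac G - jac F - (correction t.+1 F)^`M(i0)) +
    ((jac F - 1) + (correction t.+1 F)^`M(i0)) by ring.
rewrite rpredD //; apply/mpow_coeffP => q; rewrite ltnS leq_eqVlt mcoeffD.
case/orP=> [/eqP deg_q|lt_q]; last first.
  rewrite (mpow_coeff0 (IHt (ltnW lt_t)) lt_q) add0r.
  exact: mpow_coeff0 (mpow_deriv i0 (correction_mpow _ _)) lt_q.
have lt_qd : (mdeg q < d)%N by rewrite deg_q ltnW.
rewrite mcoeff_deriv mcoeffN raddf_sum /= (bigD1 (BMultinom lt_qd)) /= ?deg_q //.
rewrite mcoeffZ mcoeffX eqxx mulr1 big1 ?addr0 => [|m /andP[_ ne_m]]; last first.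
  rewrite mcoeffZ mcoeffX eqm_add2r; case: eqP => [eq_m|]; last by rewrite mulr0.
  by case/eqP: ne_m; apply: val_inj.
rewrite mulNrn -[(_ / _) *+ _]mulr_natr mulfVK ?natr_neq0 // mcoeffB mcoeff1 -mdeg_eq0 deg_q subr0.
by rewrite subrr.
Qed.

(** Two solutions of the Jacobian condition with the same free coefficients
    agree: the lowest term of their difference is killed by d/dx_i0. *)
Lemma jac_unique F G c : near_id 2 F -> near_id 2 G ->
    jac F - c%:MP \in mpow k n d.-1 -> jac G - c%:MP \in mpow k n d.-1 ->
    (forall u, free u -> (F u.1)@_u.2 = (G u.1)@_u.2) ->
  forall i, G i - F i \in mpow k n d.
Proof.
move=> F2 G2 jF jG eqFG.
have jGF : jac G - jac F \in mpow k n d.-1.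
  by have := rpredB jG jF; rewrite opprB addrA subrK.
suff h e : (1 < e)%N -> (e <= d)%N -> forall i, G i - F i \in mpow k n e by apply: h.
elim: e => // e IHe; rewrite ltnS leq_eqVlt => /orP[/eqP <- _ i|lt_e lt_ed].
  have -> : G i - F i = (G i - 'X_i) - (F i - 'X_i) by rewrite opprB addrA subrK.
  by rewrite rpredB.
have {}IHe := IHe lt_e (ltnW lt_ed); have e_gt0 := ltnW lt_e.
have hp : jac G - jac F - \sum_i (G i - F i)^`M(i) \in mpow k n e.
  have -> : e = e.-1.+1 by rewrite prednK.
  by apply: jac_perturb => // [|i]; [rewrite -ltnS prednK|rewrite prednK].
have hd : \sum_i (G i - F i)^`M(i) \in mpow k n e.
  rewrite -[X in X \in _](subKr (jac G - jac F)) rpredB //.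
  by apply: mpow_leq jGF; rewrite -ltnS prednK // ltnW.
have free0 i m : (mdeg m = e)%N -> ~~ ((i == i0) && (0 < m i0)%N) -> (G i - F i)@_m = 0.
  move=> deg_m nfree; have lt_m : (mdeg m < d)%N by rewrite deg_m.
  have h := eqFG (i, BMultinom lt_m); rewrite mcoeffB -h ?subrr //.
  by rewrite /free /higher /= deg_m lt_e.
move=> i; apply/mpow_coeffP => m; rewrite ltnS leq_eqVlt => /orP[/eqP deg_m|]; last first.
  exact: mpow_coeff0.
have [/andP[/eqP -> m_gt0]|] := boolP ((i == i0) && (0 < m i0)%N); last exact: free0.
have mE : (m - U_(i0) + U_(i0))%MM = m by rewrite submK // lep1mP -lt0n.
have deg_q : (mdeg (m - U_(i0))%MM).+1 = e by rewrite -deg_m -[in RHS]mE mdegD mdeg1 addn1.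
have lt_q : (mdeg (m - U_(i0))%MM < e)%N by rewrite -deg_q.
have := mpow_coeff0 hd lt_q; rewrite raddf_sum (bigD1 i0) //= big1 => [|j ne_j].
  rewrite addr0 mcoeff_deriv mE -mulr_natr => /eqP.
  by rewrite mulf_eq0 (negPf (natr_neq0 char_k _)) orbF => /eqP.
rewrite mcoeff_deriv free0 ?mul0rn // ?(negPf ne_j) //.
by rewrite mdegD mdeg1 addn1.
Qed.

(** By [ustep_jac] and [jac_unique], an element of H is the product of its
    linear part and of the unique solution of the Jacobian condition with its
    free coefficients. *)
Lemma dimension_H : has_dimension H (n * n + #|free|).
Proof.
pose t := (d - 2)%N; have tE : t.+1 = d.-1 by rewrite /t -subn1 -subSn // subSS.
have jU z : jac (ustep z t) - 1 \in mpow k n d.-1.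
  by rewrite -tE; apply: ustep_jac; rewrite tE prednK // ltnW.
apply: (@dimension_LU free (fun z => ustep z t)).
- by move=> z; apply: ustep_near.
- exact: ustep_poly.
- by move=> z v; apply: ustep_coef.
move=> phi; split=> [hH|[L uL [z ->]]]; last first.
  have U2 := ustep_near z t.
  apply: (GJac_H char_k d_gt1 n_gt1).
  apply/GJac_amap; first exact/centered_vlin/(near_id_centered _ U2).
  split; first exact: vlin_aut.
  exists (\det L); first by rewrite -unitfE -unitmxE.
  by rewrite jac_vlin -[X in _ - X]mulr1 -mulrBr mpowMl.
have hJ := H_GJac char_k d_gt1 hH; have haut := hJ.1.
have cF := aut_centered d_gt1 haut; have uL := aut_linmx d_gt1 haut.
have [U [U2 FE _]] := linear_unipotent cF uL; set L := linmx _ in uL FE.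
pose z (v : {u | free u}) := (U (val v).1)@_(val v).2; exists L => //; exists z.
have hU : jac U - 1 \in mpow k n d.-1.
  have [c _] := GJac_const d_gt1 hJ; rewrite FE jac_vlin => hc.
  have det_neq0 : \det L != 0 by rewrite -unitfE -unitmxE.
  have hc' : jac U - ((\det L)^-1 * c)%:MP \in mpow k n d.-1.
    have -> : jac U - ((\det L)^-1 * c)%:MP =
        (\det L)^-1%:MP * ((\det L)%:MP * jac U - c%:MP).
      by rewrite mulrBr mulrA -!mpolyCM mulVf // mul1r.
    exact: mpowMl.
  have lt0 : (mdeg (0 : 'X_{1..n})%MM < d.-1)%N by rewrite mdeg0 -tE.
  have /eqP := mpow_coeff0 hc' lt0; rewrite mcoeffB jac_const near_id_linmx //.
  rewrite det1 mcoeffC eqxx mulr1 subr_eq0 => /eqP c1.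
  by move: hc'; rewrite -c1 mpolyC1.
have z2 : near_id 2 (ustep z t) by apply: ustep_near.
have phiE : phi = amap d (vlin L U) by rewrite -FE; apply: aut_amap.
rewrite [LHS]phiE (vlin_linf _ U2) (vlin_linf _ z2).
have -> : amap d U = amap d (ustep z t); last by [].
apply: amap_congr; [exact: near_id_centered U2|exact: near_id_centered z2|].
apply: (jac_unique (c := 1) z2 U2); rewrite ?mpolyC1 //.
move=> u fu; rewrite -[u]/(val (Sub u fu : {u | free u})).
by rewrite ustep_coef.
Qed.

Definition inner_exps := [pred a : 'X_{1..n < d.-1} | (a : 'X_{1..n}) != 0%MM].

Lemma card_inner_exps : #|inner_exps| = ('C(n + d - 2, n) - 1)%N.
Proof.
have dE : d.-1 = (d - 2).+1 by rewrite -subn1 -subSn // subSS.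
have lt0 : (mdeg (0%MM : 'X_{1..n}) < d.-1)%N by rewrite mdeg0 dE.
have -> : #|inner_exps| = #|{: 'X_{1..n < d.-1}}|.-1.
  rewrite [in RHS](cardD1 (BMultinom lt0)) inE /=; apply: eq_card => a.
  by rewrite !inE -val_eqE /= andbT.
by rewrite dE card_bmultinom addnBA // subn1.
Qed.

(** The determined coefficients correspond to the exponents a of the inner
    degrees, through a |-> (i0, a + e_i0). *)
Lemma card_higher : #|higher| = (#|free| + ('C(n + d - 2, n) - 1))%N.
Proof.
rewrite -(cardID free higher) -card_inner_exps; congr (_ + _)%N.
  by apply: eq_card => u; rewrite !inE -!topredE /= /free; case: higher.
have lt_f (a : 'X_{1..n < d.-1}) : (mdeg (a + U_(i0))%MM < d)%N.
  by rewrite mdegD mdeg1 addn1 -ltn_predRL bmdeg.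
pose f (a : 'X_{1..n < d.-1}) : coef_index := (i0, BMultinom (lt_f a)).
have f_inj : injective f.
  move=> a b eq_f; apply: val_inj; apply: (@addIm n U_(i0)%MM).
  exact: (congr1 (fun u : coef_index => val u.2) eq_f).
rewrite -(card_image f_inj).
apply: eq_card => u; rewrite inE /=; apply/andP/imageP => [[nfree high]|[a a_neq0 ->]].
  have := nfree; rewrite -topredE /= /free (high : higher u) /= negbK => /andP[/eqP u1 u2].
  have uE : (u.2 - U_(i0) + U_(i0))%MM = u.2 by rewrite submK // lep1mP -lt0n.
  have lt_a : (mdeg (u.2 - U_(i0))%MM < d.-1)%N.
    by rewrite ltn_predRL; have := bmdeg u.2; rewrite -{1}uE mdegD mdeg1 addn1.
  exists (BMultinom lt_a).
    have deg_a : (mdeg (u.2 - U_(i0))%MM).+1 = mdeg u.2.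
      by rewrite -[in RHS]uE mdegD mdeg1 addn1.
    by rewrite inE /= -mdeg_eq0 -lt0n -ltnS deg_a.
  rewrite [LHS]surjective_pairing u1 /f; congr (i0, _).
  by apply: val_inj; rewrite /= uE.
have high : higher (f a).
  by rewrite /higher /= mdegD mdeg1 addn1 ltnS lt0n mdeg_eq0.
by rewrite -!topredE /= /free high /= eqxx mnmDE mnm1E eqxx addn1.
Qed.

End ConstantJacobian.

Theorem codimension_H :
  has_codimension_in H (@is_aut k n d) ('C(n + d - 2, n) - 1)%N.
Proof.
pose i0 := Ordinal (ltnW n_gt1); exists (n * n + #|free i0|)%N.
split; first exact: dimension_H.
by rewrite -addnA -card_higher; apply: dimension_aut.
Qed.

Lemma inner_rootP alpha : inner_root k d alpha <->
  exists2 a : 'X_{1..n < d.-1}, (a : 'X_{1..n}) != 0%MM & alpha = expZ a.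
Proof.
pose i0 := Ordinal (ltnW n_gt1).
split=> [[[a_neq0 [D D_neq0 hD]] nneg]|[a a_neq0 ->]]; last first.
  split; last by move=> i; rewrite ffunE.
  rewrite -(eroot_shift i0); apply: (eroot_jet_root k d_gt1).
  - rewrite eroot_shift; apply: contra_neq a_neq0 => eq0; apply: expZ_inj.
    by rewrite eq0; apply/ffunP => i; rewrite !ffunE mnm0E.
  - by rewrite mnmD_eq0 (negPf a_neq0).
  by rewrite mdegD mdeg1 addn1 -ltn_predRL bmdeg.
have [a eq_a] := expZ_nonneg nneg.
have lt_a : (mdeg a < d.-1)%N.
  rewrite ltnNge; apply: contra D_neq0 => ge_a; apply/eqP.
  apply: der_ext; [exact: hD.1|by case: (piece0 k d (0 : Zn))|move=> i].
  have [c ->] := piece_gen i hD; rewrite eq_a -expZD xmon_exp zero_lfunE.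
  rewrite (_ : jpi d _ = 0) ?scaler0 //; apply/jpi_eq0.
  apply: mpow_leq (mpowX _ _); rewrite mdegD mdeg1 add1n.
  by rewrite -(prednK (ltnW d_gt1)).
exists (BMultinom lt_a) => //=; apply: contra_neq a_neq0 => a0.
by rewrite eq_a a0; apply/ffunP => i; rewrite !ffunE mnm0E.
Qed.

Theorem inner_roots_count : exists s : seq Zn,
  [/\ uniq s, forall alpha, alpha \in s <-> inner_root k d alpha
    & size s = ('C(n + d - 2, n) - 1)%N].
Proof.
exists [seq expZ (val a) | a in inner_exps]; split.
- rewrite map_inj_in_uniq ?enum_uniq // => a b _ _ /expZ_inj eq_ab.
  exact: val_inj.
- move=> alpha; split=> [/imageP[a a_neq0 ->]|/inner_rootP[a a_neq0 ->]].
    by apply/inner_rootP; exists a.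
  by apply/imageP; exists a.
by rewrite size_map -cardE card_inner_exps.
Qed.

End Dimensions.

Theorem proposition5p4 (k : closedFieldType) (n d : nat)
    (char_k : [pchar k] =i pred0) (n_ge2 : (2 <= n)%N) (d_ge2 : (2 <= d)%N) :
  [/\ forall phi : 'End(jet k n d), subgroupH phi <-> GJac phi,
      internal_direct_sum
        (fun alpha : {ffun 'I_n -> int} => alpha = 0 \/ jet_root k d alpha)
        (@LieH_piece k n d)
        (Lie (@subgroupH k n d)),
      has_codimension_in (@subgroupH k n d) (@is_aut k n d)
        ('C(n + d - 2, n) - 1)%N
    & exists s : seq {ffun 'I_n -> int},
        [/\ uniq s, forall alpha, alpha \in s <-> inner_root k d alpha
          & size s = ('C(n + d - 2, n) - 1)%N]].
Proof.
split.
- by move=> phi; split; [apply: H_GJac | apply: GJac_H].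
- exact: Lie_H_direct_sum.
- exact: codimension_H.
- exact: inner_roots_count.
Qed.
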